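(* Let $\boldsymbol{\ell}=(\ell_{\mathbf{u}\mathbf{v}})$ be the set of edge lengths for an octahedron such that $0<\ell_{\mathbf{u}\mathbf{v}}<\pi$ for all edges $\mathbf{u}\mathbf{v}$, $$\ell_{\mathbf{a}_1\mathbf{a}_2}=\ell_{\mathbf{a}_1\mathbf{b}_2}=\ell_{\mathbf{b}_1\mathbf{a}_2}=\ell_{\mathbf{b}_1\mathbf{b}_2}=\frac{\pi}{2},\quad \ell_{\mathbf{a}_1\mathbf{a}_3}=\ell_{\mathbf{a}_1\mathbf{b}_3},\quad \ell_{\mathbf{b}_1\mathbf{a}_3}=\ell_{\mathbf{b}_1\mathbf{b}_3},\quad \ell_{\mathbf{a}_2\mathbf{a}_3}+\ell_{\mathbf{a}_2\mathbf{b}_3}=\ell_{\mathbf{b}_2\mathbf{a}_3}+\ell_{\mathbf{b}_2\mathbf{b}_3}=\pi,$$ and the cosines $p_1=\cos\ell_{\mathbf{a}_1\mathbf{a}_3}$, $p_2=\cos\ell_{\mathbf{b}_1\mathbf{a}_3}$, $q_1=\cos\ell_{\mathbf{a}_2\mathbf{a}_3}$, $q_2=\cos\ell_{\mathbf{b}_2\mathbf{a}_3}$ satisfy $|p_1|<|p_2|$, $|q_1|<|q_2|$ and $p_2^2+q_2^2<1$. Put $\theta_{\min}=\arcsin|q_2|$ and $\theta_{\max}=\arccos|p_2|$. Then the configuration space $\Sigma=\Sigma(\boldsymbol{\ell})$ has a unique essential one-dimensional irreducible component $\Gamma$, which consists of two connected components $\Gamma_+$ and $\Gamma_-$. For either connected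 component $\Gamma_\pm$, the corresponding flexion of the octahedron, up to rotation of $\mathbb{S}^3$, is given by the formulae $$\begin{aligned} \mathbf{a}_1&=\Bigl(\tfrac{p_1}{\cos\theta},\delta_1\sqrt{1-\tfrac{p_1^2}{\cos^2\theta}},0,0\Bigr),& \mathbf{b}_1&=\Bigl(\tfrac{p_2}{\cos\theta},\delta_2\sqrt{1-\tfrac{p_2^2}{\cos^2\theta}},0,0\Bigr),\\ \mathbf{a}_2&=\Bigl(0,0,\tfrac{q_1}{\sin\theta},\varepsilon_1\sqrt{1-\tfrac{q_1^2}{\sin^2\theta}}\Bigr),& \mathbf{b}_2&=\Bigl(0,0,\tfrac{q_2}{\sin\theta},\varepsilon_2\sqrt{1-\tfrac{q_2^2}{\sin^2\theta}}\Bigr),\\ \mathbf{a}_3&=(\cos\theta,0,\sin\theta,0),&\mathbf{b}_3&=(\cos\theta,0,-\sin\theta,0), \end{aligned}\qquad \delta_1,\delta_2,\varepsilon_1,\varepsilon_2\in\{-1,1\},$$ where the signs $\delta_1$ and $\varepsilon_1$ remain unchanged during the flexion, the sign $\delta_2$ changes when $\theta=\theta_{\max}$, and the sign $\varepsilon_2$ changes when $\theta=\theta_{\min}$. Thus $\Gamma_\pm$ projects $4$-fold (at interior points) onto the segment $[\theta_{\min},\theta_{\max}]$. The component $\Gamma_+$ corresponds to $\delta_1\varepsilon_1=1$ and the component $\Gamma_-$ corresponds to $\delta_1\varepsilon_1=-1$. Moreover, all (real) points of $\Gamma$ are smooth and all coordinates of vertices of the flexible octahedron given by the formulae above are real analytic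 functions on $\Gamma$.
   Context: **Octahedra.** $\mathbb{S}^3$ is the unit sphere centered at the origin in Euclidean space $\mathbb{E}^4$. An octahedron in $\mathbb{S}^3$ is a (possibly self-intersecting) polyhedral surface with the combinatorial type of a regular octahedron: it has 6 vertices $\mathbf{a}_1,\mathbf{a}_2,\mathbf{a}_3,\mathbf{b}_1,\mathbf{b}_2,\mathbf{b}_3$, 12 edges (shortest great-circle arcs) joining all pairs of vertices except the three pairs $\{\mathbf{a}_i,\mathbf{b}_i\}$, and 8 triangular faces $\mathbf{u}_1\mathbf{u}_2\mathbf{u}_3$ with $\mathbf{u}_i\in\{\mathbf{a}_i,\mathbf{b}_i\}$. All faces are non-degenerate (the vertices of a face do not lie on a great circle). **Oriented dihedral angles.** Orient the surface so that the face $\mathbf{a}_1\mathbf{a}_2\mathbf{a}_3$ has the orientation given by this order of vertices. Let $\mathbf{u}\mathbf{v}$ be an edge, $\mathbf{u}\mathbf{v}\mathbf{w}_1$, $\mathbf{u}\mathbf{v}\mathbf{w}_2$ the two faces containing it, and $\mathbf{p}$ a point on it. Let $\mathbf{m}_i\in T_{\mathbf{p}}\mathbb{S}^3$ be the exterior unit normal to the face $\mathbf{u}\mathbf{v}\mathbf{w}_i$ (the orientation of the normal followed by the positive orientation of the face is the positive orientation of $\mathbb{S}^3$) and $\mathbf{n}_i\in T_{\mathbf{p}}\mathbb{S}^3$ the unit vector orthogonal to the edge, tangent to the face $\mathbf{u}\mathbf{v}\mathbf{w}_i$ and pointing inside it. Choose the positive direction of rotation around $\mathbf{u}\mathbf{v}$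 so that $\mathbf{n}_1$ is obtained from $\mathbf{m}_1$ by rotation through $\pi/2$ in the positive direction. The oriented dihedral angle $\varphi_{\mathbf{u}\mathbf{v}}\in\mathbb{R}/2\pi\mathbb{Z}$ is the rotation angle from $\mathbf{n}_1$ to $\mathbf{n}_2$ in this direction. Put $t_{\mathbf{u}\mathbf{v}}=\tan(\varphi_{\mathbf{u}\mathbf{v}}/2)\in\mathbb{R}\cup\{\infty\}=\mathbb{RP}^1$. **Configuration space.** Sets of edge lengths $\boldsymbol{\ell}$ are always such that for each face the three lengths are side lengths of a non-degenerate spherical triangle (each in $(0,\pi)$, strict triangle inequalities, sum less than $2\pi$). Then $\boldsymbol{\ell}$ determines all angles of faces. For each vertex $\mathbf{u}$ and each face $\mathbf{u}\mathbf{v}_1\mathbf{v}_2$ containing it, let $\mathbf{u}\mathbf{v}_1\mathbf{v}_2,\mathbf{u}\mathbf{v}_2\mathbf{v}_3,\mathbf{u}\mathbf{v}_3\mathbf{v}_4,\mathbf{u}\mathbf{v}_4\mathbf{v}_1$ be the four faces at $\mathbf{u}$ in cyclic order and $\alpha=\angle\mathbf{v}_1\mathbf{u}\mathbf{v}_2$, $\beta=\angle\mathbf{v}_2\mathbf{u}\mathbf{v}_3$, $\gamma=\angle\mathbf{v}_3\mathbf{u}\mathbf{v}_4$, $\delta=\angle\mathbf{v}_4\mathbf{u}\mathbf{v}_1$. Writing $t_{\mathbf{u}\mathbf{v}_i}=(X_i:Y_i)$, one has the equation $$AX_1^2X_2^2+BX_1^2Y_2^2+2CX_1Y_1X_2Y_2+DY_1^2X_2^2+EY_1^2Y_2^2=0,$$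 $A=\cos\gamma-\cos(\alpha+\beta+\delta)$, $B=\cos\gamma-\cos(\alpha-\beta+\delta)$, $D=\cos\gamma-\cos(\alpha+\beta-\delta)$, $E=\cos\gamma-\cos(\alpha-\beta-\delta)$, $C=-2\sin\beta\sin\delta$. The configuration space $\Sigma(\boldsymbol{\ell})\subset(\mathbb{RP}^1)^{12}$ is the algebraic variety in the 12 variables $t_{\mathbf{u}\mathbf{v}}$ given by these 24 equations (one for each pair of edges lying in a common face). Its points are in one-to-one correspondence with octahedra with edge lengths $\boldsymbol{\ell}$ up to rotations of $\mathbb{S}^3$. A one-dimensional irreducible component $\Gamma$ of $\Sigma(\boldsymbol{\ell})$ is essential if no $t_{\mathbf{u}\mathbf{v}}$ is identically $0$ or identically $\infty$ on $\Gamma$. The rotation by $\pi$ about the great circle $x_2=x_4=0$ reverses all four signs $\delta_1,\delta_2,\varepsilon_1,\varepsilon_2$ simultaneously, so quadruples of signs differing by a simultaneous reversal correspond to the same point of $\Sigma$; when vertex coordinates are regarded as functions on $\Gamma$, the value of $\delta_1$ is fixed.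
   Formalization: Σ(ℓ) is taken as the solutions of the 24 equations that come from an actual octahedron with edge lengths ℓ; the 24 equations alone have a second essential one-dimensional component, corresponding to no octahedron, so uniqueness of Γ would fail. *)

(* Defs.v *)
From HB Require Import structures.
From mathcomp Require Import all_boot all_order all_algebra.
From mathcomp Require Import all_classical all_reals all_analysis.
(* The notations of mpoly clash with those of MathComp-Analysis. *)
From mathcomp Require Import -(notations) mpoly.

Set Implicit Arguments.
Unset Strict Implicit.
Unset Printing Implicit Defensive.

Import Order.TTheory GRing.Theory Num.Theory.
Import numFieldNormedType.Exports.

Local Open Scope classical_set_scope.
Local Open Scope ring_scope.

(** * Combinatorics of the octahedron *)

(* [(i, false)] is a_(i+1) and [(i, true)] is b_(i+1). *)
Definition vertex : Type := ('I_3 * bool)%type.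

Definition a1 : vertex := (@Ordinal 3 0 isT, false).
Definition a2 : vertex := (@Ordinal 3 1 isT, false).
Definition a3 : vertex := (@Ordinal 3 2 isT, false).
Definition b1 : vertex := (@Ordinal 3 0 isT, true).
Definition b2 : vertex := (@Ordinal 3 1 isT, true).
Definition b3 : vertex := (@Ordinal 3 2 isT, true).

Definition opp (u : vertex) : vertex := (u.1, ~~ u.2).

Definition adjacent (u v : vertex) : bool := u.1 != v.1.

Definition is_face (u v w : vertex) : bool := uniq [:: u.1; v.1; w.1].

(* The edge [(k, s, s')] joins [(k + 1, s)] to [(k + 2, s')], indices mod 3. *)
Definition edge : Type := ('I_3 * bool * bool)%type.

(* Symmetric in [u] and [v]; meaningful only when [adjacent u v]. *)
Definition edge_of (u v : vertex) : edge :=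
  if v.1 == ordS u.1 then (ordS v.1, u.2, v.2) else (ordS u.1, v.2, u.2).

(* For a face, whether the order [u, v, w] of its vertices is the positive
   orientation of the surface: [a1 a2 a3] is positive, and replacing one vertex
   by its opposite gives an adjacent face, hence reverses the sign. *)
Definition positively_ordered (u v w : vertex) : bool :=
  (v.1 == ordS u.1) (+) u.2 (+) v.2 (+) w.2.

Section Octahedra.
Variable R : realType.

(** * Octahedra in the sphere and their dihedral angles *)

Definition dot (x y : 'rV[R]_4) : R := (x *m y^T) 0 0.

Definition vec4 (x1 x2 x3 x4 : R) : 'rV[R]_4 :=
  \row_(i < 4) [:: x1; x2; x3; x4]`_i.

Definition mx_of_rows n (s : seq 'rV[R]_n) : 'M[R]_(size s, n) :=
  \matrix_(i < size s) s`_i.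

Definition octahedron : Type := vertex -> 'rV[R]_4.

Definition is_octahedron (Q : octahedron) : Prop :=
  (forall u, dot (Q u) (Q u) = 1) /\
  (forall u v w, is_face u v w -> row_free (mx_of_rows [:: Q u; Q v; Q w])).

Definition has_edge_lengths (Q : octahedron) (l : edge -> R) : Prop :=
  forall u v, adjacent u v -> acos (dot (Q u) (Q v)) = l (edge_of u v).

Definition is_rotation (g : 'M[R]_4) : Prop := g *m g^T = 1%:M /\ \det g = 1.

(* The dihedral angle at the edge [u v] is computed at the point p = u (it does
   not depend on p).  The sphere is oriented by: a basis (x, y, z) of its
   tangent space at p is positive iff (p, x, y, z) is positive in R^4.  The
   tangent directions at u of the arcs u v and u w are the projections of v and
   w, which explains the determinant. *)
Definition exterior_normal (Q : octahedron) (u v w : vertex) (m : 'rV[R]_4) :=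
  [/\ dot m m = 1, dot m (Q u) = 0, dot m (Q v) = 0, dot m (Q w) = 0 &
      0 < (-1) ^+ (~~ positively_ordered u v w) *
          \det (mx_of_rows [:: Q u; m; Q v; Q w])].

Definition inward_normal (Q : octahedron) (u v w : vertex) (n : 'rV[R]_4) :=
  [/\ dot n n = 1, dot n (Q u) = 0, dot n (Q v) = 0 &
      exists a b c : R, 0 < c /\ n = a *: Q u + b *: Q v + c *: Q w].

(* The faces at the edge [u v] are [u v w] and [u v (opp w)].  In the direction
   that takes m1 to n1 by a quarter turn, the rotation through phi takes n1 to
   cos phi n1 - sin phi m1. *)
Definition dihedral_angle (Q : octahedron) (u v w : vertex) (phi : R) : Prop :=
  exists m1 n1 n2, [/\ exterior_normal Q u v w m1, inward_normal Q u v w n1,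
    inward_normal Q u v (opp w) n2 & n2 = cos phi *: n1 - sin phi *: m1].

(** * The space (RP^1)^12 *)

(* [Some x] is (x : 1) and [None] is (1 : 0). *)
Definition RP1 := one_point_compactification R.

Definition RP1_12 := prod_topology (fun _ : edge => RP1).

(* The pair (X, Y) of homogeneous coordinates, selected by [false], [true]. *)
Definition hcoord (t : RP1) (i : bool) : R :=
  if t is Some x then (if i then 1 else x) else (if i then 0 else 1).

Definition half_tan (phi : R) : RP1 :=
  if cos (phi / 2) == 0 then None else Some (tan (phi / 2)).

Definition has_half_tans (Q : octahedron) (t : RP1_12) : Prop :=
  forall u v w, is_face u v w ->
    exists2 phi, dihedral_angle Q u v w phi & t (edge_of u v) = half_tan phi.

(** * The configuration space *)

Definition nondegenerate_lengths (l : edge -> R) : Prop :=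
  forall u v w, is_face u v w ->
    let x := l (edge_of u v) in let y := l (edge_of v w) in
    let z := l (edge_of w u) in
    [/\ 0 < x < pi, x < y + z & x + y + z < 2 * pi].

(* The angle at [u] of the face [u v w], by the spherical law of cosines. *)
Definition face_angle (l : edge -> R) (u v w : vertex) : R :=
  acos ((cos (l (edge_of v w)) - cos (l (edge_of u v)) * cos (l (edge_of u w)))
        / (sin (l (edge_of u v)) * sin (l (edge_of u w)))).

Definition link_equation (l : edge -> R) (t : RP1_12) (u v1 v2 : vertex) :=
  let v3 := opp v1 in let v4 := opp v2 in
  let alpha := face_angle l u v1 v2 in let beta := face_angle l u v2 v3 in
  let gamma := face_angle l u v3 v4 in let delta := face_angle l u v4 v1 in
  let A := cos gamma - cos (alpha + beta + delta) in
  let B := cos gamma - cos (alpha - beta + delta) in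
  let D := cos gamma - cos (alpha + beta - delta) in
  let E := cos gamma - cos (alpha - beta - delta) in
  let C := - 2 * sin beta * sin delta in
  let X1 := hcoord (t (edge_of u v1)) false in
  let Y1 := hcoord (t (edge_of u v1)) true in
  let X2 := hcoord (t (edge_of u v2)) false in
  let Y2 := hcoord (t (edge_of u v2)) true in
  A * X1 ^+ 2 * X2 ^+ 2 + B * X1 ^+ 2 * Y2 ^+ 2 + 2 * C * X1 * Y1 * X2 * Y2
  + D * Y1 ^+ 2 * X2 ^+ 2 + E * Y1 ^+ 2 * Y2 ^+ 2 = 0.

(* The second condition is not implied by the first: the equations at a vertex
   relate only consecutive edges of its link, and for some lengths they have
   common solutions for which the link does not close up. *)
Definition config_space (l : edge -> R) : set RP1_12 :=
  [set t | (forall u v1 v2, is_face u v1 v2 -> link_equation l t u v1 v2) /\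
           exists Q, [/\ is_octahedron Q, has_edge_lengths Q l &
                         has_half_tans Q t]].

(** * Zariski topology of (RP^1)^12 *)

Definition nvars : nat := #|{: edge * bool}|.

Definition hvar (e : edge) (i : bool) : 'I_nvars := enum_rank (e, i).

Definition hpoint (t : RP1_12) (k : 'I_nvars) : R :=
  hcoord (t (enum_val k).1) (enum_val k).2.

Definition multihomogeneous (p : mpoly nvars R) : Prop :=
  exists d : edge -> nat, forall m, m \in msupp p ->
    forall e, (m (hvar e false) + m (hvar e true))%N = d e.

Definition vanishes_at (p : mpoly nvars R) (t : RP1_12) : Prop :=
  meval (hpoint t) p = 0.

Definition zariski_closed (Z : set RP1_12) : Prop :=
  exists S : set (mpoly nvars R), S `<=` multihomogeneous /\
    Z = [set t | forall p, S p -> vanishes_at p t].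

Definition zariski_irreducible (Z : set RP1_12) : Prop :=
  [/\ zariski_closed Z, Z !=set0 &
      forall Z1 Z2, zariski_closed Z1 -> zariski_closed Z2 ->
        Z `<=` Z1 `|` Z2 -> Z `<=` Z1 \/ Z `<=` Z2].

Definition irreducible_component (S Z : set RP1_12) : Prop :=
  [/\ zariski_irreducible Z, Z `<=` S &
      forall Z', zariski_irreducible Z' -> Z' `<=` S -> Z `<=` Z' -> Z' = Z].

Definition has_chain (Z : set RP1_12) (n : nat) : Prop :=
  exists C : nat -> set RP1_12,
    [/\ forall i, (i <= n)%N -> zariski_irreducible (C i),
        forall i, (i < n)%N -> C i `<` C i.+1 & C n `<=` Z].

Definition has_dimension (Z : set RP1_12) (n : nat) : Prop :=
  has_chain Z n /\ ~ has_chain Z n.+1.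

Definition essential (Z : set RP1_12) : Prop :=
  forall e, ~ (forall t, Z t -> t e = Some 0) /\
            ~ (forall t, Z t -> t e = None).

Definition essential_component (S Z : set RP1_12) : Prop :=
  [/\ irreducible_component S Z, has_dimension Z 1 & essential Z].

(* Derivative of [p] at [t] along the affine coordinate of the [e]-th factor:
   X/Y when [t e] is finite, Y/X when it is infinite.  In that chart the other
   homogeneous coordinate is the constant 1, as in [hcoord]. *)
Definition chart_deriv (p : mpoly nvars R) (t : RP1_12) (e : edge) : R :=
  meval (hpoint t) (mderiv (hvar e (t e == None)) p).

Definition zariski_tangent (Z : set RP1_12) (t : RP1_12) : set (edge -> R) :=
  [set v | forall p, multihomogeneous p -> Z `<=` vanishes_at p ->
             \sum_e chart_deriv p t e * v e = 0].

(* A point of a curve is smooth iff the tangent space there is a line. *)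
Definition smooth_point_of_curve (Z : set RP1_12) (t : RP1_12) : Prop :=
  exists2 v, (exists e, v e != 0) &
    zariski_tangent Z t = [set (fun e => c * v e) | c in [set: R]].

(** * Real analytic functions on a smooth real curve *)

Definition analytic_at (f : R -> R) (x : R) : Prop :=
  exists a : nat -> R,
    \forall y \near x, pseries a (y - x) n @[n --> \oo] --> f y.

(* An affine coordinate on RP^1 around [t0]: t itself, or 1/t when
   [t0 = None]; the value at the missing point is irrelevant. *)
Definition chart (t0 t : RP1) : R :=
  if t0 is Some _ then (if t is Some x then x else 0)
  else (if t is Some x then x^-1 else 0).

Definition local_parametrization (Z : set RP1_12) (t : RP1_12)
    (c : R -> RP1_12) : Prop :=
  c 0 = t /\
  (exists2 r, 0 < r &
    [/\ {in `]-r, r[, continuous c}, {in `]-r, r[ &, injective c} &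
        exists2 U, open U & Z `&` U = c @` `]-r, r[]) /\
  (forall e, analytic_at (fun s => chart (t e) (c s e)) 0) /\
  (exists e, derive1 (fun s => chart (t e) (c s e)) 0 != 0).

Definition analytic_on (Z : set RP1_12) (f : RP1_12 -> R) : Prop :=
  forall t, Z t ->
    exists2 c, local_parametrization Z t c & analytic_at (f \o c) 0.

(** * The explicit family of octahedra *)

Definition is_sign (x : R) : Prop := x = 1 \/ x = -1.

Definition flexed_octahedron (p1 p2 q1 q2 th d1 d2 e1 e2 : R) : octahedron :=
  fun u =>
  match val u.1, u.2 with
  | 0%N, false =>
      vec4 (p1 / cos th) (d1 * Num.sqrt (1 - p1 ^+ 2 / cos th ^+ 2)) 0 0
  | 0%N, true =>
      vec4 (p2 / cos th) (d2 * Num.sqrt (1 - p2 ^+ 2 / cos th ^+ 2)) 0 0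
  | 1%N, false =>
      vec4 0 0 (q1 / sin th) (e1 * Num.sqrt (1 - q1 ^+ 2 / sin th ^+ 2))
  | 1%N, true =>
      vec4 0 0 (q2 / sin th) (e2 * Num.sqrt (1 - q2 ^+ 2 / sin th ^+ 2))
  | _, false => vec4 (cos th) 0 (sin th) 0
  | _, true => vec4 (cos th) 0 (- sin th) 0
  end.

(* One period of the flexion, for tau from 0 to 4.  The parameter theta goes
   from thmin to thmax on [0, 1], back on [1, 2], again up on [2, 3] and down
   on [3, 4]; delta_2 changes at tau = 1, 3, where theta = thmax, and epsilon_2
   at tau = 2, 4, where theta = thmin. *)
Definition loop_theta (thmin thmax tau : R) : R :=
  if tau <= 1 then thmin + tau * (thmax - thmin)
  else if tau <= 2 then thmin + (2 - tau) * (thmax - thmin)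
  else if tau <= 3 then thmin + (tau - 2) * (thmax - thmin)
  else thmin + (4 - tau) * (thmax - thmin).

Definition loop_d2 (tau : R) : R := if 1 < tau < 3 then -1 else 1.

Definition loop_e2 (tau : R) : R := if 2 < tau < 4 then -1 else 1.

End Octahedra.

(* Main.v *)
(* Every octahedron with these edge lengths is congruent to one of the formulae:
   a3 + b3 and a3 - b3 are orthogonal, a1 and b1 are orthogonal to a3 - b3, a2 and
   b2 to a3 + b3, and the lengths pi / 2 make the planes of a1, b1 and of a2, b2
   orthogonal.  So the configuration space itself is a curve.  Let al_i and be_j be
   the signed square roots of cos^2 theta - p_i^2 and sin^2 theta - q_j^2.  The
   half-angle tangents depend only on T = be_1 / al_1, x = al_2 / al_1 and
   y = be_2 / al_1, which satisfy x^2 = 1 - P (1 + T^2) and y^2 = T^2 - Q (1 + T^2)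
   for constants P, Q > 0 with P + Q < 1.  Thus (x, y) lies on the ellipse
   P y^2 + (1 - Q) x^2 = 1 - P - Q and T = +- sqrt ((Q + y^2) / (1 - Q)), which
   never vanishes: there are two ovals, and the sign of T is delta_1 epsilon_1.
   Irreducibility holds because the coordinate ring of the space curve is a domain
   and every infinite subset of the real curve is Zariski dense.  Explicit
   multihomogeneous equations cut out the curve; linearized, they bound the
   dimension of the tangent space by 1, and the angle on the ellipse gives both a
   nonzero tangent vector and a real analytic local parameter. *)

(* Half-angle tangents are carried as pairs (cos, sin) on the unit circle, so that an infinite
   tangent is an ordinary value. The cosines and sines of the dihedral angles are quotients of
   quadratic forms in al and be; by homogeneity the reversal of all four signs is invisible and al_1
   = 1 can be imposed. The main obstacle is that two topologically disjoint ovals form one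
   irreducible set. A polynomial may have infinitely many zeros on one oval only a priori, so
   irreducibility must come from algebra: the norm of the polynomial down to R[T] has infinitely
   many roots, hence is zero, and the signs of x^2 and y^2 as functions of T then force the
   polynomial itself to vanish on the curve. The homogeneous coordinates of a tangent that are
   polynomial in (T, x, y) have zeros in common, so the pair used at each edge is chosen according
   to the point under study. Analyticity of reciprocals and of square roots, the only operations
   beyond ring operations, both follow from a single quadratic fixed point equation for power
   series. *)
Require Import Defs.
From HB Require Import structures.
From mathcomp Require Import all_boot all_order all_algebra.
From mathcomp Require Import all_classical all_reals all_analysis.
From mathcomp Require Import -(notations) mpoly.
From mathcomp Require Import ring lra.
Set Implicit Arguments.
Unset Strict Implicit.
Unset Printing Implicit Defensive.
Import Order.TTheory GRing.Theory Num.Theory.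
Import numFieldNormedType.Exports.
Local Open Scope classical_set_scope.
Local Open Scope ring_scope.

Local Notation opp := Defs.opp.
Local Notation adjacent := Defs.adjacent.

(** * The projective line *)

Section ProjectiveLine.
Variable R : realType.
Implicit Types (c s x phi : R) (t : RP1 R).

(** This is tan (phi / 2) = sin phi / (1 + cos phi), a function of the cosine and the sine that
    requires no choice of phi. *)
Definition half_tan_cs c s : RP1 R := if c == -1 then None else Some (s / (1 + c)).

Lemma half_tanE phi : half_tan phi = half_tan_cs (cos phi) (sin phi).
Proof.
rewrite /half_tan /half_tan_cs /tan.
have e : phi = (phi / 2) *+ 2 by rewrite -mulr_natr divfK.
rewrite [in cos phi]e [in sin phi]e cos_mulr2n sin_mulr2n.
set C := cos (phi / 2); set S := sin (phi / 2).
have -> : (C ^+ 2 *+ 2 - 1 == -1) = (C == 0).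
  by rewrite -[RHS]sqrf_eq0; apply/eqP/eqP => h; lra.
have [//|C0] := eqVneq C 0.
have -> : 1 + (C ^+ 2 *+ 2 - 1) = 2 * C ^+ 2 by lra.
by congr Some; rewrite -mulr_natl; field.
Qed.

Lemma unit_circle_bound c s : c ^+ 2 + s ^+ 2 = 1 -> -1 <= c <= 1.
Proof. by move=> h; have := sqr_ge0 s => s0; apply/andP; split; nra. Qed.

Lemma cos_sin_angle c s : c ^+ 2 + s ^+ 2 = 1 ->
  exists phi, cos phi = c /\ sin phi = s.
Proof.
move=> h; have c1 := unit_circle_bound h.
have ss : Num.sqrt (1 - c ^+ 2) = `|s| by rewrite -sqrtr_sqr; congr Num.sqrt; lra.
have [s0|s0] := leP 0 s.
  by exists (acos c); rewrite acosK ?inE//= sin_acos// ss ger0_norm.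
by exists (- acos c); rewrite cosN sinN acosK ?inE//= sin_acos// ss ltr0_norm ?opprK.
Qed.

Lemma sin0_of_cosN1 c s : c ^+ 2 + s ^+ 2 = 1 -> c = -1 -> s = 0.
Proof. by move=> h c1; apply/eqP; rewrite -sqrf_eq0; apply/eqP; rewrite c1 in h; lra. Qed.

(** Both (s : 1 + c) and (1 - c : s) represent the tangent; the first pair degenerates at c = -1,
    the second at c = 1. The factors to the standard coordinates are explicit because [poly_coordsE]
    needs them. *)
Lemma hcoord_half_tan_cs c s : c ^+ 2 + s ^+ 2 = 1 ->
  let X := hcoord (half_tan_cs c s) false in
  let Y := hcoord (half_tan_cs c s) true in
  [/\ s = (1 + c) * X, 1 + c = (1 + c) * Y,
      (c != -1 -> 1 - c = s * X /\ s = s * Y) &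
      (c = -1 -> 1 - c = 2 * X /\ s = 2 * Y)].
Proof.
move=> h; rewrite /half_tan_cs; case: eqVneq => [c1|c1] /=.
  by rewrite (sin0_of_cosN1 h c1) c1; split => // *; lra.
have c1' : 1 + c != 0 by rewrite addrC -[1]opprK subr_eq0.
split=> [||_|/eqP]; rewrite ?mulr1 ?(negPf c1)//; first by field.
by split; [apply: (mulIf c1'); rewrite -mulrA divfK//; lra|].
Qed.

(** The half-angle formulae in homogeneous form, which stay valid at infinity. *)
Lemma half_tan_cs_quad c s : c ^+ 2 + s ^+ 2 = 1 ->
  let X := hcoord (half_tan_cs c s) false in
  let Y := hcoord (half_tan_cs c s) true in
  [/\ 0 < X ^+ 2 + Y ^+ 2, Y ^+ 2 - X ^+ 2 = c * (X ^+ 2 + Y ^+ 2) &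
      2 * X * Y = s * (X ^+ 2 + Y ^+ 2)].
Proof.
move=> h; rewrite /half_tan_cs; case: eqVneq => [c1|c1] /=.
  by rewrite (sin0_of_cosN1 h c1) c1; split => //; lra.
have c1' : 1 + c != 0 by rewrite addrC -[1]opprK subr_eq0.
have := sqr_ge0 (s / (1 + c)); split; first by lra.
  have -> : (s / (1 + c)) ^+ 2 = (1 - c) / (1 + c).
    have -> : 1 - c = s ^+ 2 / (1 + c) by apply: (mulIf c1'); rewrite divfK//; lra.
    by field.
  by field.
have -> : (s / (1 + c)) ^+ 2 = (1 - c) / (1 + c).
  have -> : 1 - c = s ^+ 2 / (1 + c) by apply: (mulIf c1'); rewrite divfK//; lra.
  by field.
by field.
Qed.

(** Two equations are required: the first is void at c = -1, the second at c = 1. *)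
Lemma half_tan_cs_unique c s t : c ^+ 2 + s ^+ 2 = 1 ->
  (1 + c) * hcoord t false = s * hcoord t true ->
  s * hcoord t false = (1 - c) * hcoord t true -> t = half_tan_cs c s.
Proof.
move=> h; rewrite /half_tan_cs; case: eqVneq => [c1|c1].
  rewrite (sin0_of_cosN1 h c1) c1.
  by case: t => [x|]//= _ hx; exfalso; lra.
have c1' : 1 + c != 0 by rewrite addrC -[1]opprK subr_eq0.
case: t => [x|]/=; last by rewrite mulr1 mulr0 => /eqP; rewrite (negPf c1').
by rewrite mulr1 => <- _; congr Some; field.
Qed.

Lemma half_tan_cs_neq c s : c ^+ 2 + s ^+ 2 = 1 -> s != 0 ->
  half_tan_cs c s <> Some 0 /\ half_tan_cs c s <> None.
Proof.
move=> h s0; rewrite /half_tan_cs; case: eqVneq => [c1|c1].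
  by rewrite (sin0_of_cosN1 h c1) eqxx in s0.
have c1' : 1 + c != 0 by rewrite addrC -[1]opprK subr_eq0.
by split=> // -[] /eqP; rewrite mulf_eq0 invr_eq0 (negPf s0) (negPf c1').
Qed.

(* Division by zero makes these hold also at the missing points. *)
Lemma chart_some x c s : chart (Some x) (half_tan_cs c s) = s / (1 + c).
Proof.
rewrite /chart /half_tan_cs; case: eqVneq => [->|//].
by rewrite subrr invr0 mulr0.
Qed.

Lemma chart_none c s : c ^+ 2 + s ^+ 2 = 1 ->
  chart None (half_tan_cs c s) = s / (1 - c).
Proof.
move=> h; rewrite /chart /half_tan_cs; case: eqVneq => [c1|c1].
  by rewrite (sin0_of_cosN1 h c1) mul0r.
have c1' : 1 + c != 0 by rewrite addrC -[1]opprK subr_eq0.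
rewrite invf_div; have [->|s0] := eqVneq s 0; first by rewrite invr0 mulr0 mul0r.
have c2 : 1 - c != 0.
  by apply: contraNneq s0 => c2; rewrite -sqrf_eq0; apply/eqP; nra.
by apply: (mulIf s0); rewrite divfK// mulrAC -expr2; apply: (mulIf c2); rewrite divfK//; lra.
Qed.

Lemma continuous_half_tan_cs (X : topologicalType) (f g : X -> R) (a : X) :
  (forall u, f u ^+ 2 + g u ^+ 2 = 1) -> {for a, continuous f} ->
  {for a, continuous g} -> {for a, continuous (fun u => half_tan_cs (f u) (g u))}.
Proof.
move=> h cf cg; have [fa|fa] := eqVneq (f a) (-1); last first.
  have nfa : \forall u \near a, f u != -1.
    apply: (cf [set x | x != -1]); apply: open_nbhs_nbhs; split => //; exact: open_neq.
  have fa' : 1 + f a != 0 by rewrite addrC -[1]opprK subr_eq0.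
  have cq : (fun u => g u / (1 + f u)) @ a --> g a / (1 + f a).
    apply: cvgM; [exact: cg|apply: cvgV => //; apply: cvgD; [exact: cvg_cst|exact: cf]].
  have cS : (fun u => Some (g u / (1 + f u)) : RP1 R) @ a --> (Some (g a / (1 + f a)) : RP1 R).
    apply: (cvg_comp _ _ cq); exact: one_point_compactification_some_continuous.
  rewrite /prop_for /continuous_at [half_tan_cs (f a) _]/half_tan_cs (negPf fa).
  apply: cvg_trans cS; apply: near_eq_cvg.
  by near=> u; rewrite /half_tan_cs ifN//; near: u.
rewrite /prop_for /continuous_at [half_tan_cs (f a) _]/half_tan_cs fa eqxx => A [K [cK clK] KA].
(* A neighbourhood of infinity contains the complement of a compact, hence bounded, set. The square
   of the tangent is (1 - f) / (1 + f), which exceeds N^2 as soon as (N^2 + 1) (1 + f) < 2. *)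
have [M [Mr HM]] := compact_bounded cK.
set N := `|M| + 1.
have N1 : M < N by rewrite /N (le_lt_trans (ler_norm M))// ltrDl.
have N0 : 0 < N ^+ 2 + 1 by have := sqr_ge0 N; lra.
have near1 : \forall u \near a, (N ^+ 2 + 1) * (1 + f u) < 2.
  have : (fun u => (N ^+ 2 + 1) * (1 + f u)) @ a --> (N ^+ 2 + 1) * (1 + f a).
    apply: cvgM; [exact: cvg_cst|apply: cvgD; [exact: cvg_cst|exact: cf]].
  by rewrite fa subrr mulr0 => /cvgr_lt; apply; lra.
apply: filterS near1 => u hu; apply: KA; rewrite /half_tan_cs.
case: eqVneq => [//|fu]; [by right|left; exists (g u / (1 + f u)) => // Ku].
have fu1 : 0 < 1 + f u.
  have /andP[h1 _] := unit_circle_bound (h u); rewrite lt_neqAle eq_sym.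
  by rewrite addrC -[1]opprK subr_eq0 fu/= subr_ge0.
have := HM _ N1 _ Ku => /= le_N.
have : (g u / (1 + f u)) ^+ 2 <= N ^+ 2.
  by rewrite -[(_ / _) ^+ 2]ger0_norm ?sqr_ge0// normrX lerXn2r ?nnegrE// /N; have := normr_ge0 M; lra.
have -> : (g u / (1 + f u)) ^+ 2 = (1 - f u) / (1 + f u).
  have -> : 1 - f u = g u ^+ 2 / (1 + f u).
    by apply: (mulIf (lt0r_neq0 fu1)); rewrite divfK ?lt0r_neq0//; have := h u; lra.
  by field; rewrite lt0r_neq0.
by rewrite ler_pdivrMr//; nra.
Unshelve. all: by end_near. Qed.

End ProjectiveLine.

(** * Determinants and dihedral angles *)

Section Vectors.
Variable R : realType.
Implicit Types (a b c d x y z : 'rV[R]_4) (k : R).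

Definition dt3 (a1 a2 a3 b1 b2 b3 c1 c2 c3 : R) :=
  a1 * (b2 * c3 - b3 * c2) - a2 * (b1 * c3 - b3 * c1) + a3 * (b1 * c2 - b2 * c1).

Definition dt4 (a1 a2 a3 a4 b1 b2 b3 b4 c1 c2 c3 c4 d1 d2 d3 d4 : R) :=
  a1 * dt3 b2 b3 b4 c2 c3 c4 d2 d3 d4 - a2 * dt3 b1 b3 b4 c1 c3 c4 d1 d3 d4
  + a3 * dt3 b1 b2 b4 c1 c2 c4 d1 d2 d4 - a4 * dt3 b1 b2 b3 c1 c2 c3 d1 d2 d3.

Lemma mx_nat n (A : 'M[R]_n.+1) :
  exists2 m : nat -> nat -> R, forall i j, A i j = m i j &
    forall i j : nat, A (inord i) (inord j) = m (inord i : 'I_n.+1) (inord j : 'I_n.+1).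
Proof. by exists (fun i j => A (inord i) (inord j)) => *; rewrite !inord_val. Qed.

Lemma det_mx2 (A : 'M[R]_2) : let m i j := A (inord i) (inord j) in
  \det A = m 0 0 * m 1 1 - m 0 1 * m 1 0.
Proof.
have [m mE mI] := mx_nat A; rewrite /= !mI !inordK// {mI}.
rewrite (expand_det_row _ ord0) !big_ord_recl big_ord0 /cofactor !det_mx11 !mxE !mE /=.
by rewrite /bump /= !(expr0, expr1, addr0); ring.
Qed.

Lemma det_mx3 (A : 'M[R]_3) : let m i j := A (inord i) (inord j) in
  \det A = dt3 (m 0 0) (m 0 1) (m 0 2) (m 1 0) (m 1 1) (m 1 2)
               (m 2 0) (m 2 1) (m 2 2).
Proof.
have [m mE mI] := mx_nat A; rewrite /= !mI !inordK// {mI}.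
rewrite (expand_det_row _ ord0) !big_ord_recl big_ord0 /cofactor !det_mx2 !mxE !mE /=.
rewrite /bump /= !inordK//= /dt3 !(expr0, expr1, addr0).
by ring.
Qed.

Lemma det_mx4 (A : 'M[R]_4) : let m i j := A (inord i) (inord j) in
  \det A = dt4 (m 0 0) (m 0 1) (m 0 2) (m 0 3) (m 1 0) (m 1 1) (m 1 2) (m 1 3)
               (m 2 0) (m 2 1) (m 2 2) (m 2 3) (m 3 0) (m 3 1) (m 3 2) (m 3 3).
Proof.
have [m mE mI] := mx_nat A; rewrite /= !mI !inordK// {mI}.
rewrite (expand_det_row _ ord0) !big_ord_recl big_ord0 /cofactor !det_mx3 !mxE !mE /=.
rewrite /bump /= !inordK//= /dt4 /dt3 !(expr0, expr1, addr0).
by ring.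
Qed.

(* Locked, so that [ring] does not try to unify distinct coordinates by
   computing with ordinals. *)
Definition co : 'rV[R]_4 -> nat -> R := locked (fun x i => x 0 (inord i)).

Lemma coE x i : co x i = x 0 (inord i). Proof. by rewrite /co -lock. Qed.

Lemma coP x y : (forall i, (i < 4)%N -> co x i = co y i) -> x = y.
Proof.
by move=> h; apply/rowP => i; have := h i (ltn_ord i); rewrite !coE inord_val.
Qed.

Lemma coD x y i : co (x + y) i = co x i + co y i. Proof. by rewrite !coE mxE. Qed.
Lemma coN x i : co (- x) i = - co x i. Proof. by rewrite !coE mxE. Qed.
Lemma coZ k x i : co (k *: x) i = k * co x i. Proof. by rewrite !coE mxE. Qed.
Lemma co_vec4 (x1 x2 x3 x4 : R) i : (i < 4)%N ->
  co (vec4 x1 x2 x3 x4) i = [:: x1; x2; x3; x4]`_i.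
Proof. by move=> i4; rewrite coE mxE inordK. Qed.

Lemma dotE x y :
  dot x y = co x 0 * co y 0 + co x 1 * co y 1 + co x 2 * co y 2 + co x 3 * co y 3.
Proof.
have E (z : 'rV[R]_4) i : z 0 i = co z i by rewrite coE inord_val.
by rewrite /dot !mxE !big_ord_recl big_ord0 !mxE !E /= addr0 !addrA.
Qed.

Definition det4 a b c d := \det (mx_of_rows [:: a; b; c; d]).

Lemma det4E a b c d : det4 a b c d =
  dt4 (co a 0) (co a 1) (co a 2) (co a 3) (co b 0) (co b 1) (co b 2) (co b 3)
      (co c 0) (co c 1) (co c 2) (co c 3) (co d 0) (co d 1) (co d 2) (co d 3).
Proof. by rewrite /det4 det_mx4 /mx_of_rows !mxE !inordK//= -!coE. Qed.

Definition coords := (det4E, dotE, coD, coN, coZ).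

Lemma dotC x y : dot x y = dot y x. Proof. by rewrite !dotE; ring. Qed.
Lemma dotDl x y z : dot (x + y) z = dot x z + dot y z.
Proof. by rewrite !coords; ring. Qed.
Lemma dotDr x y z : dot z (x + y) = dot z x + dot z y.
Proof. by rewrite !coords; ring. Qed.
Lemma dotNl x z : dot (- x) z = - dot x z. Proof. by rewrite !coords; ring. Qed.
Lemma dotNr x z : dot z (- x) = - dot z x. Proof. by rewrite !coords; ring. Qed.
Lemma dotZl k x z : dot (k *: x) z = k * dot x z. Proof. by rewrite !coords; ring. Qed.
Lemma dotZr k x z : dot z (k *: x) = k * dot z x. Proof. by rewrite !coords; ring. Qed.
Definition dot_lin := (dotDl, dotDr, dotNl, dotNr, dotZl, dotZr).

Lemma dot_eq0 x : dot x x = 0 -> x = 0.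
Proof.
rewrite dotE => h; apply: coP => i i4; rewrite [RHS]coE mxE.
have h0 := sqr_ge0 (co x 0); have h1 := sqr_ge0 (co x 1).
have h2 := sqr_ge0 (co x 2); have h3 := sqr_ge0 (co x 3).
by apply/eqP; rewrite -sqrf_eq0; apply/eqP; case: i i4 => [|[|[|[|//]]]] _; lra.
Qed.

Lemma dot_ext x y : (forall z, dot x z = dot y z) -> x = y.
Proof.
by move=> h; apply/eqP; rewrite -subr_eq0; apply/eqP/dot_eq0; rewrite dotDl dotNl h subrr.
Qed.

Lemma cauchy_schwarz x y : dot x y ^+ 2 <= dot x x * dot y y.
Proof.
rewrite -subr_ge0; set f := fun i j => (co x i * co y j - co x j * co y i) ^+ 2.
have f0 i j : 0 <= f i j by exact: sqr_ge0.
suff -> : dot x x * dot y y - dot x y ^+ 2 =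
    f 0 1 + f 0 2 + f 0 3 + f 1 2 + f 1 3 + f 2 3 by rewrite !addr_ge0.
by rewrite !dotE /f; ring.
Qed.

(** Removes coordinates: determinants only enter through their signs and pairwise products, and the
    products are polynomials in inner products. *)
Lemma det4_mul a b c d x y z t : det4 a b c d * det4 x y z t =
  dt4 (dot a x) (dot a y) (dot a z) (dot a t) (dot b x) (dot b y) (dot b z) (dot b t)
      (dot c x) (dot c y) (dot c z) (dot c t) (dot d x) (dot d y) (dot d z) (dot d t).
Proof.
rewrite /det4 -(det_tr (mx_of_rows [:: x; y; z; t])) -det_mulmx det_mx4.
have E (i j : 'I_4) : (mx_of_rows [:: a; b; c; d] *m (mx_of_rows [:: x; y; z; t])^T) i j =
    dot ([:: a; b; c; d]`_i) ([:: x; y; z; t]`_j).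
  by rewrite /dot !mxE; apply: eq_bigr => k _; rewrite !mxE.
by rewrite !E !inordK.
Qed.

(** The generalized cross product: the vector dual to the linear form x -> det (a, x, b, c), with x
    in the slot that the normal occupies in [exterior_normal]. *)
Definition cross a b c : 'rV[R]_4 := \row_i det4 a (delta_mx 0 i) b c.

Lemma dot_cross a b c x : dot (cross a b c) x = det4 a x b c.
Proof.
have D i j : (i < 4)%N -> (j < 4)%N -> co (delta_mx 0 (inord i)) j = (j == i)%:R.
  by move=> i4 j4; rewrite coE mxE eqxx /= -val_eqE /= !inordK.
rewrite dotE ![co (cross _ _ _) _]coE !mxE !det4E !D//=.
by rewrite /dt4 /dt3; ring.
Qed.

(** The Gram determinant of three unit vectors. *)
Definition gram3 a b c :=
  (1 - dot a b ^+ 2) * (1 - dot a c ^+ 2) - (dot b c - dot a b * dot a c) ^+ 2.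

Lemma dot_cross_cross a b c : dot a a = 1 -> dot b b = 1 -> dot c c = 1 ->
  dot (cross a b c) (cross a b c) = gram3 a b c.
Proof.
move=> ha hb hc.
have -> : dot (cross a b c) (cross a b c) = dt3 (dot a a) (dot a b) (dot a c)
    (dot a b) (dot b b) (dot b c) (dot a c) (dot b c) (dot c c).
  have D i j : (i < 4)%N -> (j < 4)%N -> co (delta_mx 0 (inord i)) j = (j == i)%:R.
    by move=> i4 j4; rewrite coE mxE eqxx /= -val_eqE /= !inordK.
  rewrite [LHS]dotE ![co (cross _ _ _) _]coE !mxE !det4E !D//=.
  by rewrite !dotE /dt4 /dt3; ring.
by rewrite ha hb hc /gram3 /dt3; ring.
Qed.

(* [1 - dot a b ^+ 2] times the inner product of the components of c and d
   orthogonal to the unit vectors a and b. *)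
Definition gram_offdiag a b c d :=
  (1 - dot a b ^+ 2) * dot c d - dot c a * dot d a - dot c b * dot d b
  + dot a b * (dot c a * dot d b + dot c b * dot d a).

Lemma gram_offdiag_diag a b c : dot a a = 1 -> dot b b = 1 -> dot c c = 1 ->
  gram_offdiag a b c c = gram3 a b c.
Proof.
move=> ha hb hc; rewrite /gram_offdiag /gram3 hc (dotC c a) (dotC c b).
by ring.
Qed.

(** Gram-Schmidt: the component of c orthogonal to a and b, divided by its norm, whose square is
    [gram3 a b c / (1 - dot a b ^+ 2)]. *)
Definition inward a b c : 'rV[R]_4 :=
  Num.sqrt ((1 - dot a b ^+ 2) / gram3 a b c) *:
  ((- (dot c a - dot a b * dot c b) / (1 - dot a b ^+ 2)) *: a +
   (- (dot c b - dot a b * dot c a) / (1 - dot a b ^+ 2)) *: b + c).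

Section Dihedral.
Variables a b : 'rV[R]_4.
Hypotheses (ha : dot a a = 1) (hb : dot b b = 1) (hab : 0 < 1 - dot a b ^+ 2).

Let hab0 : 1 - dot a b ^+ 2 != 0. Proof. by rewrite lt0r_neq0. Qed.

Lemma dot_inward_l c : dot (inward a b c) a = 0.
Proof. by rewrite /inward !dot_lin ha (dotC b a); field. Qed.

Lemma dot_inward_r c : dot (inward a b c) b = 0.
Proof. by rewrite /inward !dot_lin hb; field. Qed.

Lemma dot_inward c d : dot (inward a b c) d =
  Num.sqrt ((1 - dot a b ^+ 2) / gram3 a b c) * gram_offdiag a b c d / (1 - dot a b ^+ 2).
Proof. by rewrite /inward !dot_lin /gram_offdiag (dotC a d) (dotC b d); field. Qed.

Lemma dot_inward_inward c d : dot (inward a b c) (inward a b d) =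
  Num.sqrt ((1 - dot a b ^+ 2) / gram3 a b d) * dot (inward a b c) d.
Proof.
by rewrite {2}/inward !dotZr !dotDr !dotZr dot_inward_l dot_inward_r !mulr0 !add0r.
Qed.

Lemma dot_inward_self c : dot c c = 1 -> 0 < gram3 a b c ->
  dot (inward a b c) (inward a b c) = 1.
Proof.
move=> hc g0; rewrite dot_inward_inward dot_inward gram_offdiag_diag// !mulrA -expr2.
rewrite sqr_sqrtr ?divr_ge0 ?ltW//; field.
by rewrite hab0 lt0r_neq0.
Qed.

(** Orthogonality to a and b expresses x and y through z; the unit norm and the sign then fix z. *)
Lemma inwardP c n : dot c c = 1 -> 0 < gram3 a b c ->
  [/\ dot n n = 1, dot n a = 0, dot n b = 0 &
      exists x y z : R, 0 < z /\ n = x *: a + y *: b + z *: c] <->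
  n = inward a b c.
Proof.
move=> hc g0; split=> [[nn na nb [x [y [z [z0 nE]]]]]|->]; last first.
  split; [exact: dot_inward_self|exact: dot_inward_l|exact: dot_inward_r|].
  pose k := Num.sqrt ((1 - dot a b ^+ 2) / gram3 a b c); exists (k * (- (dot c a - dot a b * dot c b) / (1 - dot a b ^+ 2))),
    (k * (- (dot c b - dot a b * dot c a) / (1 - dot a b ^+ 2))), k.
  by split; rewrite ?sqrtr_gt0 ?divr_gt0// /inward -/k !scalerDr !scalerA.
have ea : x + y * dot a b + z * dot c a = 0.
  by rewrite -na nE !dot_lin ha (dotC b a); ring.
have eb : x * dot a b + y + z * dot c b = 0.
  by rewrite -nb nE !dot_lin hb; ring.
have ea' : dot a b * (x + y * dot a b + z * dot c a) = 0 by rewrite ea mulr0.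
have eb' : dot a b * (x * dot a b + y + z * dot c b) = 0 by rewrite eb mulr0.
have xE : x = z * (- (dot c a - dot a b * dot c b) / (1 - dot a b ^+ 2)).
  by apply: (mulIf hab0); rewrite mulrA divfK//; lra.
have yE : y = z * (- (dot c b - dot a b * dot c a) / (1 - dot a b ^+ 2)).
  by apply: (mulIf hab0); rewrite mulrA divfK//; lra.
have n1 : dot n n = z ^+ 2 * gram3 a b c / (1 - dot a b ^+ 2).
  rewrite {2}nE !dot_lin na nb !mulr0 !add0r nE !dot_lin xE yE hc (dotC a c) (dotC b c).
  by rewrite -gram_offdiag_diag// /gram_offdiag hc; field.
have zE : z = Num.sqrt ((1 - dot a b ^+ 2) / gram3 a b c).
  rewrite -[LHS]ger0_norm ?ltW// -sqrtr_sqr; congr Num.sqrt.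
  apply: (mulIf (lt0r_neq0 g0)); rewrite divfK ?lt0r_neq0//.
  by move: n1; rewrite nn => /(congr1 ( *%R^~ (1 - dot a b ^+ 2))); rewrite divfK// mul1r.
by rewrite /inward -zE nE !scalerDr !scalerA -xE -yE.
Qed.

Lemma exteriorP c (e : R) m : e ^+ 2 = 1 -> dot c c = 1 -> 0 < gram3 a b c ->
  [/\ dot m m = 1, dot m a = 0, dot m b = 0, dot m c = 0 & 0 < e * det4 a m b c] <->
  m = (e / Num.sqrt (gram3 a b c)) *: cross a b c.
Proof.
move=> he hc g0; have sg : 0 < Num.sqrt (gram3 a b c) by rewrite sqrtr_gt0.
have sgg : Num.sqrt (gram3 a b c) ^+ 2 = gram3 a b c by rewrite sqr_sqrtr ?ltW.
split=> [[mm ma mb mc m0]|->]; last first.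
  have Z : [/\ det4 a a b c = 0, det4 a b b c = 0 & det4 a c b c = 0].
    by rewrite !det4E /dt4 /dt3; split; ring.
  case: Z => Z1 Z2 Z3; rewrite !dot_lin !dot_cross Z1 Z2 Z3 !mulr0; split=> //.
    rewrite -dot_cross dot_cross_cross// mulrA -expr2 expr_div_n he sgg mul1r mulVf//.
    exact: lt0r_neq0.
  have -> : det4 a ((e / Num.sqrt (gram3 a b c)) *: cross a b c) b c =
      e / Num.sqrt (gram3 a b c) * dot (cross a b c) (cross a b c).
    by rewrite -dotZr dot_cross.
  by rewrite dot_cross_cross// mulrA mulrA -expr2 he mul1r mulr_gt0 ?invr_gt0.
(* As m is orthogonal to a, b and c, the Gram determinant collapses. Taking x = m gives the absolute
   value of [det4 a m b c], and arbitrary x then gives m. *)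
have dd x : det4 a m b c * det4 a x b c = dot m x * gram3 a b c.
  rewrite det4_mul ma mb mc ha hb hc.
  by rewrite (dotC b a) (dotC c a) (dotC c b) /gram3 /dt4 /dt3; ring.
have dE : det4 a m b c = e * Num.sqrt (gram3 a b c).
  suff h : e * det4 a m b c = Num.sqrt (gram3 a b c) by rewrite -h mulrA -expr2 he mul1r.
  rewrite -[LHS]ger0_norm ?ltW// -sqrtr_sqr; congr Num.sqrt.
  by rewrite exprMn he mul1r expr2 dd mm mul1r.
apply: dot_ext => x; apply: (mulIf (lt0r_neq0 g0)).
rewrite -dd dE dotZl dot_cross; move: sg sgg.
set r := Num.sqrt (gram3 a b c) => r0 <-; field.
by rewrite lt0r_neq0.
Qed.

End Dihedral.
End Vectors.

Section DihedralAngles.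
Variable R : realType.
Implicit Types (a b c d : 'rV[R]_4) (Q : octahedron R) (t : RP1_12 R).

(** With [dih_sin], the cosine and the sine of the angle at the edge a b from the half-plane of c to
    that of d, the sine still without the sign of the orientation of the surface. *)
Definition dih_cos a b c d : R :=
  gram_offdiag a b c d / (Num.sqrt (gram3 a b c) * Num.sqrt (gram3 a b d)).

Definition dih_sin a b c d : R :=
  Num.sqrt (1 - dot a b ^+ 2) * det4 a b d c /
  (Num.sqrt (gram3 a b c) * Num.sqrt (gram3 a b d)).

Lemma gram3C a b c : gram3 b a c = gram3 a b c.
Proof. by rewrite /gram3 (dotC b a); ring. Qed.

Lemma gram_offdiagC a b c d : gram_offdiag b a c d = gram_offdiag a b c d.
Proof. by rewrite /gram_offdiag (dotC b a); ring. Qed.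

Lemma gram_offdiag_sym a b c d : gram_offdiag a b d c = gram_offdiag a b c d.
Proof. by rewrite /gram_offdiag (dotC d c); ring. Qed.

Lemma dih_cosC a b c d : dih_cos b a c d = dih_cos a b c d.
Proof. by rewrite /dih_cos gram_offdiagC !(gram3C a b). Qed.

Lemma dih_cos_sym a b c d : dih_cos a b d c = dih_cos a b c d.
Proof. by rewrite /dih_cos gram_offdiag_sym [Num.sqrt (gram3 a b d) * _]mulrC. Qed.

Lemma dih_sinC a b c d : dih_sin b a c d = - dih_sin a b c d.
Proof.
rewrite /dih_sin (dotC b a) !(gram3C a b).
have -> : det4 b a d c = - det4 a b d c by rewrite !det4E /dt4 /dt3; ring.
by rewrite mulrN mulNr.
Qed.

Lemma dih_sin_sym a b c d : dih_sin a b d c = - dih_sin a b c d.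
Proof.
rewrite /dih_sin [Num.sqrt (gram3 a b d) * _]mulrC.
have -> : det4 a b c d = - det4 a b d c by rewrite !det4E /dt4 /dt3; ring.
by rewrite mulrN mulNr.
Qed.

Definition face_sign u v w : R := (-1) ^+ (~~ positively_ordered u v w).

Lemma oppK : involutive opp. Proof. by case=> i b; rewrite /opp negbK. Qed.

Lemma face_sign_opp u v w : face_sign u v (opp w) = - face_sign u v w.
Proof.
rewrite /face_sign /positively_ordered /opp /= addbN.
by case: (_ (+) w.2); rewrite ?expr0 ?expr1 ?opprK.
Qed.

Lemma adjacent_ordS u v : adjacent u v -> (u.1 == ordS v.1) = ~~ (v.1 == ordS u.1).
Proof.
by case: u v => [[[|[|[|//]]] ?] ?] [[[|[|[|//]]] ?] ?].
Qed.

Lemma face_signC u v w : adjacent u v -> face_sign v u w = - face_sign u v w.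
Proof.
move=> uv; rewrite /face_sign /positively_ordered (adjacent_ordS uv).
rewrite -!addbA (addbCA v.2) !addbA addNb -!addNb.
case: (v.1 == ordS u.1); case: u.2; case: v.2; case: w.2;
  by rewrite /= ?expr0 ?expr1 ?opprK.
Qed.

Lemma face_signCr u v w : is_face u v w -> face_sign u w v = - face_sign u v w.
Proof.
by case: u v w => [[[|[|[|//]]] ?] []] [[[|[|[|//]]] ?] []] [[[|[|[|//]]] ?] []] //= _;
  rewrite /face_sign /= ?expr0 ?expr1 ?opprK.
Qed.

Lemma face_sign_sqr u v w : face_sign u v w ^+ 2 = 1.
Proof. exact: sqrr_sign. Qed.

Definition Dcos Q u v w : R := dih_cos (Q u) (Q v) (Q w) (Q (opp w)).
Definition Dsin Q u v w : R := face_sign u v w * dih_sin (Q u) (Q v) (Q w) (Q (opp w)).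

Lemma DcosC Q u v w : Dcos Q v u w = Dcos Q u v w.
Proof. exact: dih_cosC. Qed.
Lemma Dcos_opp Q u v w : Dcos Q u v (opp w) = Dcos Q u v w.
Proof. by rewrite /Dcos oppK dih_cos_sym. Qed.
Lemma DsinC Q u v w : adjacent u v -> Dsin Q v u w = Dsin Q u v w.
Proof. by move=> uv; rewrite /Dsin dih_sinC face_signC// mulrNN. Qed.
Lemma Dsin_opp Q u v w : Dsin Q u v (opp w) = Dsin Q u v w.
Proof. by rewrite /Dsin oppK dih_sin_sym face_sign_opp mulrNN. Qed.

(** Non-degeneracy as strict inequalities, the form in which divisions and square roots use it; it
    implies [is_octahedron], by [row_free_gram3]. *)
Definition regular Q := (forall u, dot (Q u) (Q u) = 1) /\
  (forall u v w, is_face u v w ->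
     0 < 1 - dot (Q u) (Q v) ^+ 2 /\ 0 < gram3 (Q u) (Q v) (Q w)).

(** The three normals are unique, and n1, m1 are orthonormal, so the inner products of n2 with them
    are the cosine and minus the sine. *)
Lemma dihedral_angleP Q u v w phi : regular Q -> is_face u v w ->
  dihedral_angle Q u v w phi <-> cos phi = Dcos Q u v w /\ sin phi = Dsin Q u v w.
Proof.
move=> [Q1 Q2] f; set e := face_sign u v w.
have [hab g1] := Q2 _ _ _ f; have [_ g2] := Q2 u v (opp w) f.
set a := Q u in hab g1 g2 *; set b := Q v in hab g1 g2 *.
set c := Q w in g1 *; set d := Q (opp w) in g2 *.
have [ha hb hc hd] : [/\ dot a a = 1, dot b b = 1, dot c c = 1 & dot d d = 1].
  by split; exact: Q1.
have he : e ^+ 2 = 1 := face_sign_sqr u v w.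
pose n1 := inward a b c; pose n2 := inward a b d.
pose m1 := (e / Num.sqrt (gram3 a b c)) *: cross a b c.
have [n11 n1a n1b _] := (inwardP ha hb hab n1 hc g1).2 erefl.
have [n22 n2a n2b _] := (inwardP ha hb hab n2 hd g2).2 erefl.
have [m11 m1a m1b m1c _] := (exteriorP ha hb m1 he hc g1).2 erefl.
have r1 : Num.sqrt (gram3 a b c) != 0 by rewrite lt0r_neq0// sqrtr_gt0.
have r2 : Num.sqrt (gram3 a b d) != 0 by rewrite lt0r_neq0// sqrtr_gt0.
have h0 : Num.sqrt (1 - dot a b ^+ 2) != 0 by rewrite lt0r_neq0// sqrtr_gt0.
have hh : Num.sqrt (1 - dot a b ^+ 2) ^+ 2 = 1 - dot a b ^+ 2 by rewrite sqr_sqrtr ?ltW.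
have s1 : Num.sqrt ((1 - dot a b ^+ 2) / gram3 a b c) =
    Num.sqrt (1 - dot a b ^+ 2) / Num.sqrt (gram3 a b c).
  by rewrite sqrtrM ?ltW// sqrtrV// ltW.
have s2 : Num.sqrt ((1 - dot a b ^+ 2) / gram3 a b d) =
    Num.sqrt (1 - dot a b ^+ 2) / Num.sqrt (gram3 a b d).
  by rewrite sqrtrM ?ltW// sqrtrV// ltW.
set H := Num.sqrt (1 - dot a b ^+ 2) in h0 hh s1 s2.
have nn : dot n2 n1 = Dcos Q u v w.
  rewrite dotC /n1 /n2 dot_inward_inward// dot_inward// s1 s2 -hh.
  by rewrite /Dcos /dih_cos -/a -/b -/c -/d; field; rewrite h0 r1 r2.
have nm : dot n2 m1 = - Dsin Q u v w.
  have Z : det4 a a b c = 0 /\ det4 a b b c = 0.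
    by rewrite !det4E /dt4 /dt3; split; ring.
  rewrite dotC /m1 dotZl /n2 /inward !dot_lin !dot_cross Z.1 Z.2 !mulr0 !add0r s2.
  rewrite /Dsin /dih_sin -/e -/a -/b -/c -/d -/H.
  have -> : det4 a d b c = - det4 a b d c by rewrite !det4E /dt4 /dt3; ring.
  by field; rewrite r1 r2.
have nm1 : dot n1 m1 = 0.
  suff aux m : dot m a = 0 -> dot m b = 0 -> dot m c = 0 -> dot n1 m = 0 by exact: aux.
  move=> ma mb mc; rewrite /n1 /inward !dot_lin (dotC a m) (dotC b m) (dotC c m) ma mb mc.
  by rewrite !mulr0 !addr0 mulr0.
have mP m : exterior_normal Q u v w m <-> m = m1 := exteriorP ha hb m he hc g1.
have n1P n : inward_normal Q u v w n <-> n = n1 := inwardP ha hb hab n hc g1.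
have n2P n : inward_normal Q u v (opp w) n <-> n = n2 := inwardP ha hb hab n hd g2.
clearbody n1 n2 m1; split=> [[_ [_ [_ [/mP-> /n1P-> /n2P-> nE]]]]|[hcos hsin]].
  split; first by rewrite -nn nE !dot_lin n11 (dotC m1) nm1; ring.
  by apply: oppr_inj; rewrite -nm nE !dot_lin m11 nm1; ring.
exists m1, n1, n2; split; [exact/mP|exact/n1P|exact/n2P|].
(* The difference has squared norm 1 - cos^2 - sin^2 = 0; this places n2 in the plane of n1 and m1
   without a dimension count. *)
apply/eqP; rewrite -subr_eq0; apply/eqP/dot_eq0.
rewrite hcos hsin !dot_lin n22 n11 m11 (dotC n1 n2) (dotC m1 n2) (dotC m1 n1) nm1 nn nm.
have := cos2Dsin2 phi; rewrite hcos hsin => cs.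
by rewrite -[RHS](subrr 1) -[X in _ = _ - X]cs; ring.
Qed.

Lemma has_half_tans_face Q t u v w : regular Q -> has_half_tans Q t -> is_face u v w ->
  Dcos Q u v w ^+ 2 + Dsin Q u v w ^+ 2 = 1 /\
  t (edge_of u v) = half_tan_cs (Dcos Q u v w) (Dsin Q u v w).
Proof.
move=> rQ h f; have [phi /(dihedral_angleP _ rQ f) [<- <-] ->] := h _ _ _ f.
by rewrite cos2Dsin2 half_tanE.
Qed.

Lemma has_half_tans_of Q t : regular Q ->
  (forall u v w, is_face u v w -> Dcos Q u v w ^+ 2 + Dsin Q u v w ^+ 2 = 1 /\
    t (edge_of u v) = half_tan_cs (Dcos Q u v w) (Dsin Q u v w)) -> has_half_tans Q t.
Proof.
move=> rQ h u v w f; have [h1 ->] := h _ _ _ f.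
have [phi [hc hs]] := cos_sin_angle h1; exists phi; first exact/dihedral_angleP.
by rewrite half_tanE hc hs.
Qed.

End DihedralAngles.

(** * The link equations *)

Section Link.
Variable R : realType.
Implicit Types (u v : 'rV[R]_4).

(** The link equation is the cosine law for a spherical quadrilateral, multiplied by (X1^2 + Y1^2)
    (X2^2 + Y2^2), with cos (alpha +- beta +- delta) expanded. *)
Lemma link_biquadratic (ca sa cb sb cg cd sd C1 S1 C2 S2 X1 Y1 X2 Y2 : R) :
  Y1 ^+ 2 - X1 ^+ 2 = C1 * (X1 ^+ 2 + Y1 ^+ 2) -> 2 * X1 * Y1 = S1 * (X1 ^+ 2 + Y1 ^+ 2) ->
  Y2 ^+ 2 - X2 ^+ 2 = C2 * (X2 ^+ 2 + Y2 ^+ 2) -> 2 * X2 * Y2 = S2 * (X2 ^+ 2 + Y2 ^+ 2) ->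
  cg = ca * cb * cd + sa * sb * cd * C2 + sa * sd * cb * C1 - ca * sb * sd * C1 * C2
       + sb * sd * S1 * S2 ->
  (cg - ((ca * cb - sa * sb) * cd - (sa * cb + ca * sb) * sd)) * X1 ^+ 2 * X2 ^+ 2
  + (cg - ((ca * cb + sa * sb) * cd - (sa * cb - ca * sb) * sd)) * X1 ^+ 2 * Y2 ^+ 2
  + 2 * (- 2 * sb * sd) * X1 * Y1 * X2 * Y2
  + (cg - ((ca * cb - sa * sb) * cd + (sa * cb + ca * sb) * sd)) * Y1 ^+ 2 * X2 ^+ 2
  + (cg - ((ca * cb + sa * sb) * cd + (sa * cb - ca * sb) * sd)) * Y1 ^+ 2 * Y2 ^+ 2 = 0.
Proof.
move=> h1 k1 h2 k2 hg.
transitivity (cg * (X1 ^+ 2 + Y1 ^+ 2) * (X2 ^+ 2 + Y2 ^+ 2)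
  - (ca * cb * cd * (X1 ^+ 2 + Y1 ^+ 2) * (X2 ^+ 2 + Y2 ^+ 2)
     + sa * sb * cd * (Y2 ^+ 2 - X2 ^+ 2) * (X1 ^+ 2 + Y1 ^+ 2)
     + sa * sd * cb * (Y1 ^+ 2 - X1 ^+ 2) * (X2 ^+ 2 + Y2 ^+ 2)
     - ca * sb * sd * (Y1 ^+ 2 - X1 ^+ 2) * (Y2 ^+ 2 - X2 ^+ 2)
     + sb * sd * (2 * X1 * Y1) * (2 * X2 * Y2))); first by ring.
by rewrite h1 h2 k1 k2 hg; ring.
Qed.

(* The cosine law for the spherical quadrilateral cut out by the link of u. *)
Lemma quadrilateral_cosine_law u v1 v2 v3 v4 (e s1 s2 s3 s4 r12 r23 r14 : R) :
  dot u u = 1 -> dot v1 v1 = 1 -> dot v2 v2 = 1 -> e ^+ 2 = 1 ->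
  0 < s1 -> 0 < s2 -> 0 < s3 -> 0 < s4 -> 0 < r12 -> 0 < r23 -> 0 < r14 ->
  s1 ^+ 2 = 1 - dot u v1 ^+ 2 -> s2 ^+ 2 = 1 - dot u v2 ^+ 2 -> r12 ^+ 2 = gram3 u v1 v2 ->
  (dot v3 v4 - dot u v3 * dot u v4) / (s3 * s4) =
  (dot v1 v2 - dot u v1 * dot u v2) / (s1 * s2) *
    ((dot v2 v3 - dot u v2 * dot u v3) / (s2 * s3)) *
    ((dot v1 v4 - dot u v1 * dot u v4) / (s1 * s4))
  + r12 / (s1 * s2) * (r23 / (s2 * s3)) * ((dot v1 v4 - dot u v1 * dot u v4) / (s1 * s4))
    * (gram_offdiag u v2 v1 v3 / (r12 * r23))
  + r12 / (s1 * s2) * (r14 / (s1 * s4)) * ((dot v2 v3 - dot u v2 * dot u v3) / (s2 * s3))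
    * (gram_offdiag u v1 v2 v4 / (r12 * r14))
  - (dot v1 v2 - dot u v1 * dot u v2) / (s1 * s2) * (r23 / (s2 * s3)) * (r14 / (s1 * s4))
    * (gram_offdiag u v1 v2 v4 / (r12 * r14)) * (gram_offdiag u v2 v1 v3 / (r12 * r23))
  + r23 / (s2 * s3) * (r14 / (s1 * s4)) * (e * (s1 * det4 u v1 v4 v2 / (r12 * r14)))
    * (- e * (s2 * det4 u v2 v3 v1 / (r12 * r23))).
Proof.
move=> hu h1 h2 he p1 p2 p3 p4 q12 q23 q14 es1 es2 er.
have [n1 n2 n3 n4] : [/\ s1 != 0, s2 != 0, s3 != 0 & s4 != 0] by rewrite !lt0r_neq0.
have [m12 m23 m14] : [/\ r12 != 0, r23 != 0 & r14 != 0] by rewrite !lt0r_neq0.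
set A12 := dot v1 v2 - _; set A23 := dot v2 v3 - _; set A14 := dot v1 v4 - _.
set A34 := dot v3 v4 - _.
set G1 := gram_offdiag u v1 v2 v4; set G2 := gram_offdiag u v2 v1 v3.
set D1 := det4 u v1 v4 v2; set D2 := det4 u v2 v3 v1.
(* Once denominators are cleared, determinants occur only in the product [D1 * D2], so [det4_mul]
   makes this a polynomial identity between inner products. *)
suff key : A34 * s1 ^+ 2 * s2 ^+ 2 * r12 ^+ 2 = A12 * A23 * A14 * r12 ^+ 2
    + G2 * A14 * r12 ^+ 2 + G1 * A23 * r12 ^+ 2 - A12 * G1 * G2 - D1 * D2 * s1 ^+ 2 * s2 ^+ 2.
  have -> : A34 / (s3 * s4) =
      (A34 * s1 ^+ 2 * s2 ^+ 2 * r12 ^+ 2) / (s3 * s4 * s1 ^+ 2 * s2 ^+ 2 * r12 ^+ 2).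
    by field; rewrite m12 n1 n2 n3 n4.
  rewrite key -[D1 * D2]mul1r -he; field.
  by rewrite m12 m23 m14 n1 n2 n3 n4.
rewrite es1 es2 er /D1 /D2 det4_mul hu h1 h2 /gram3 /A12 /A23 /A14 /A34 /G1 /G2 /gram_offdiag.
rewrite ?(dotC _ u) ?(dotC v2 v1) ?(dotC v3 v1) ?(dotC v4 v1) ?(dotC v3 v2) ?(dotC v4 v2).
by rewrite ?(dotC v4 v3) /dt4 /dt3 ?hu; ring.
Qed.

End Link.

Section LinkEquation.
Variable R : realType.
Variables (Q : octahedron R) (l : edge -> R).
Hypothesis rQ : regular Q.
Hypothesis lQ : forall u v, adjacent u v ->
  dot (Q u) (Q v) = cos (l (edge_of u v)) /\ 0 < sin (l (edge_of u v)).

Let S u v := sin (l (edge_of u v)).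

Let SE u v : adjacent u v -> S u v ^+ 2 = 1 - dot (Q u) (Q v) ^+ 2.
Proof. by move=> uv; rewrite /S sin2cos2 (lQ uv).1. Qed.

Lemma is_face_adjacent u v w : is_face u v w -> [/\ adjacent u v, adjacent u w & adjacent v w].
Proof.
by rewrite /is_face /= !inE !negb_or andbT => /andP[/andP[h1 h2] h3]; split.
Qed.

Lemma cos_sin_face_angle u v w : is_face u v w ->
  cos (face_angle l u v w) = (dot (Q v) (Q w) - dot (Q u) (Q v) * dot (Q u) (Q w)) / (S u v * S u w)
  /\ sin (face_angle l u v w) = Num.sqrt (gram3 (Q u) (Q v) (Q w)) / (S u v * S u w).
Proof.
move=> f; have [uv uw vw] := is_face_adjacent f.
have [euv suv] := lQ uv; have [euw suw] := lQ uw; have [evw _] := lQ vw.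
have ss : 0 < S u v * S u w by rewrite mulr_gt0.
have [_ g0] := rQ.2 _ _ _ f.
have gE : gram3 (Q u) (Q v) (Q w) = (S u v * S u w) ^+ 2 -
    (dot (Q v) (Q w) - dot (Q u) (Q v) * dot (Q u) (Q w)) ^+ 2.
  by rewrite exprMn !SE.
rewrite /face_angle -evw -euv -euw -/(S u v) -/(S u w).
set x := (dot (Q v) (Q w) - _) in gE *; set k := S u v * S u w in ss gE *.
have xk : -1 <= x / k <= 1.
  rewrite ler_pdivrMr// ler_pdivlMr// mul1r mulN1r -ler_norml.
  by rewrite -[k]gtr0_norm// -ler_sqr ?nnegrE// !real_normK ?num_real//; lra.
rewrite acosK ?inE// sin_acos//; split=> //.
have -> : 1 - (x / k) ^+ 2 = gram3 (Q u) (Q v) (Q w) / k ^+ 2.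
  by rewrite gE; field; rewrite lt0r_neq0.
by rewrite sqrtrM ?ltW// sqrtrV ?sqr_ge0// sqrtr_sqr gtr0_norm.
Qed.

Lemma link_equation_holds t u v1 v2 : has_half_tans Q t -> is_face u v1 v2 ->
  link_equation l t u v1 v2.
Proof.
move=> ht f12.
have f21 : is_face u v2 v1.
  move: f12; rewrite /is_face /= !inE !negb_or !andbT => /andP[/andP[-> ->]].
  by rewrite eq_sym.
have f23 : is_face u v2 (opp v1) by [].
have f34 : is_face u (opp v1) (opp v2) by [].
have f41 : is_face u (opp v2) v1 by [].
have f14 : is_face u v1 (opp v2) by [].
have [cs1 t1] := has_half_tans_face rQ ht f12.
have [cs2 t2] := has_half_tans_face rQ ht f21.
have [_ q1 k1] := half_tan_cs_quad cs1; have [_ q2 k2] := half_tan_cs_quad cs2.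
rewrite /link_equation t1 t2.
set X1 := hcoord _ false in q1 k1 *; set Y1 := hcoord _ true in q1 k1 *.
set X2 := hcoord (half_tan_cs (Dcos Q u v2 v1) _) false in q2 k2 *.
set Y2 := hcoord (half_tan_cs (Dcos Q u v2 v1) _) true in q2 k2 *.
have [ca sa] := cos_sin_face_angle f12; have [cb sb] := cos_sin_face_angle f23.
have [cg _] := cos_sin_face_angle f34; have [cd sd] := cos_sin_face_angle f41.
rewrite !(cosB, cosD, sinB, sinD).
apply: (link_biquadratic q1 k1 q2 k2).
rewrite ca sa cb sb cg cd sd.
have [a1 a2 _] := is_face_adjacent f12.
have s1 : 0 < S u v1 := (lQ a1).2; have s2 : 0 < S u v2 := (lQ a2).2.
have a3 : adjacent u (opp v1) by []. have a4 : adjacent u (opp v2) by [].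
have s3 : 0 < S u (opp v1) := (lQ a3).2; have s4 : 0 < S u (opp v2) := (lQ a4).2.
have r12 := (rQ.2 _ _ _ f12).2; have r23 := (rQ.2 _ _ _ f23).2.
have r14 := (rQ.2 _ _ _ f14).2.
have q12 : 0 < Num.sqrt (gram3 (Q u) (Q v1) (Q v2)) by rewrite sqrtr_gt0.
have q23 : 0 < Num.sqrt (gram3 (Q u) (Q v2) (Q (opp v1))) by rewrite sqrtr_gt0.
have q14 : 0 < Num.sqrt (gram3 (Q u) (Q v1) (Q (opp v2))) by rewrite sqrtr_gt0.
have gC x y z : dot x x = 1 -> dot y y = 1 -> dot z z = 1 -> gram3 x y z = gram3 x z y :> R.
  by move=> *; rewrite /gram3 (dotC z y); ring.
(* The sign e is the orientation of the face u v1 v2. Exchanging v1 and v2 reverses it, whence the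
   factor - e at the second edge. *)
have := @quadrilateral_cosine_law _ (Q u) (Q v1) (Q v2) (Q (opp v1)) (Q (opp v2)) _ _ _ _ _ _ _ _
  (rQ.1 u) (rQ.1 v1) (rQ.1 v2) (face_sign_sqr R u v1 v2)
  s1 s2 s3 s4 q12 q23 q14 (SE a1) (SE a2) (sqr_sqrtr (ltW r12)).
have sE v : adjacent u v -> Num.sqrt (1 - dot (Q u) (Q v) ^+ 2) = S u v.
  by move=> uv; rewrite -SE// sqrtr_sqr gtr0_norm// (lQ uv).2.
rewrite /Dcos /Dsin /dih_cos /dih_sin (sE _ a1) (sE _ a2) (face_signCr R f12).
rewrite (gC _ (Q v2) (Q v1)) ?rQ.1// (gC _ (Q (opp v2)) (Q v1)) ?rQ.1//.
rewrite (dotC (Q (opp v2)) (Q v1)) => ->.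
rewrite [S u (opp v2) * S u v1]mulrC [dot _ (Q (opp v2)) * dot _ (Q v1)]mulrC.
by [].
Qed.

End LinkEquation.

(** * The curve of flexed octahedra *)

Section Curve.
Variable R : realType.
Variables p q : bool -> R.
Hypotheses (hp : `|p false| < `|p true|) (hq : `|q false| < `|q true|).
Hypothesis hpq : p true ^+ 2 + q true ^+ 2 < 1.
Implicit Types (i j k : bool) (al be : bool -> R) (e : edge).

Local Notation i0 := (@Ordinal 3 0 isT).
Local Notation i1 := (@Ordinal 3 1 isT).
Local Notation i2 := (@Ordinal 3 2 isT).

Definition sg k : R := (-1) ^+ k.
Lemma sg_sqr k : sg k ^+ 2 = 1. Proof. exact: sqrr_sign. Qed.

(** The Gram determinant of both faces that contain the i-th of a1, b1 and the j-th of a2, b2. *)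
Definition kk i j : R := 1 - p i ^+ 2 - q j ^+ 2.

Lemma sqr_p_lt : p false ^+ 2 < p true ^+ 2.
Proof. by rewrite -[p false ^+ 2]real_normK ?num_real// -[p true ^+ 2]real_normK ?num_real// ltr_sqr ?nnegrE. Qed.
Lemma sqr_q_lt : q false ^+ 2 < q true ^+ 2.
Proof. by rewrite -[q false ^+ 2]real_normK ?num_real// -[q true ^+ 2]real_normK ?num_real// ltr_sqr ?nnegrE. Qed.

Lemma sqr_p_le i : p i ^+ 2 <= p true ^+ 2.
Proof. by case: i => //; have := sqr_p_lt; lra. Qed.
Lemma sqr_q_le i : q i ^+ 2 <= q true ^+ 2.
Proof. by case: i => //; have := sqr_q_lt; lra. Qed.

Lemma kk_gt0 i j : 0 < kk i j.
Proof. by rewrite /kk; have hi := sqr_p_le i; have hj := sqr_q_le j; have h := hpq; lra. Qed.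

Lemma one_sub_p_gt0 i : 0 < 1 - p i ^+ 2.
Proof. by have h := kk_gt0 i true; have := sqr_ge0 (q true); rewrite /kk in h; lra. Qed.
Lemma one_sub_q_gt0 j : 0 < 1 - q j ^+ 2.
Proof. by have h := kk_gt0 true j; have := sqr_ge0 (p true); rewrite /kk in h; lra. Qed.

(* The octahedron of the formulae for c = cos theta and s = sin theta, in terms of
   al i = delta_i sqrt(c^2 - p_i^2) and be j = epsilon_j sqrt(s^2 - q_j^2).  The
   indices 1 and 2 of p, q, delta, epsilon are the booleans [false] and [true]. *)
Definition oct_of (c s : R) al be : octahedron R := fun u =>
  match val u.1 with
  | 0%N => vec4 (p u.2 / c) (al u.2 / c) 0 0
  | 1%N => vec4 0 0 (q u.2 / s) (be u.2 / s)
  | _ => vec4 c 0 (sg u.2 * s) 0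
  end.

(** The relations al_i^2 = c^2 - p_i^2, be_j^2 = s^2 - q_j^2 and c^2 + s^2 = 1 with c and s
    eliminated. *)
Definition on_curve al be := [/\ al false ^+ 2 + be false ^+ 2 = kk false false,
  al true ^+ 2 = al false ^+ 2 + p false ^+ 2 - p true ^+ 2 &
  be true ^+ 2 = be false ^+ 2 + q false ^+ 2 - q true ^+ 2].

Lemma on_curve_al al be i : on_curve al be -> al i ^+ 2 = al false ^+ 2 + p false ^+ 2 - p i ^+ 2.
Proof. by case=> _ h _; case: i => //; ring. Qed.
Lemma on_curve_be al be j : on_curve al be -> be j ^+ 2 = be false ^+ 2 + q false ^+ 2 - q j ^+ 2.
Proof. by case=> _ _ h; case: j => //; ring. Qed.

Lemma on_curve_kk al be i j : on_curve al be -> al i ^+ 2 + be j ^+ 2 = kk i j.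
Proof.
move=> h; rewrite (on_curve_al i h) (on_curve_be j h); case: h => h _ _.
by move: h; rewrite /kk; lra.
Qed.

(** Here |p1| < |p2| and |q1| < |q2| enter: al_1^2 exceeds al_2^2 >= 0 by p2^2 - p1^2, and similarly
    for be. Hence delta_1 and epsilon_1 cannot change. *)
Lemma on_curve_neq0 al be : on_curve al be -> al false != 0 /\ be false != 0.
Proof.
move=> [_ h1 h2]; have hp2 := sqr_p_lt; have hq2 := sqr_q_lt.
have := sqr_ge0 (al true); have := sqr_ge0 (be true); rewrite h1 h2 => hb ha.
have a0 : 0 < al false ^+ 2 by lra.
have b0 : 0 < be false ^+ 2 by lra.
by rewrite -[al _ == 0]sqrf_eq0 -[be _ == 0]sqrf_eq0 !lt0r_neq0.
Qed.

Section Forms.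
(* Numerators and common denominator of the cosine and the sine of the dihedral
   angle at an edge, as quadratic forms in [al], [be]; they are polymorphic so
   that they can be evaluated at numbers and at polynomials. *)
Variables (S : comNzRingType) (io : R -> S) (al be : bool -> S).

(** On the curve this is cos^2 theta = al_1^2 + p_1^2, made homogeneous by writing 1 as (al_1^2 +
    be_1^2) / kk; [s2form] is sin^2 theta in the same way. *)
Definition c2form : S :=
  io (kk false false)^-1 * (io (1 - q false ^+ 2) * al false ^+ 2 + io (p false ^+ 2) * be false ^+ 2).
Definition s2form : S :=
  io (kk false false)^-1 * (io (1 - p false ^+ 2) * be false ^+ 2 + io (q false ^+ 2) * al false ^+ 2).

Definition cn (e : edge) : S :=
  match val e.1.1 with
  | 0%N => io (p false * p true) * be e.1.2 ^+ 2 + io (1 - q e.1.2 ^+ 2) * (al false * al true)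
  | 1%N => io (q false * q true) * al e.2 ^+ 2 + io (1 - p e.2 ^+ 2) * (be false * be true)
  | _ => al e.1.2 ^+ 2 - be e.2 ^+ 2
  end.

Definition sn (e : edge) : S :=
  match val e.1.1 with
  | 0%N => io (- (sg e.1.2 * Num.sqrt (1 - q e.1.2 ^+ 2))) * be e.1.2
             * (io (p true) * al false - io (p false) * al true)
  | 1%N => io (sg e.2 * sg e.1.2 * Num.sqrt (1 - p e.2 ^+ 2)) * al e.2
             * (io (q true) * be false - io (q false) * be true)
  | _ => io (- (sg e.1.2 * sg e.2 * 2)) * al e.1.2 * be e.2
  end.

Definition rn (e : edge) : S :=
  match val e.1.1 with
  | 0%N => io (Num.sqrt (kk false e.1.2) * Num.sqrt (kk true e.1.2)) * c2form
  | 1%N => io (Num.sqrt (kk e.2 false) * Num.sqrt (kk e.2 true)) * s2form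
  | _ => al e.1.2 ^+ 2 + be e.2 ^+ 2
  end.
End Forms.

Lemma forms_morph (S S' : comNzRingType) (f : {rmorphism S -> S'}) (io : R -> S) (al be : bool -> S) e :
  [/\ f (cn io al be e) = cn (f \o io) (f \o al) (f \o be) e,
      f (sn io al be e) = sn (f \o io) (f \o al) (f \o be) e &
      f (rn io al be e) = rn (f \o io) (f \o al) (f \o be) e].
Proof.
rewrite /cn /sn /rn /c2form /s2form; case: e => [[[[|[|n]] /= _] k] k'] /=;
  by split; rewrite !(rmorphB, rmorphD, rmorphM, rmorphXn).
Qed.

Definition angle_cos al be e : R := cn id al be e / rn id al be e.
Definition angle_sin al be e : R := sn id al be e / rn id al be e.

Lemma formsZ al be (k : R) e :
  [/\ cn id (fun i => k * al i) (fun j => k * be j) e = k ^+ 2 * cn id al be e,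
      sn id (fun i => k * al i) (fun j => k * be j) e = k ^+ 2 * sn id al be e &
      rn id (fun i => k * al i) (fun j => k * be j) e = k ^+ 2 * rn id al be e].
Proof.
by rewrite /cn /sn /rn /c2form /s2form; case: e => [[[[|[|n]] /= _] j] j'] /=; split; ring.
Qed.

Lemma c2formE al be : on_curve al be -> c2form id al be = al false ^+ 2 + p false ^+ 2.
Proof.
move=> h; have k0 := lt0r_neq0 (kk_gt0 false false).
apply: (mulfI k0); rewrite /c2form mulrA divff// mul1r.
by have := on_curve_kk false false h => <-; rewrite /kk; have := on_curve_kk false false h; rewrite /kk; nra.
Qed.
Lemma s2formE al be : on_curve al be -> s2form id al be = be false ^+ 2 + q false ^+ 2.
Proof.
move=> h; have k0 := lt0r_neq0 (kk_gt0 false false).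
apply: (mulfI k0); rewrite /s2form mulrA divff// mul1r.
by have := on_curve_kk false false h => <-; rewrite /kk; have := on_curve_kk false false h; rewrite /kk; nra.
Qed.

Lemma on_curve_c2 al be : on_curve al be -> 0 < al false ^+ 2 + p false ^+ 2.
Proof.
move=> h; rewrite ltr_wpDr ?sqr_ge0//.
by rewrite lt_neqAle sqr_ge0 eq_sym sqrf_eq0 (on_curve_neq0 h).1.
Qed.

Lemma on_curve_s2 al be : on_curve al be -> 0 < be false ^+ 2 + q false ^+ 2.
Proof.
move=> h; rewrite ltr_wpDr ?sqr_ge0//.
by rewrite lt_neqAle sqr_ge0 eq_sym sqrf_eq0 (on_curve_neq0 h).2.
Qed.

Lemma on_curve_cs al be : on_curve al be ->
  (al false ^+ 2 + p false ^+ 2) + (be false ^+ 2 + q false ^+ 2) = 1.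
Proof. by case=> h _ _; move: h; rewrite /kk; lra. Qed.

Lemma edge_cases (P : edge -> Prop) : (forall i j, P (i0, i, j)) -> (forall i j, P (i1, i, j)) ->
  (forall i j, P (i2, i, j)) -> forall e, P e.
Proof.
move=> h0 h1 h2 [[[[|[|[|//]]] h] i] j]; [move: (h0 i j)|move: (h1 i j)|move: (h2 i j)];
  by congr P; congr (_, _, _); apply: val_inj.
Qed.

Lemma rn_gt0 al be e : on_curve al be -> 0 < rn id al be e.
Proof.
move=> h; elim/edge_cases: e => i j; rewrite /rn /=.
- by rewrite c2formE// mulr_gt0 ?mulr_gt0 ?sqrtr_gt0 ?kk_gt0 ?(on_curve_c2 h).
- by rewrite s2formE// mulr_gt0 ?mulr_gt0 ?sqrtr_gt0 ?kk_gt0 ?(on_curve_s2 h).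
- by rewrite (on_curve_kk _ _ h) kk_gt0.
Qed.

(** At an edge ending in a3 or b3 the sum of squares splits by Brahmagupta's identity into two
    factors, each of which is cos^2 theta (or sin^2 theta) times a value of [kk]. At the other edges
    it is (a^2 - b^2)^2 + 4 a^2 b^2 = (a^2 + b^2)^2. *)
Lemma cn_sn_sqr al be e : on_curve al be ->
  cn id al be e ^+ 2 + sn id al be e ^+ 2 = rn id al be e ^+ 2.
Proof.
move=> h; have cs := on_curve_cs h.
elim/edge_cases: e => i j; rewrite /cn /sn /rn /= ?c2formE// ?s2formE//.
- rewrite !(exprMn, sqrrN, sg_sqr, mul1r) !sqr_sqrtr ?ltW ?kk_gt0 ?one_sub_q_gt0// /kk.
  have := on_curve_be i h; have := on_curve_al true h; move: cs.
  set a := al false; set a' := al true; set b := be i; set s2 := be false ^+ 2 + _.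
  move=> cs ha hb; have b2 : b ^+ 2 = s2 - q i ^+ 2 by rewrite hb.
  set c2 := a ^+ 2 + _ in cs ha *; have a2 : a ^+ 2 = c2 - p false ^+ 2 by rewrite /c2; ring.
  transitivity ((b ^+ 2 * p false ^+ 2 + (1 - q i ^+ 2) * a ^+ 2) *
                (b ^+ 2 * p true ^+ 2 + (1 - q i ^+ 2) * a' ^+ 2)); first by ring.
  by rewrite ha a2 b2 (_ : s2 = 1 - c2); [ring|lra].
- rewrite !(exprMn, sqrrN, sg_sqr, mul1r) !sqr_sqrtr ?ltW ?kk_gt0 ?one_sub_p_gt0// /kk.
  have := on_curve_al j h; have := on_curve_be true h; move: cs.
  set b := be false; set b' := be true; set a := al j; set c2 := al false ^+ 2 + _.
  move=> cs hb ha; have a2 : a ^+ 2 = c2 - p j ^+ 2 by rewrite ha.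
  set s2 := b ^+ 2 + _ in cs hb *; have b2 : b ^+ 2 = s2 - q false ^+ 2 by rewrite /s2; ring.
  transitivity ((a ^+ 2 * q false ^+ 2 + (1 - p j ^+ 2) * b ^+ 2) *
                (a ^+ 2 * q true ^+ 2 + (1 - p j ^+ 2) * b' ^+ 2)); first by ring.
  by rewrite hb a2 b2 (_ : s2 = 1 - c2); [ring|lra].
- by rewrite !(exprMn, sqrrN, sg_sqr, mul1r); ring.
Qed.

Lemma angle_sqr al be e : on_curve al be -> angle_cos al be e ^+ 2 + angle_sin al be e ^+ 2 = 1.
Proof.
move=> h; rewrite /angle_cos /angle_sin !expr_div_n -mulrDl cn_sn_sqr// divff//.
by rewrite sqrf_eq0 lt0r_neq0// rn_gt0.
Qed.

Lemma vertex_cases (P : vertex -> Prop) : (forall i, P (i0, i)) -> (forall i, P (i1, i)) ->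
  (forall i, P (i2, i)) -> forall u, P u.
Proof.
move=> h0 h1 h2 [[[|[|[|//]]] hh] i]; [move: (h0 i)|move: (h1 i)|move: (h2 i)];
  by congr P; congr (_, _); apply: val_inj.
Qed.

(** The inner products that the edge lengths prescribe; [sg] expresses that the lengths from a2, or
    from b2, to a3 and to b3 add up to pi. *)
Definition gram (u v : vertex) : R :=
  match val u.1, val v.1 with
  | 0%N, 2%N => p u.2 | 2%N, 0%N => p v.2
  | 1%N, 2%N => sg v.2 * q u.2 | 2%N, 1%N => sg u.2 * q v.2
  | _, _ => 0
  end.

Section Octahedron.
Variables (c s : R) (al be : bool -> R).
Hypotheses (hc : c ^+ 2 = al false ^+ 2 + p false ^+ 2).
Hypotheses (hs : s ^+ 2 = be false ^+ 2 + q false ^+ 2) (h : on_curve al be).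

Let c0 : c != 0. Proof. by rewrite -sqrf_eq0 hc lt0r_neq0 ?(on_curve_c2 h). Qed.
Let s0 : s != 0. Proof. by rewrite -sqrf_eq0 hs lt0r_neq0 ?(on_curve_s2 h). Qed.
Let cs : c ^+ 2 + s ^+ 2 = 1. Proof. by rewrite hc hs on_curve_cs. Qed.
Let al2 i : al i ^+ 2 = c ^+ 2 - p i ^+ 2. Proof. by rewrite (on_curve_al i h) hc. Qed.
Let be2 j : be j ^+ 2 = s ^+ 2 - q j ^+ 2. Proof. by rewrite (on_curve_be j h) hs. Qed.
Local Notation Q := (oct_of c s al be).

Lemma oct_dot00 i k : dot (Q (i0, i)) (Q (i0, k)) = (p i * p k + al i * al k) / c ^+ 2.
Proof. by rewrite /oct_of /= dotE !co_vec4//=; field. Qed.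
Lemma oct_dot01 i j : dot (Q (i0, i)) (Q (i1, j)) = 0.
Proof. by rewrite /oct_of /= dotE !co_vec4//=; ring. Qed.
Lemma oct_dot02 i k : dot (Q (i0, i)) (Q (i2, k)) = p i.
Proof. by rewrite /oct_of /= dotE !co_vec4//=; field. Qed.
Lemma oct_dot11 j k : dot (Q (i1, j)) (Q (i1, k)) = (q j * q k + be j * be k) / s ^+ 2.
Proof. by rewrite /oct_of /= dotE !co_vec4//=; field. Qed.
Lemma oct_dot12 j k : dot (Q (i1, j)) (Q (i2, k)) = sg k * q j.
Proof. by rewrite /oct_of /= dotE !co_vec4//=; field. Qed.
Lemma oct_dot22 k k' : dot (Q (i2, k)) (Q (i2, k')) = c ^+ 2 + sg k * sg k' * s ^+ 2.
Proof. by rewrite /oct_of /= dotE !co_vec4//=; ring. Qed.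

Lemma oct_unit u : dot (Q u) (Q u) = 1.
Proof.
elim/vertex_cases: u => i.
- by rewrite oct_dot00 -!expr2 al2 addrC subrK divff// sqrf_eq0.
- by rewrite oct_dot11 -!expr2 be2 addrC subrK divff// sqrf_eq0.
- by rewrite oct_dot22 -expr2 sg_sqr mul1r.
Qed.

Lemma oct_gram u v : adjacent u v -> dot (Q u) (Q v) = gram u v.
Proof.
elim/vertex_cases: u => i; elim/vertex_cases: v => j //= _; rewrite /gram /=.
- exact: oct_dot01.
- exact: oct_dot02.
- by rewrite dotC oct_dot01.
- exact: oct_dot12.
- by rewrite dotC oct_dot02.
- by rewrite dotC oct_dot12.
Qed.

Lemma oct_regular : regular Q.
Proof.
split=> [|u v w f]; first exact: oct_unit.
have [uv uw vw] := is_face_adjacent f.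
rewrite /gram3 !oct_gram// /gram; move: f {uv uw vw}.
elim/vertex_cases: u => i; elim/vertex_cases: v => j; elim/vertex_cases: w => k //= _;
  rewrite ?exprMn ?sg_sqr; split; try (have := kk_gt0 i j; have := kk_gt0 i k;
  have := kk_gt0 j i; have := kk_gt0 j k; have := kk_gt0 k i; have := kk_gt0 k j; rewrite /kk;
  have := one_sub_p_gt0 i; have := one_sub_p_gt0 j; have := one_sub_q_gt0 i;
  have := one_sub_q_gt0 j; have := sg_sqr i; have := sg_sqr j; have := sg_sqr k; nra).
Qed.

Let sq_kk i j : Num.sqrt (kk i j) ^+ 2 = kk i j.
Proof. by rewrite sqr_sqrtr// ltW// kk_gt0. Qed.
Let sq_kk0 i j : Num.sqrt (kk i j) != 0.
Proof. by rewrite lt0r_neq0// sqrtr_gt0 kk_gt0. Qed.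

Let angles01 i j : let u := (i0, i) in let v := (i1, j) in let w := (i2, false) in
  Dcos Q u v w = angle_cos al be (edge_of u v) /\ Dsin Q u v w = angle_sin al be (edge_of u v).
Proof.
move=> u v w; rewrite /Dcos /Dsin /dih_cos /dih_sin /angle_cos /angle_sin.
have -> : gram3 (Q u) (Q v) (Q w) = kk i j.
  by rewrite /gram3 !oct_gram//; rewrite /gram /sg /kk /=; ring.
have -> : gram3 (Q u) (Q v) (Q (opp w)) = kk i j.
  by rewrite /gram3 !oct_gram//; rewrite /gram /sg /kk /=; ring.
rewrite -expr2 sq_kk /cn /sn /rn /= (on_curve_kk i j h).
have k0 := lt0r_neq0 (kk_gt0 i j); split.
  rewrite /gram_offdiag oct_dot22 !oct_gram// /gram /sg /= al2 be2.
  by congr (_ / _); ring.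
rewrite oct_gram// /gram /= expr0n subr0 sqrtr1 mul1r det4E /oct_of /= !co_vec4//= mulrA.
congr (_ / _); rewrite /face_sign /positively_ordered /= /dt4 /dt3 /sg.
by case: (i); case: (j); rewrite /= ?expr0 ?expr1; field; rewrite c0 s0.
Qed.

Let angles02 i j : let u := (i0, i) in let v := (i2, j) in let w := (i1, false) in
  Dcos Q u v w = angle_cos al be (edge_of u v) /\ Dsin Q u v w = angle_sin al be (edge_of u v).
Proof.
move=> u v w; rewrite /Dcos /Dsin /dih_cos /dih_sin /angle_cos /angle_sin.
have -> : gram3 (Q u) (Q v) (Q w) = kk i false.
  by rewrite /gram3 !oct_gram//; rewrite /gram /kk /= mulr0 subr0 exprMn sg_sqr; ring.
have -> : gram3 (Q u) (Q v) (Q (opp w)) = kk i true.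
  by rewrite /gram3 !oct_gram//; rewrite /gram /kk /= mulr0 subr0 exprMn sg_sqr; ring.
rewrite /cn /sn /rn /= s2formE// -hs.
have cE : c ^+ 2 = 1 - s ^+ 2 by rewrite -cs; ring.
split.
  rewrite /gram_offdiag oct_dot11 !oct_gram// /gram /=.
  transitivity (((1 - p i ^+ 2) * (q false * q true + be false * be true) / s ^+ 2
     - sg j ^+ 2 * (q false * q true)) / (Num.sqrt (kk i false) * Num.sqrt (kk i true))).
    by congr (_ / _); ring.
  by rewrite sg_sqr al2 cE; field; rewrite s0 !sq_kk0.
rewrite oct_gram// /gram /= det4E /oct_of /= !co_vec4//=.
rewrite /face_sign /positively_ordered /= /dt4 /dt3 /sg.
by case: (i); case: (j); rewrite /= ?expr0 ?expr1; field; rewrite c0 s0 !sq_kk0.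
Qed.

Let angles12 i j : let u := (i1, i) in let v := (i2, j) in let w := (i0, false) in
  Dcos Q u v w = angle_cos al be (edge_of u v) /\ Dsin Q u v w = angle_sin al be (edge_of u v).
Proof.
move=> u v w; rewrite /Dcos /Dsin /dih_cos /dih_sin /angle_cos /angle_sin.
have -> : gram3 (Q u) (Q v) (Q w) = kk false i.
  by rewrite /gram3 !oct_gram//; rewrite /gram /kk /= exprMn sg_sqr; ring.
have -> : gram3 (Q u) (Q v) (Q (opp w)) = kk true i.
  by rewrite /gram3 !oct_gram//; rewrite /gram /kk /= exprMn sg_sqr; ring.
rewrite /cn /sn /rn /= c2formE// -hc.
have cE : s ^+ 2 = 1 - c ^+ 2 by rewrite -cs; ring.
split.
  rewrite /gram_offdiag oct_dot00 !oct_gram// /gram /=.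
  transitivity (((1 - sg j ^+ 2 * q i ^+ 2) * (p false * p true + al false * al true) / c ^+ 2
     - p false * p true) / (Num.sqrt (kk false i) * Num.sqrt (kk true i))).
    by congr (_ / _); ring.
  by rewrite sg_sqr be2 cE; field; rewrite c0 !sq_kk0.
rewrite oct_gram// /gram /= exprMn sg_sqr mul1r det4E /oct_of /= !co_vec4//=.
rewrite /face_sign /positively_ordered /= /dt4 /dt3 /sg.
by case: (i); case: (j); rewrite /= ?expr0 ?expr1; field; rewrite c0 s0 !sq_kk0.
Qed.

(** Exchanging the ends of the edge, or passing to the opposite third vertex, changes neither the
    cosine nor the sine, so three families of computations cover all cases. *)
Lemma oct_angles u v w : is_face u v w ->
  Dcos Q u v w = angle_cos al be (edge_of u v) /\ Dsin Q u v w = angle_sin al be (edge_of u v).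
Proof.
pose P u v w := Dcos Q u v w = angle_cos al be (edge_of u v) /\
  Dsin Q u v w = angle_sin al be (edge_of u v); rewrite -/(P u v w).
have swap x y z : adjacent x y -> P x y z -> P y x z.
  move=> xy [h1 h2]; rewrite /P DcosC DsinC// h1 h2; suff -> : edge_of y x = edge_of x y by [].
  by rewrite /edge_of adjacent_ordS//; case: ifP => //=; rewrite /edge_of; case: eqP.
have other x y z : P x y (opp z) -> P x y z by rewrite /P Dcos_opp Dsin_opp.
have third x y (n : 'I_3) k : P x y (n, false) -> P x y (n, k).
  by case: k => // h1; apply: other.
elim/vertex_cases: u => i; elim/vertex_cases: v => j; elim/vertex_cases: w => k //= _;
  apply: third.
- exact: angles01.
- exact: angles02.
- apply: swap => //; exact: angles01.
- exact: angles12.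
- apply: swap => //; exact: angles02.
- apply: swap => //; exact: angles12.
Qed.

End Octahedron.

End Curve.

(** * Rotations and the classification of the octahedra *)

Section Isometries.
Variable R : realType.
Implicit Types (a b c d x y : 'rV[R]_4) (g : 'M[R]_4) (Q : octahedron R).

(** The determinant of M M^T is [gram3 a b c], so M has a right inverse. *)
Lemma row_free_gram3 a b c : dot a a = 1 -> dot b b = 1 -> dot c c = 1 ->
  gram3 a b c != 0 -> row_free (mx_of_rows [:: a; b; c]).
Proof.
move=> ha hb hc g0; set M := mx_of_rows _.
have E (i j : 'I_3) : (M *m M^T) i j = dot ([:: a; b; c]`_i) ([:: a; b; c]`_j).
  by rewrite /dot !mxE; apply: eq_bigr => k _; rewrite !mxE.
have U : M *m M^T \in unitmx.
  rewrite unitmxE det_mx3 !E !inordK//= ha hb hc (dotC b a) (dotC c a) (dotC c b) unitfE.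
  rewrite (_ : dt3 _ _ _ _ _ _ _ _ _ = gram3 a b c)// /dt3 /gram3; ring.
by apply/row_freeP; exists (M^T *m invmx (M *m M^T)); rewrite mulmxA mulmxV.
Qed.

Lemma regular_is_octahedron Q : regular Q -> is_octahedron Q.
Proof.
move=> [h1 h2]; split=> // u v w f.
by apply: row_free_gram3; rewrite ?h1// lt0r_neq0// (h2 _ _ _ f).2.
Qed.

Lemma dot_rotation g x y : g *m g^T = 1%:M -> dot (x *m g) (y *m g) = dot x y.
Proof. by move=> h; rewrite /dot trmx_mul mulmxA -(mulmxA x) h mulmx1. Qed.

Lemma det4_rotation g a b c d : \det g = 1 ->
  det4 (a *m g) (b *m g) (c *m g) (d *m g) = det4 a b c d.
Proof.
move=> h; rewrite /det4; have -> : (mx_of_rows [:: a *m g; b *m g; c *m g; d *m g] : 'M[R]_4) =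
    mx_of_rows [:: a; b; c; d] *m g.
  apply/matrixP => i j; rewrite !mxE.
  by case: i => [[|[|[|[|//]]]] hi] /=; rewrite !mxE; apply: eq_bigr => k _; rewrite !mxE.
by rewrite (det_mulmx (mx_of_rows [:: a; b; c; d] : 'M[R]_4)) h mulr1.
Qed.

Lemma rotation_dihedral g Q u v w : is_rotation g ->
  Dcos (fun u => Q u *m g) u v w = Dcos Q u v w /\
  Dsin (fun u => Q u *m g) u v w = Dsin Q u v w.
Proof.
move=> [g1 g2]; rewrite /Dcos /Dsin /dih_cos /dih_sin /gram_offdiag /gram3.
by rewrite det4_rotation// !dot_rotation.
Qed.

Lemma rotation_regular g Q : is_rotation g -> regular Q -> regular (fun u => Q u *m g).
Proof.
move=> [g1 g2] [h1 h2]; split=> [u|u v w f]; first by rewrite dot_rotation.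
by have := h2 _ _ _ f; rewrite /gram3 !dot_rotation.
Qed.

Lemma frame_coords (x1 x2 x3 x4 : 'rV[R]_4) :
  let f := [:: x1; x2; x3; x4] in
  (forall i j : 'I_4, dot (f`_i) (f`_j) = (i == j)%:R) ->
  exists2 g, g *m g^T = 1%:M & \det g = det4 x1 x2 x3 x4 /\
    forall x, x = vec4 (dot x x1) (dot x x2) (dot x x3) (dot x x4) *m g.
Proof.
move=> f h; exists (mx_of_rows f : 'M[R]_4).
  apply/matrixP => i j; rewrite [RHS]mxE -h /dot !mxE.
  by apply: eq_bigr => k _; rewrite !mxE.
split=> // x; have gg : (mx_of_rows f : 'M[R]_4)^T *m (mx_of_rows f : 'M[R]_4) = 1%:M.
  apply: mulmx1C; apply/matrixP => i j; rewrite [RHS]mxE -h /dot !mxE.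
  by apply: eq_bigr => k _; rewrite !mxE.
rewrite -[LHS]mulmx1 -gg mulmxA; congr (_ *m _); apply/rowP => i.
have -> : (x *m (mx_of_rows f : 'M[R]_4)^T) 0 i = dot x (f`_i).
  by rewrite /dot !mxE; apply: eq_bigr => k _; rewrite !mxE.
by rewrite mxE; case: i => [[|[|[|[|//]]]] hi].
Qed.

End Isometries.

(** Abbreviates a term by an opaque variable, which later tactics cannot unfold. *)
Lemma ex_eq T (x : T) : exists y, y = x. Proof. by exists x. Qed.

Section Classification.
Variable R : realType.
Variables p q : bool -> R.
Hypotheses (hp : `|p false| < `|p true|) (hq : `|q false| < `|q true|).
Hypothesis hpq : p true ^+ 2 + q true ^+ 2 < 1.
Variable Q : octahedron R.
Hypothesis Qu : forall u, dot (Q u) (Q u) = 1.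
Hypothesis Qg : forall u v, adjacent u v -> dot (Q u) (Q v) = gram p q u v.

(* The vectors a3 + b3 and a3 - b3 are orthogonal, the first one to a2 and b2,
   the second one to a1 and b1; the planes spanned by a1, b1 and by a2, b2 are
   therefore orthogonal complements, and yield the frame of the formulae. *)
Lemma octahedron_classification : exists c s al be g,
  [/\ 0 < c, 0 < s, c ^+ 2 = al false ^+ 2 + p false ^+ 2,
      s ^+ 2 = be false ^+ 2 + q false ^+ 2 &
      [/\ on_curve p q al be, is_rotation g & forall u, Q u = oct_of p q c s al be u *m g]].
Proof.
have hp2 := sqr_p_lt hp; have hq2 := sqr_q_lt hq.
have e12 i j : dot (Q (@Ordinal 3 0 isT, i)) (Q (@Ordinal 3 1 isT, j)) = 0 by rewrite Qg.
have e13 i j : dot (Q (@Ordinal 3 0 isT, i)) (Q (@Ordinal 3 2 isT, j)) = p i by rewrite Qg.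
have e23 i j : dot (Q (@Ordinal 3 1 isT, i)) (Q (@Ordinal 3 2 isT, j)) = sg R j * q i by rewrite Qg.
pose a i := Q (@Ordinal 3 0 isT, i); pose b i := Q (@Ordinal 3 1 isT, i).
pose d i := Q (@Ordinal 3 2 isT, i).
have a1 i : dot (a i) (a i) = 1 := Qu _; have b1 i : dot (b i) (b i) = 1 := Qu _.
have d1 i : dot (d i) (d i) = 1 := Qu _.
pose x := 2^-1 *: (d false + d true); pose y := 2^-1 *: (d false - d true).
have xy : dot x y = 0 by rewrite /x /y !dot_lin !d1 (dotC (d true)); ring.
have xx_yy : dot x x + dot y y = 1 by rewrite /x /y !dot_lin !d1 (dotC (d true)); field.
have ax i : dot (a i) x = p i by rewrite /x !dot_lin !e13; field.
have ay i : dot (a i) y = 0 by rewrite /y !dot_lin !e13; ring.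
have bx i : dot (b i) x = 0 by rewrite /x !dot_lin !e23 /sg expr0 expr1; ring.
have bY i : dot (b i) y = q i by rewrite /y !dot_lin !e23 /sg expr0 expr1; field.
have ab i j : dot (a i) (b j) = 0 by exact: e12.
have dE i : d i = x + sg R i *: y.
  apply: coP => k _; rewrite /x /y /sg !(coD, coN, coZ).
  by case: i; rewrite ?expr0 ?expr1; field.
clearbody x y.
(* Cauchy-Schwarz makes the square roots of the formulae real; for the index [false] the
   inequalities become strict, which allows the divisions by A and B. *)
have px i : p i ^+ 2 <= dot x x by rewrite -ax (le_trans (cauchy_schwarz _ _))// a1 mul1r.
have qy i : q i ^+ 2 <= dot y y by rewrite -bY (le_trans (cauchy_schwarz _ _))// b1 mul1r.
have p0 := sqr_ge0 (p false); have q0 := sqr_ge0 (q false).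
have x0 : 0 < dot x x by have := px true; lra.
have y0 : 0 < dot y y by have := qy true; lra.
set c := Num.sqrt (dot x x); set s := Num.sqrt (dot y y).
have cc : c ^+ 2 = dot x x by rewrite sqr_sqrtr// ltW.
have ss : s ^+ 2 = dot y y by rewrite sqr_sqrtr// ltW.
have c0 : 0 < c by rewrite sqrtr_gt0. have s0 : 0 < s by rewrite sqrtr_gt0.
set A := Num.sqrt (c ^+ 2 - p false ^+ 2); set B := Num.sqrt (s ^+ 2 - q false ^+ 2).
have AA : A ^+ 2 = c ^+ 2 - p false ^+ 2.
  by rewrite sqr_sqrtr// cc; have := px true; lra.
have BB : B ^+ 2 = s ^+ 2 - q false ^+ 2.
  by rewrite sqr_sqrtr// ss; have := qy true; lra.
have A0 : 0 < A by rewrite sqrtr_gt0 cc; have := px true; lra.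
have B0 : 0 < B by rewrite sqrtr_gt0 ss; have := qy true; lra.
have [cn0 sn0 An0 Bn0] : [/\ c != 0, s != 0, A != 0 & B != 0] by rewrite !lt0r_neq0.
have [E1 E1E] := ex_eq (c^-1 *: x : 'rV[R]_4); have [E3 E3E] := ex_eq (s^-1 *: y : 'rV[R]_4).
(* Gram-Schmidt: E1 and E3 point along a3 + b3 and a3 - b3, while E2 and F4 are the normalized
   remainders of a1 and a2. *)
have [E2 E2E] := ex_eq ((c / A) *: (a false - (p false / c) *: E1) : 'rV[R]_4).
have [F4 F4E] := ex_eq ((s / B) *: (b false - (q false / s) *: E3) : 'rV[R]_4).
(* The orthonormal frame may be negatively oriented. Multiplying the last vector by its determinant,
   a sign, makes g a rotation and moves that sign into be. *)
have [ep epE] := ex_eq (det4 E1 E2 E3 F4); have [E4 E4E] := ex_eq (ep *: F4 : 'rV[R]_4).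
have [w11 w13 w33] : [/\ dot E1 E1 = 1, dot E1 E3 = 0 & dot E3 E3 = 1].
  by rewrite E1E E3E !dot_lin xy -cc -ss; split; field; rewrite ?cn0 ?sn0.
have [w12 w22 w32] : [/\ dot E1 E2 = 0, dot E2 E2 = 1 & dot E3 E2 = 0].
  have aE : dot (a false) E1 = p false / c by rewrite E1E !dot_lin ax mulrC.
  have aE3 : dot (a false) E3 = 0 by rewrite E3E !dot_lin ay mulr0.
  rewrite E2E !dot_lin !(dotC _ (a false)) aE aE3 a1 w11 (dotC E3) w13; split.
  - by field; rewrite cn0 An0.
  - transitivity ((c ^+ 2 - p false ^+ 2) / A ^+ 2); first by field; rewrite cn0 An0.
    by rewrite -AA divff// sqrf_eq0.
  - by ring.
have [f12 f14 f34 f44] : [/\ dot E1 F4 = 0, dot E2 F4 = 0, dot E3 F4 = 0 & dot F4 F4 = 1].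
  have bE : dot (b false) E3 = q false / s by rewrite E3E !dot_lin bY mulrC.
  have bE1 : dot (b false) E1 = 0 by rewrite E1E !dot_lin bx mulr0.
  have bE2 : dot (b false) E2 = 0.
    by rewrite E2E !dot_lin bE1 (dotC (b false)) ab; ring.
  rewrite F4E !dot_lin !(dotC _ (b false)) bE bE1 bE2 b1 w13 w33 (dotC E2) w32; split.
  - by ring.
  - by ring.
  - by field; rewrite sn0 Bn0.
  - transitivity ((s ^+ 2 - q false ^+ 2) / B ^+ 2); first by field; rewrite sn0 Bn0.
    by rewrite -BB divff// sqrf_eq0.
have ep2 : ep ^+ 2 = 1.
  rewrite expr2 epE det4_mul !(dotC F4) !(dotC E3 E1) !(dotC E2 E1) (dotC E2 E3).
  by rewrite w11 w12 w13 f12 w22 w32 f14 w33 f34 f44 /dt4 /dt3; ring.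
have detE : det4 E1 E2 E3 E4 = 1.
  rewrite -ep2 [RHS]expr2 {2}epE E4E !coords /dt4 /dt3; ring.
have [g g1 [g2 gE]] : exists2 g, g *m g^T = 1%:M & \det g = det4 E1 E2 E3 E4 /\
    forall x, x = vec4 (dot x E1) (dot x E2) (dot x E3) (dot x E4) *m g.
  apply: frame_coords => i j; have {}F : [/\ dot E1 E4 = 0, dot E2 E4 = 0, dot E3 E4 = 0 & dot E4 E4 = 1].
    by rewrite E4E !dot_lin f12 f14 f34 f44 !mulr0; split=> //; rewrite mulr1 -expr2.
  case: F => F1 F2 F3 F4'.
  case: i => [[|[|[|[|//]]]] hi]; case: j => [[|[|[|[|//]]]] hj] //=;
    by rewrite ?(dotC E4) ?(dotC E3 E1) ?(dotC E2 E1) ?(dotC E2 E3).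
exists c, s, (fun i => c * dot (a i) E2), (fun i => s * dot (b i) E4), g.
have aE1 i : dot (a i) E1 = p i / c by rewrite E1E !dot_lin ax mulrC.
have aE3 i : dot (a i) E3 = 0 by rewrite E3E !dot_lin ay mulr0.
have bE3 i : dot (b i) E3 = q i / s by rewrite E3E !dot_lin bY mulrC.
have bE1 i : dot (b i) E1 = 0 by rewrite E1E !dot_lin bx mulr0.
have aE4 i : dot (a i) E4 = 0.
  by rewrite E4E F4E !dot_lin aE3 ab; ring.
have bE2 i : dot (b i) E2 = 0.
  by rewrite E2E !dot_lin bE1 (dotC (b i)) ab; ring.
have xE : [/\ dot x E1 = c, dot x E2 = 0, dot x E3 = 0 & dot x E4 = 0].
  have xE1 : x = c *: E1 by rewrite E1E scalerA divff// scale1r.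
  by rewrite {1 2 3 4}xE1 !dotZl w11 w12 w13 E4E dotZr f12 !mulr0 mulr1.
have yE : [/\ dot y E1 = 0, dot y E2 = 0, dot y E3 = s & dot y E4 = 0].
  have yE3 : y = s *: E3 by rewrite E3E scalerA divff// scale1r.
  by rewrite {1 2 3 4}yE3 !dotZl w33 w32 (dotC E3 E1) w13 E4E dotZr f34 !mulr0 mulr1.
have aQ i : a i = vec4 (p i / c) (dot (a i) E2) 0 0 *m g.
  by rewrite {1}[a i]gE aE1 aE3 aE4.
have bQ i : b i = vec4 0 0 (q i / s) (dot (b i) E4) *m g.
  by rewrite {1}[b i]gE bE1 bE2 bE3.
have a2 i : (c * dot (a i) E2) ^+ 2 = c ^+ 2 - p i ^+ 2.
  have := a1 i; rewrite {1 2}aQ dot_rotation// dotE !co_vec4//= => h.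
  transitivity (c ^+ 2 * (p i / c * (p i / c) + dot (a i) E2 * dot (a i) E2 + 0 * 0 + 0 * 0) - p i ^+ 2).
    by field.
  by rewrite h mulr1.
have b2 i : (s * dot (b i) E4) ^+ 2 = s ^+ 2 - q i ^+ 2.
  have := b1 i; rewrite {1 2}bQ dot_rotation// dotE !co_vec4//= => h.
  transitivity (s ^+ 2 * (0 * 0 + 0 * 0 + q i / s * (q i / s) + dot (b i) E4 * dot (b i) E4) - q i ^+ 2).
    by field.
  by rewrite h mulr1.
have cs1 : c ^+ 2 + s ^+ 2 = 1 by rewrite cc ss.
split=> //; try by rewrite ?a2 ?b2; ring.
split; first by split; rewrite !(a2, b2) /kk -?cs1; ring.
  by split=> //; rewrite g2.
elim/vertex_cases => i; rewrite /oct_of /=.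
- by rewrite -/(a i) {1}aQ [c * _]mulrC mulfK.
- by rewrite -/(b i) {1}bQ [s * _]mulrC mulfK.
- rewrite -/(d i) {1}[d i]gE !dE !dotDl !dotZl.
  case: xE yE => -> -> -> -> [-> -> -> ->]; rewrite !mulr0 !addr0 add0r.
  by [].
Qed.

End Classification.

(** * The configuration space as the image of the curve *)

Section ConfigurationSpace.
Variable R : realType.
Variables p q : bool -> R.
Hypotheses (hp : `|p false| < `|p true|) (hq : `|q false| < `|q true|).
Hypothesis hpq : p true ^+ 2 + q true ^+ 2 < 1.
Implicit Types (al be : bool -> R) (e : edge) (Q : octahedron R) (t : RP1_12 R).

Definition curve_point al be : RP1_12 R :=
  fun e => half_tan_cs (angle_cos p q al be e) (angle_sin p q al be e).

Lemma edge_of_surj e : exists u v w, is_face u v w /\ edge_of u v = e.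
Proof.
elim/edge_cases: e => i j.
- exists (@Ordinal 3 1 isT, i), (@Ordinal 3 2 isT, j), (@Ordinal 3 0 isT, true).
  by split=> //; congr (_, _, _); apply: val_inj.
- exists (@Ordinal 3 2 isT, i), (@Ordinal 3 0 isT, j), (@Ordinal 3 1 isT, true).
  by split=> //; congr (_, _, _); apply: val_inj.
- exists (@Ordinal 3 0 isT, i), (@Ordinal 3 1 isT, j), (@Ordinal 3 2 isT, true).
  by split=> //; congr (_, _, _); apply: val_inj.
Qed.

Lemma half_tans_oct c s al be g t : c ^+ 2 = al false ^+ 2 + p false ^+ 2 ->
  s ^+ 2 = be false ^+ 2 + q false ^+ 2 -> on_curve p q al be -> is_rotation g ->
  has_half_tans (fun u => oct_of p q c s al be u *m g) t <-> t = curve_point al be.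
Proof.
move=> hc hs h hg; have rQ := rotation_regular hg (oct_regular hp hq hpq hc hs h).
have dE u v w : is_face u v w ->
    Dcos (fun u => oct_of p q c s al be u *m g) u v w = angle_cos p q al be (edge_of u v) /\
    Dsin (fun u => oct_of p q c s al be u *m g) u v w = angle_sin p q al be (edge_of u v).
  move=> f; have [-> ->] := rotation_dihedral (oct_of p q c s al be) u v w hg.
  exact: oct_angles.
split=> [ht|->].
  apply/funext => e; have [u [v [w [f <-]]]] := edge_of_surj e.
  by have [_ ->] := has_half_tans_face rQ ht f; have [-> ->] := dE _ _ _ f.
apply: has_half_tans_of => // u v w f; have [-> ->] := dE _ _ _ f.
by split=> //; exact: angle_sqr.
Qed.

Lemma rotation1 : is_rotation (1%:M : 'M[R]_4).
Proof. by split; rewrite ?det1// trmx1 mulmx1. Qed.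

Lemma mulmx1_oct (Q : octahedron R) : (fun u => Q u *m 1%:M) = Q.
Proof. by apply/funext => u; rewrite mulmx1. Qed.

Variable l : edge -> R.
Hypothesis hl : forall u v, adjacent u v -> cos (l (edge_of u v)) = gram p q u v.
Hypothesis hl0 : forall e, 0 < l e < pi.

Lemma edge_lengthsP Q : (forall u, dot (Q u) (Q u) = 1) ->
  has_edge_lengths Q l <-> forall u v, adjacent u v -> dot (Q u) (Q v) = gram p q u v.
Proof.
move=> Q1; split=> h u v uv; last first.
  by rewrite h// -hl// cosK// in_itv /= !ltW; have /andP[] := hl0 (edge_of u v).
rewrite -hl// -h// acosK// in_itv /=.
have := cauchy_schwarz (Q u) (Q v); rewrite !Q1 mul1r => le1.
by apply/andP; split; nra.
Qed.

Lemma lengths_sin e : 0 < sin (l e).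
Proof. exact: sin_gt0_pi. Qed.

Lemma oct_edge_lengths c s al be g : c ^+ 2 = al false ^+ 2 + p false ^+ 2 ->
  s ^+ 2 = be false ^+ 2 + q false ^+ 2 -> on_curve p q al be -> is_rotation g ->
  let Q u := oct_of p q c s al be u *m g in is_octahedron Q /\ has_edge_lengths Q l.
Proof.
move=> hc hs h hg Q; have rQ : regular Q.
  exact: (rotation_regular hg (oct_regular hp hq hpq hc hs h)).
split; first exact: regular_is_octahedron.
apply/edge_lengthsP; first exact: rQ.1.
by move=> u v uv; rewrite /Q dot_rotation ?hg.1// (oct_gram hp hq hc hs).
Qed.

Lemma config_spaceP t : config_space l t <->
  exists al be, on_curve p q al be /\ t = curve_point al be.
Proof.
split=> [[_ [Q [[Q1 _] lQ ht]]]|[al [be [h ->]]]].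
  have [c [s [al [be [g [c0 s0 hc hs [h hg QE]]]]]]] :=
    octahedron_classification hp hq Q1 ((edge_lengthsP Q1).1 lQ).
  exists al, be; split=> //; apply/(half_tans_oct _ hc hs h hg).
  by have <- : Q = (fun u => oct_of p q c s al be u *m g) by apply/funext.
have hc := sqr_sqrtr (ltW (on_curve_c2 hp hq h)).
have hs := sqr_sqrtr (ltW (on_curve_s2 hp hq h)).
have [oQ lQ] := oct_edge_lengths hc hs h rotation1; move: oQ lQ; rewrite mulmx1_oct => oQ lQ.
have tQ : has_half_tans (oct_of p q (Num.sqrt (al false ^+ 2 + p false ^+ 2))
    (Num.sqrt (be false ^+ 2 + q false ^+ 2)) al be) (curve_point al be).
  by have := (half_tans_oct (curve_point al be) hc hs h rotation1).2 erefl; rewrite mulmx1_oct.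
split; last by eexists; split; eauto.
have rQ := oct_regular hp hq hpq hc hs h.
move=> u v1 v2 f; apply: (link_equation_holds rQ) => // x y xy.
by rewrite lengths_sin hl// (oct_gram hp hq hc hs).
Qed.

End ConfigurationSpace.

Section FlexedOctahedron.
Variable R : realType.
Variables p q : bool -> R.

Lemma flexed_octahedronE th d1 d2 e1 e2 : 0 < cos th -> 0 < sin th ->
  flexed_octahedron (p false) (p true) (q false) (q true) th d1 d2 e1 e2 =
  oct_of p q (cos th) (sin th)
    (fun i => (if i then d2 else d1) * Num.sqrt (cos th ^+ 2 - p i ^+ 2))
    (fun j => (if j then e2 else e1) * Num.sqrt (sin th ^+ 2 - q j ^+ 2)).
Proof.
move=> c0 s0.
have E (c x : R) : 0 < c -> Num.sqrt (1 - x ^+ 2 / c ^+ 2) = Num.sqrt (c ^+ 2 - x ^+ 2) / c.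
  move=> cp; have -> : 1 - x ^+ 2 / c ^+ 2 = (c ^+ 2 - x ^+ 2) / c ^+ 2.
    by field; rewrite lt0r_neq0.
  by rewrite [X in Num.sqrt X = _]mulrC sqrtrM ?invr_ge0 ?sqr_ge0// sqrtrV ?sqr_ge0// sqrtr_sqr gtr0_norm// mulrC.
apply/funext; elim/vertex_cases => i; rewrite /flexed_octahedron /oct_of /=.
- by case: i; rewrite !E// mulrA.
- by case: i; rewrite !E// mulrA.
- by case: i; rewrite /sg ?expr0 ?expr1 ?mul1r ?mulN1r.
Qed.

End FlexedOctahedron.

(** * The configuration space as an algebraic curve *)

Section MultihomogeneousPolynomials.
Variable R : realType.
Implicit Types (p q : mpoly nvars R) (e : edge) (i : bool) (h g : 'I_nvars -> R).

Definition mvar e i : mpoly nvars R := mpolyX R (mnm1 (hvar e i)).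

Lemma hvar_ind (P : 'I_nvars -> Prop) : (forall e i, P (hvar e i)) -> forall k, P k.
Proof. by move=> h k; rewrite -(enum_valK k); case: (enum_val k) => e i; exact: h. Qed.

Lemma hvar_eq e i e' i' : (hvar e i == hvar e' i') = (e == e') && (i == i').
Proof. by rewrite /hvar (inj_eq enum_rank_inj). Qed.

Lemma mpoly_ring_ind (P : mpoly nvars R -> Prop) : (forall c, P (mpolyC nvars c)) ->
  (forall e i, P (mvar e i)) -> (forall p q, P p -> P q -> P (p + q)) ->
  (forall p q, P p -> P q -> P (p * q)) -> forall p, P p.
Proof.
move=> hC hX hD hM; elim/mpolyind => [|c m p _ _ ih]; first by rewrite -mpolyC0.
apply: (hD) => //; rewrite -mul_mpolyC; apply: (hM) => //; rewrite mpolyXE_id.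
apply: (big_ind P) => [||k _]; first by rewrite -mpolyC1.
  exact: (hM).
elim: (m k) => [|n IH]; first by rewrite expr0 -mpolyC1.
by rewrite exprS; apply: (hM) => //; elim/hvar_ind: k {IH}.
Qed.

(** The multidegree is explicit because a sum of multihomogeneous polynomials is controlled only
    when the degrees agree. *)
Definition mhom (d : edge -> nat) p := forall m, m \in msupp p ->
  forall e, (m (hvar e false) + m (hvar e true))%N = d e.

Lemma mhom_multihomogeneous d p : mhom d p -> multihomogeneous p.
Proof. by exists d. Qed.

Lemma mhomC c : mhom (fun=> 0%N) (mpolyC nvars c).
Proof.
move=> m; rewrite msuppC; case: eqP => //= _; rewrite inE => /eqP -> e.
by rewrite !mnm0E.
Qed.

Lemma mhomD d p q : mhom d p -> mhom d q -> mhom d (p + q).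
Proof. by move=> hp hq m /msuppD_le; rewrite mem_cat => /orP[/hp|/hq]. Qed.

Lemma mhomN d p : mhom d p -> mhom d (- p).
Proof. by move=> hp m; rewrite (perm_mem (msuppN p)) => /hp. Qed.

Lemma mhomM d d' p q : mhom d p -> mhom d' q -> mhom (fun e => d e + d' e)%N (p * q).
Proof.
move=> hp hq m /msuppM_le /allpairsP[[m1 m2] /= [/hp h1 /hq h2 ->]] e.
by rewrite !mnmDE addnACA h1 h2.
Qed.

Lemma mhomX e i : mhom (fun e' => (e == e') : nat) (mvar e i).
Proof.
move=> m; rewrite msuppX inE => /eqP -> e'.
by rewrite !mnm1E !hvar_eq; case: eqP => //= _; case: i.
Qed.

Lemma mhom_eq d d' p : d =1 d' -> mhom d p -> mhom d' p.
Proof. by move=> dd hp m /hp h e; rewrite h dd. Qed.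

Lemma mhom_sqr d p : mhom d p -> mhom (fun e => d e + d e)%N (p ^+ 2).
Proof. by move=> h; rewrite expr2; exact: mhomM. Qed.

Lemma mhomCM c d p : mhom d p -> mhom d (mpolyC nvars c * p).
Proof. by move=> h; have h' := mhomM (mhomC (c := c)) h; apply: mhom_eq h'. Qed.

(** Vanishing can therefore be tested in any homogeneous coordinates whose scaling factors are
    nonzero, not only in those of [hpoint]. *)
Lemma mhom_scale d p (la : edge -> R) g h : mhom d p ->
  (forall e i, g (hvar e i) = la e * h (hvar e i)) ->
  meval g p = (\prod_e la e ^+ d e) * meval h p.
Proof.
move=> hp gh; rewrite !mevalE big_distrr /= big_seq [RHS]big_seq.
apply: eq_bigr => m /hp hm; rewrite mulrCA; congr (_ * _).
have reix (F : 'I_nvars -> R) : \prod_k F k = \prod_e (F (hvar e true) * F (hvar e false)).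
  rewrite (reindex (@enum_rank _)) /=; last by apply: onW_bij; exact: enum_rank_bij.
  transitivity (\prod_(j : edge * bool) F (enum_rank (j.1, j.2))).
    by apply: eq_bigr => -[].
  rewrite -(pair_bigA _ (fun e i => F (enum_rank (e, i)))) /=.
  by apply: eq_bigr => e _; rewrite big_bool.
rewrite !reix -big_split /=; apply: eq_bigr => e _.
by rewrite !gh !exprMn mulrACA -exprD addnC hm.
Qed.

Lemma meval_mvar h e i : meval h (mvar e i) = h (hvar e i).
Proof. exact: mevalXU. Qed.

Lemma hpoint_hvar (t : RP1_12 R) e i : hpoint t (hvar e i) = hcoord (t e) i.
Proof. by rewrite /hpoint /hvar enum_rankK. Qed.

End MultihomogeneousPolynomials.

(** * The coordinate ring of the space curve *)

Section SpaceCurve.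
Variable R : realType.
Variables P Q : R.
Hypotheses (P0 : 0 < P) (P1 : P < 1) (Q0 : 0 < Q).

Definition xpol : {poly R} := (1 - P)%:P - P%:P * 'X ^+ 2.
Definition ypol : {poly R} := (1 - Q)%:P * 'X ^+ 2 - Q%:P.

Lemma xpolE T : xpol.[T] = 1 - P - P * T ^+ 2.
Proof. by rewrite /xpol !hornerE. Qed.
Lemma ypolE T : ypol.[T] = (1 - Q) * T ^+ 2 - Q.
Proof. by rewrite /ypol !hornerE. Qed.

(* The coordinates are (T, x, y). *)
Definition space_curve (u : R * R * R) :=
  u.1.2 ^+ 2 = xpol.[u.1.1] /\ u.2 ^+ 2 = ypol.[u.1.1].

(** Membership in the coordinate ring, through the normal form over R[T] in the basis 1, x, y, x
    y. *)
Definition curve_poly (F : R * R * R -> R) := exists f0 f1 f2 f3 : {poly R},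
  forall u, space_curve u -> F u = f0.[u.1.1] + f1.[u.1.1] * u.1.2 +
    f2.[u.1.1] * u.2 + f3.[u.1.1] * (u.1.2 * u.2).

Lemma curve_polyC c : curve_poly (fun=> c).
Proof. by exists c%:P, 0, 0, 0 => u _; rewrite !hornerE. Qed.
Lemma curve_polyT : curve_poly (fun u => u.1.1).
Proof. by exists 'X, 0, 0, 0 => u _; rewrite !hornerE. Qed.
Lemma curve_polyx : curve_poly (fun u => u.1.2).
Proof. by exists 0, 1, 0, 0 => u _; rewrite !hornerE. Qed.
Lemma curve_polyy : curve_poly (fun u => u.2).
Proof. by exists 0, 0, 1, 0 => u _; rewrite !hornerE. Qed.

Lemma curve_polyD F G : curve_poly F -> curve_poly G -> curve_poly (fun u => F u + G u).
Proof.
move=> [f0 [f1 [f2 [f3 hf]]]] [g0 [g1 [g2 [g3 hg]]]].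
exists (f0 + g0), (f1 + g1), (f2 + g2), (f3 + g3) => u hu.
by rewrite hf// hg// !hornerD; ring.
Qed.

Lemma curve_polyM F G : curve_poly F -> curve_poly G -> curve_poly (fun u => F u * G u).
Proof.
move=> [f0 [f1 [f2 [f3 hf]]]] [g0 [g1 [g2 [g3 hg]]]].
exists (f0 * g0 + f1 * g1 * xpol + f2 * g2 * ypol + f3 * g3 * xpol * ypol),
  (f0 * g1 + f1 * g0 + (f2 * g3 + f3 * g2) * ypol),
  (f0 * g2 + f2 * g0 + (f1 * g3 + f3 * g1) * xpol), (f0 * g3 + f3 * g0 + f1 * g2 + f2 * g1).
move=> u hu; rewrite hf// hg//; case: hu; move: xpol ypol => X Y hx hy.
by rewrite !(hornerD, hornerM) -hx -hy; ring.
Qed.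

Lemma poly_eq0_itv (h : {poly R}) a b : a < b ->
  (forall T, a < T < b -> h.[T] = 0) -> h = 0.
Proof.
move=> ab hz; apply/eqP/negPn/negP => h0.
(* The shift by two keeps all these points strictly between a and b. *)
pose rs := mkseq (fun k => a + (b - a) / (k.+2)%:R) (size h).
have ba : 0 < b - a by rewrite subr_gt0.
have : (size rs < size h)%N.
  apply: max_poly_roots => //.
    apply/allP => T /mapP[k _ ->]; rewrite /root hz//.
    rewrite ltrDl divr_gt0//= -ltrBrDl ltr_pdivrMr// -[ltLHS]mulr1 ltr_pM2l//.
    by rewrite ltr1n.
  rewrite map_inj_uniq ?iota_uniq// => j k /addrI /mulfI /invr_inj.
  by rewrite lt0r_neq0// => /(_ isT) /eqP; rewrite eqr_nat => /eqP[].
by rewrite size_mkseq ltnn.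
Qed.

Lemma finite_roots (h : {poly R}) : h != 0 -> finite_set [set T | h.[T] = 0].
Proof.
move=> h0; apply: contrapT => /infiniteP /pcard_leP/unsquash f.
pose rs := mkseq f (size h).
have : (size rs < size h)%N.
  apply: max_poly_roots => //.
    by apply/allP => T /mapP[k _ ->]; apply/eqP; exact: (@funS _ _ _ _ f k I).
  by rewrite map_inj_uniq ?iota_uniq// => j k; apply: inj; rewrite inE.
by rewrite size_mkseq ltnn.
Qed.

(* For T large [xpol] is negative, for T small [ypol] is negative and [xpol] is
   positive: a vanishing norm is then a sum of squares, hence the coordinate
   ring of the curve has no zero divisors. *)
Lemma curve_poly_eq0 F : curve_poly F ->
  ~ finite_set [set u | space_curve u /\ F u = 0] -> forall u, space_curve u -> F u = 0.
Proof.
move=> [f0 [f1 [f2 [f3 hF]]]] inf.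
(* c0 + c1 x is the product of F and its conjugate under y -> - y, and N is the product of c0 + c1 x
   and its conjugate under x -> - x. *)
pose c0 := f0 ^+ 2 + f1 ^+ 2 * xpol - (f2 ^+ 2 + f3 ^+ 2 * xpol) * ypol.
pose c1 := f0 * f1 *+ 2 - f2 * f3 *+ 2 * ypol.
pose N := c0 ^+ 2 - c1 ^+ 2 * xpol.
have c0E T : c0.[T] = f0.[T] ^+ 2 + f1.[T] ^+ 2 * xpol.[T]
    - (f2.[T] ^+ 2 + f3.[T] ^+ 2 * xpol.[T]) * ypol.[T].
  by rewrite /c0; move: xpol ypol => X Y; rewrite !(hornerD, hornerN, hornerM, horner_exp).
have c1E T : c1.[T] = 2 * f0.[T] * f1.[T] - 2 * f2.[T] * f3.[T] * ypol.[T].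
  rewrite /c1; move: ypol => Y.
  by rewrite !(hornerD, hornerN, hornerM, hornerMn); ring.
have NE T : N.[T] = c0.[T] ^+ 2 - c1.[T] ^+ 2 * xpol.[T].
  suff gen (a b X : {poly R}) : (a ^+ 2 - b ^+ 2 * X).[T] = a.[T] ^+ 2 - b.[T] ^+ 2 * X.[T] by exact: gen.
  by rewrite !(hornerD, hornerN, hornerM, horner_exp).
have rootN u : space_curve u -> F u = 0 -> N.[u.1.1] = 0.
  move=> hu; rewrite (hF _ hu); case: hu; case: u => -[T x] y /= hx hy h.
  have A : (f0.[T] + f1.[T] * x) ^+ 2 = (f2.[T] + f3.[T] * x) ^+ 2 * y ^+ 2.
    rewrite -exprMn -[RHS]sqrrN; congr (_ ^+ 2); apply/eqP; rewrite -subr_eq0 -h; apply/eqP; ring.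
  have C : c0.[T] = - (c1.[T] * x).
    rewrite c0E c1E -hy -hx; apply/eqP; rewrite -subr_eq0; apply/eqP.
    by rewrite -[RHS](subrr ((f0.[T] + f1.[T] * x) ^+ 2)) {2}A; ring.
  by rewrite NE C -hx; ring.
have N0 : N = 0.
  apply/eqP/negPn/negP => nN; apply: inf.
  (* Over each of the finitely many roots T of a nonzero N lie at most four points of the curve,
     indexed by the signs of x and y. *)
  pose G (v : R * bool * bool) : R * R * R :=
    (v.1.1, (-1) ^+ v.1.2 * Num.sqrt xpol.[v.1.1], (-1) ^+ v.2 * Num.sqrt ypol.[v.1.1]).
  apply: (@sub_finite_set _ _ (G @` ([set T | N.[T] = 0] `*` [set: bool] `*` [set: bool]))).
    move=> [[T x] y] /= [hu Fu]; exists (T, x < 0, y < 0) => /=.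
      by do 2!split => //=; exact: (rootN _ hu Fu).
    case: hu => /= hx hy; rewrite /G /= -hx -hy !sqrtr_sqr.
    by congr (_, _, _); rewrite -realEsign ?num_real.
  apply: finite_image; apply: finite_setX; last exact: finite_finset.
  by apply: finite_setX; [exact: finite_roots|exact: finite_finset].
have [c00 c10] : c0 = 0 /\ c1 = 0.
  (* For T > 1 / P > 1 one has P T^2 > 1, so [xpol] is negative and N = 0 is a vanishing sum of
     squares of c0 and a multiple of c1. *)
  pose M := P^-1.
  have M0 : 1 < M by rewrite /M invf_gt1.
  have key T : M < T < M + 1 -> c0.[T] = 0 /\ c1.[T] = 0.
    move=> /andP[MT _]; have xn : xpol.[T] < 0.
      have : 1 < P * T by rewrite mulrC -ltr_pdivrMr// div1r.
      by rewrite xpolE; nra.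
    have := NE T; rewrite N0 horner0 => /esym NT.
    have s0 := sqr_ge0 c0.[T]; have s1 := sqr_ge0 c1.[T].
    have z1 : c1.[T] ^+ 2 = 0 by nra.
    have z0 : c0.[T] ^+ 2 = 0 by rewrite z1 mul0r subr0 in NT.
    by split; apply/eqP; rewrite -sqrf_eq0 ?z0 ?z1.
  by split; apply: (@poly_eq0_itv _ M (M + 1)); rewrite ?ltrDl// => T /key[].
(* The curve has no real point above such T, but c0 = c1 = 0 holds as an identity of polynomials and
   so can be evaluated there. *)
have [d d0 hd] : exists2 d, 0 < d & forall T, 0 < T < d -> 0 < xpol.[T] /\ ypol.[T] < 0.
  exists (Num.min (1 - P) Q) => [|T /andP[T0]]; first by rewrite lt_min subr_gt0 P1 Q0.
  rewrite lt_min => /andP[TP TQ]; rewrite xpolE ypolE.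
  have h1 := P0; have h2 := P1; have h3 := Q0.
  have T1 : T < 1 by lra.
  by split; nra.
have key T : 0 < T < d -> [/\ f0.[T] = 0, f1.[T] = 0, f2.[T] = 0 & f3.[T] = 0].
  move=> /hd[xT yT].
  have AB x : x ^+ 2 = xpol.[T] -> f0.[T] + f1.[T] * x = 0 /\ f2.[T] + f3.[T] * x = 0.
    move=> hx; have := c0E T; have := c1E T; rewrite c00 c10 horner0 => h1 h0.
    have E : (f0.[T] + f1.[T] * x) ^+ 2 - (f2.[T] + f3.[T] * x) ^+ 2 * ypol.[T] = 0.
      transitivity (0 + 0 * x : R); last by rewrite mul0r addr0.
      by rewrite {1}h0 h1 -hx; ring.
    have s0 := sqr_ge0 (f0.[T] + f1.[T] * x); have s1 := sqr_ge0 (f2.[T] + f3.[T] * x).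
    have z1 : (f2.[T] + f3.[T] * x) ^+ 2 = 0 by nra.
    have z0 : (f0.[T] + f1.[T] * x) ^+ 2 = 0 by rewrite z1 mul0r subr0 in E.
    by split; apply/eqP; rewrite -sqrf_eq0 ?z0 ?z1.
  set x := Num.sqrt xpol.[T].
  have hx : x ^+ 2 = xpol.[T] by rewrite sqr_sqrtr// ltW.
  have x0 : x != 0 by rewrite lt0r_neq0// sqrtr_gt0.
  (* Both square roots of [xpol.[T]] are used, to separate f0 from f1 and f2 from f3. *)
  have [a1 b1] := AB x hx; have [a2 b2] := AB (- x) (etrans (sqrrN x) hx).
  have Z u v : u + v * x = 0 -> u + v * - x = 0 -> u = 0 /\ v = 0.
    move=> h1 h2; have u0 : u = 0 by lra.
    split=> //; apply: (mulIf x0); rewrite mul0r; lra.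
  by have [? ?] := Z _ _ a1 a2; have [? ?] := Z _ _ b1 b2.
have [e0 e1 e2 e3] : [/\ f0 = 0, f1 = 0, f2 = 0 & f3 = 0].
  by split; apply: (poly_eq0_itv d0) => T /key[].
by move=> u hu; rewrite hF// e0 e1 e2 e3 !horner0; ring.
Qed.

End SpaceCurve.

(** * Affine coordinates on the configuration space *)

Section AffineModel.
Variable R : realType.
Variables p q : bool -> R.
Hypotheses (hp : `|p false| < `|p true|) (hq : `|q false| < `|q true|).
Hypothesis hpq : p true ^+ 2 + q true ^+ 2 < 1.
Implicit Types (al be : bool -> R) (e : edge) (t : RP1_12 R) (u : R * R * R).

(** P and Q arise by dividing the relations of [on_curve] by al_1^2, which equals kk / (1 + T^2). *)
Definition Pc : R := (p true ^+ 2 - p false ^+ 2) / kk p q false false.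
Definition Qc : R := (q true ^+ 2 - q false ^+ 2) / kk p q false false.

Let K0 : 0 < kk p q false false. Proof. exact: kk_gt0. Qed.
Let Kn0 : kk p q false false != 0. Proof. exact: lt0r_neq0. Qed.

Lemma Pc_gt0 : 0 < Pc.
Proof. by rewrite divr_gt0// subr_gt0 sqr_p_lt. Qed.
Lemma Qc_gt0 : 0 < Qc.
Proof. by rewrite divr_gt0// subr_gt0 sqr_q_lt. Qed.
Lemma PQc_lt1 : Pc + Qc < 1.
Proof. by rewrite -mulrDl ltr_pdivrMr// mul1r /kk; have h := hpq; lra. Qed.
Lemma Pc_lt1 : Pc < 1.
Proof. by have := PQc_lt1; have := Qc_gt0; lra. Qed.
Lemma Qc_lt1 : Qc < 1.
Proof. by have := PQc_lt1; have := Pc_gt0; lra. Qed.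

Definition al_of u (i : bool) : R := if i then u.1.2 else 1.
Definition be_of u (i : bool) : R := if i then u.2 else u.1.1.
Definition point_of u : RP1_12 R := curve_point p q (al_of u) (be_of u).

Local Notation spc := (space_curve Pc Qc).

Lemma curve_pointZ (k : R) al be : k != 0 ->
  curve_point p q (fun i => k * al i) (fun j => k * be j) = curve_point p q al be.
Proof.
move=> k0; apply/funext => e; rewrite /curve_point /angle_cos /angle_sin.
have [-> -> ->] := formsZ p q al be k e.
by rewrite -!mulf_div !divff ?sqrf_eq0// !mul1r.
Qed.

Definition affine_of al be : R * R * R :=
  (be false / al false, al true / al false, be true / al false).

Lemma affine_space_curve al be : on_curve p q al be -> spc (affine_of al be).
Proof.
move=> h; have [a0 _] := on_curve_neq0 hp hq h; case: h => h0 h1 h2.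
rewrite /space_curve /= xpolE ypolE /Pc /Qc !expr_div_n h1 h2 -h0.
have n0 : al false ^+ 2 + be false ^+ 2 != 0 by rewrite h0.
by split; field; rewrite a0 n0.
Qed.

Lemma curve_point_affine al be : on_curve p q al be ->
  curve_point p q al be = point_of (affine_of al be).
Proof.
move=> h; have [a0 _] := on_curve_neq0 hp hq h.
rewrite /point_of -(curve_pointZ (al_of _) (be_of _) a0); congr curve_point; apply/funext => -[];
  by rewrite /al_of /be_of /=; field.
Qed.

(* The scaling factor [d * radius u] brings [al_of u], [be_of u] to the
   normalization of [on_curve]. *)
Definition radius u : R := Num.sqrt (kk p q false false / (1 + u.1.1 ^+ 2)).

Lemma radius_gt0 u : 0 < radius u.
Proof.
by rewrite sqrtr_gt0 divr_gt0// ltr_pwDl// sqr_ge0.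
Qed.

Lemma radius_sqr u : radius u ^+ 2 = kk p q false false / (1 + u.1.1 ^+ 2).
Proof. by rewrite sqr_sqrtr// ltW// divr_gt0// ltr_pwDl// sqr_ge0. Qed.

(** The sign d is delta_1. Both choices give the same point of the configuration space: this is the
    simultaneous reversal of the four signs. *)
Lemma on_curve_of d u : d ^+ 2 = 1 -> spc u ->
  on_curve p q (fun i => d * radius u * al_of u i) (fun i => d * radius u * be_of u i).
Proof.
move=> d2; case: u => -[T x] y [/= hx hy].
have T0 : 1 + T ^+ 2 != 0 by rewrite lt0r_neq0// ltr_pwDl// sqr_ge0.
rewrite /on_curve /al_of /be_of /= mulr1 !exprMn d2 !mul1r radius_sqr /= hx hy xpolE ypolE.
by rewrite /Pc /Qc; split; field; rewrite ?Kn0 ?T0.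
Qed.

Lemma point_of_scaled d u : d ^+ 2 = 1 -> spc u ->
  curve_point p q (fun i => d * radius u * al_of u i) (fun i => d * radius u * be_of u i)
  = point_of u.
Proof.
move=> d2 hu; apply: curve_pointZ; apply: mulf_neq0; last by rewrite lt0r_neq0 ?radius_gt0.
by rewrite -sqrf_eq0 d2 oner_eq0.
Qed.

Lemma spc_T_neq0 u : spc u -> u.1.1 != 0.
Proof.
case=> _ hy; apply: contraPneq hy => ->; rewrite ypolE => hy.
by have := sqr_ge0 u.2; have := Qc_gt0; rewrite hy; lra.
Qed.

Lemma rn_affine_gt0 u e : spc u -> 0 < rn p q id (al_of u) (be_of u) e.
Proof.
move=> hu; have := rn_gt0 hp hq hpq e (on_curve_of (expr1n _ 2) hu).
have [_ _ ->] := formsZ p q (al_of u) (be_of u) (1 * radius u) e.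
by rewrite pmulr_rgt0// exprn_gt0// mul1r radius_gt0.
Qed.

Lemma cn_sn_affine u e : spc u ->
  cn p q id (al_of u) (be_of u) e ^+ 2 + sn p q id (al_of u) (be_of u) e ^+ 2 =
  rn p q id (al_of u) (be_of u) e ^+ 2.
Proof.
move=> hu; have := cn_sn_sqr hp hq hpq e (on_curve_of (expr1n _ 2) hu).
have [-> -> ->] := formsZ p q (al_of u) (be_of u) (1 * radius u) e.
have : (1 * radius u) ^+ 2 != 0 by rewrite expf_neq0// mul1r lt0r_neq0// radius_gt0.
move: ((1 * radius u) ^+ 2) => k k0; rewrite !exprMn -mulrDr; apply: mulfI.
by rewrite expf_neq0.
Qed.

Lemma angle_affine u e : spc u ->
  angle_cos p q (al_of u) (be_of u) e ^+ 2 + angle_sin p q (al_of u) (be_of u) e ^+ 2 = 1.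
Proof.
move=> hu; rewrite /angle_cos /angle_sin !expr_div_n -mulrDl cn_sn_affine// divff//.
by rewrite sqrf_eq0 lt0r_neq0// rn_affine_gt0.
Qed.

Lemma sg_false : sg R false = 1. Proof. by []. Qed.
Lemma sg_true : sg R true = -1. Proof. by rewrite /sg expr1. Qed.

(* The edges a1 a2, a1 b2 and b1 a2. *)
Definition eT : edge := (@Ordinal 3 2 isT, false, false).
Definition eY : edge := (@Ordinal 3 2 isT, false, true).
Definition eU : edge := (@Ordinal 3 2 isT, true, false).

Let sqr1_neq0 (x : R) : 1 + x ^+ 2 != 0.
Proof. by rewrite lt0r_neq0// ltr_pwDl// sqr_ge0. Qed.

Lemma half_tan_cs_rational (x : R) :
  half_tan_cs ((1 - x ^+ 2) / (1 + x ^+ 2)) (2 * x / (1 + x ^+ 2)) = Some x.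
Proof.
have e : 1 + (1 - x ^+ 2) / (1 + x ^+ 2) = 2 / (1 + x ^+ 2) by field.
rewrite /half_tan_cs; case: eqVneq => [h|_].
  by move/eqP: e; rewrite h subrr eq_sym mulf_eq0 invr_eq0 (negPf (sqr1_neq0 x)) orbF pnatr_eq0.
by congr Some; rewrite e; field.
Qed.

Lemma point_of_T u : point_of u eT = Some (- u.1.1).
Proof.
rewrite -half_tan_cs_rational /point_of /curve_point /angle_cos /angle_sin /cn /sn /rn /=.
rewrite /al_of /be_of /= !sg_false; congr half_tan_cs; first by rewrite sqrrN expr1n.
by rewrite sqrrN expr1n; congr (_ / _); ring.
Qed.

Lemma point_of_Y u : point_of u eY = Some u.2.
Proof.
rewrite -half_tan_cs_rational /point_of /curve_point /angle_cos /angle_sin /cn /sn /rn /=.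
rewrite /al_of /be_of /= sg_false sg_true; congr half_tan_cs; first by rewrite expr1n.
by rewrite expr1n; congr (_ / _); ring.
Qed.

Lemma point_of_U u : spc u ->
  point_of u eU = if u.1.2 == 0 then None else Some (u.1.1 / u.1.2).
Proof.
move=> /spc_T_neq0; case: u => -[T x] y /= T0.
have T2 : 0 < T ^+ 2 by rewrite lt_neqAle sqr_ge0 eq_sym sqrf_eq0 T0.
have xT : x ^+ 2 + T ^+ 2 != 0 by rewrite lt0r_neq0// ltr_wpDl// sqr_ge0.
rewrite /point_of /curve_point /angle_cos /angle_sin /cn /sn /rn /= /al_of /be_of /= sg_false sg_true.
have e : 1 + (x ^+ 2 - T ^+ 2) / (x ^+ 2 + T ^+ 2) = 2 * x ^+ 2 / (x ^+ 2 + T ^+ 2) by field.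
rewrite /half_tan_cs -addr_eq0 addrC e mulf_eq0 invr_eq0 (negPf xT) orbF.
rewrite mulf_eq0 pnatr_eq0 /= sqrf_eq0; case: eqVneq => // x0.
by congr Some; field; rewrite x0 xT.
Qed.

(** The tangents at [eT], [eY] and [eU] are - T, y and T / x, and since T is nonzero the last one
    determines x, infinity included. *)
Lemma point_of_inj u v : spc u -> spc v -> point_of u = point_of v -> u = v.
Proof.
move=> hu hv uv; have := congr1 (@^~ eT) uv; rewrite !point_of_T => -[/oppr_inj eT'].
have := congr1 (@^~ eY) uv; rewrite !point_of_Y => -[eY'].
have := congr1 (@^~ eU) uv; rewrite !point_of_U//.
have := spc_T_neq0 hu; move: eT' eY' {hu hv uv}.
case: u v => -[T x] y [[T' x'] y'] /= -> -> T0.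
have [->|x0] := eqVneq x 0; have [->|x0'] := eqVneq x' 0 => //.
by case=> /(mulfI T0)/invr_inj ->.
Qed.

Variable l : edge -> R.
Hypothesis hl : forall v w, adjacent v w -> cos (l (edge_of v w)) = gram p q v w.
Hypothesis hl0 : forall e, 0 < l e < pi.

Lemma config_space_affine : config_space l = [set point_of u | u in spc].
Proof.
apply/seteqP; split=> t.
  move=> /(config_spaceP hp hq hpq hl hl0)[al [be [h ->]]].
  exists (affine_of al be); first exact: affine_space_curve.
  by rewrite curve_point_affine.
move=> [u hu <-]; apply/(config_spaceP hp hq hpq hl hl0).
rewrite -(point_of_scaled (expr1n _ 2) hu).
by do 2!eexists; split; first exact: (on_curve_of (expr1n _ 2) hu).
Qed.

End AffineModel.

(** * The Zariski topology of the curve *)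

Section ZariskiCurve.
Variable R : realType.
Variables p q : bool -> R.
Hypotheses (hp : `|p false| < `|p true|) (hq : `|q false| < `|q true|).
Hypothesis hpq : p true ^+ 2 + q true ^+ 2 < 1.
Implicit Types (e : edge) (t : RP1_12 R) (u : R * R * R) (f : mpoly nvars R).

Local Notation P := (Pc p q).
Local Notation Q := (Qc p q).
Local Notation spc := (space_curve P Q).
Local Notation pt := (point_of p q).
Local Notation cna u e := (cn p q id (al_of u) (be_of u) e).
Local Notation sna u e := (sn p q id (al_of u) (be_of u) e).
Local Notation rna u e := (rn p q id (al_of u) (be_of u) e).

Lemma curve_poly_forms e : [/\ curve_poly P Q (fun u => cna u e),
  curve_poly P Q (fun u => sna u e) & curve_poly P Q (fun u => rna u e)].
Proof.
have hC c : curve_poly P Q (fun=> c) := curve_polyC _ _ c.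
have hD := @curve_polyD R P Q; have hM := @curve_polyM R P Q.
have hS F : curve_poly P Q F -> curve_poly P Q (fun u => F u ^+ 2) by move=> h; exact: hM.
have hN F : curve_poly P Q F -> curve_poly P Q (fun u => - F u).
  move=> h; have := hM _ _ (hC (-1)) h; congr curve_poly.
  by apply/funext => u; rewrite mulN1r.
have ha i : curve_poly P Q (fun u => al_of u i).
  by case: i; [exact: curve_polyx|exact: curve_polyC].
have hb i : curve_poly P Q (fun u => be_of u i).
  by case: i; [exact: curve_polyy|exact: curve_polyT].
have hx : curve_poly P Q (fun u => u.1.2) := curve_polyx P Q.
have hy : curve_poly P Q (fun u => u.2) := curve_polyy P Q.
have hT : curve_poly P Q (fun u => u.1.1) := curve_polyT P Q.
by elim/edge_cases: e => i j; rewrite /cn /sn /rn /c2form /s2form /=; split;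
  do ?[exact: hC|exact: ha|exact: hb|exact: hx|exact: hy|exact: hT|apply: (hD)|apply: (hM)
      |apply: (hS)|apply: (hN)].
Qed.

(* Homogeneous coordinates of [pt u] that are polynomial in [u]; the flag [chi e]
   chooses (1 - cos : sin) rather than (sin : 1 + cos) for the tangent at [e]. *)
Definition poly_coords (chi : edge -> bool) u (k : 'I_nvars) : R :=
  let e := (enum_val k).1 in
  if chi e then if (enum_val k).2 then sna u e else rna u e - cna u e
  else if (enum_val k).2 then rna u e + cna u e else sna u e.

Lemma poly_coordsE chi u : spc u -> exists la : edge -> R,
  (forall e i, poly_coords chi u (hvar e i) = la e * hpoint (pt u) (hvar e i)) /\
  forall e, chi e = (angle_cos p q (al_of u) (be_of u) e == -1) -> la e != 0.
Proof.
move=> hu; pose C e := angle_cos p q (al_of u) (be_of u) e.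
pose S e := angle_sin p q (al_of u) (be_of u) e.
exists (fun e => rna u e * (if chi e then if C e == -1 then 2 else S e else 1 + C e)).
have r0 e : rna u e != 0 by rewrite lt0r_neq0// rn_affine_gt0.
have CS e : C e ^+ 2 + S e ^+ 2 = 1 by exact: angle_affine.
split=> [e i|e ->]; last first.
  rewrite mulf_neq0// -/(C e); case: (eqVneq (C e) (-1)) => c1 /=; first by rewrite pnatr_eq0.
  by rewrite addrC -[1]opprK subr_eq0.
rewrite hpoint_hvar /poly_coords /hvar enum_rankK /= -[pt u e]/(half_tan_cs (C e) (S e)).
have [h1 h2 h3 h4] := hcoord_half_tan_cs (CS e).
have cE : cna u e = rna u e * C e by rewrite /C /angle_cos mulrC divfK.
have sE : sna u e = rna u e * S e by rewrite /S /angle_sin mulrC divfK.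
rewrite cE sE -mulrA; case: (chi e).
  case: (eqVneq (C e) (-1)) => [/h4|/h3] [e1 e2]; case: i; rewrite -?e1 -?e2//; ring.
by case: i; rewrite -?h1 -?h2//; ring.
Qed.

(** The flags [chi] are adapted to the point u where vanishing is claimed, so that no pair of
    coordinates is zero there. Elsewhere a scaling factor may vanish, which can only add zeros and
    keeps the zero set infinite. *)
Lemma vanishes_infinite f : multihomogeneous f ->
  ~ finite_set [set u | spc u /\ vanishes_at f (pt u)] ->
  forall u, spc u -> vanishes_at f (pt u).
Proof.
move=> [d hd] inf u hu.
pose chi e := angle_cos p q (al_of u) (be_of u) e == -1.
have [la [laE la0]] := poly_coordsE chi hu.
have hF : curve_poly P Q (fun u => meval (poly_coords chi u) f).
  elim/mpoly_ring_ind: f {hd inf} => [c|e i|f g hf hg|f g hf hg].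
  - by under eq_fun do rewrite mevalC; exact: curve_polyC.
  - under eq_fun do rewrite meval_mvar.
    rewrite /poly_coords /hvar enum_rankK /=; have [h1 h2 h3] := curve_poly_forms e.
    case: (chi e); case: i => //.
      have := curve_polyD h3 (curve_polyM (curve_polyC P Q (-1)) h1); congr curve_poly.
      by apply/funext => v; rewrite mulN1r.
    exact: curve_polyD.
  - by under eq_fun do rewrite mevalD; exact: curve_polyD.
  - by under eq_fun do rewrite mevalM; exact: curve_polyM.
have sub : [set u | spc u /\ vanishes_at f (pt u)] `<=`
    [set u | spc u /\ meval (poly_coords chi u) f = 0].
  move=> v [hv zv]; split=> //; have [lb [lbE _]] := poly_coordsE chi hv.
  by rewrite (mhom_scale hd lbE) [meval _ _]zv mulr0.
have := curve_poly_eq0 (Pc_gt0 hp hq hpq) (Pc_lt1 hp hq hpq) (Qc_gt0 hp hq hpq) hF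
  (fun fin => inf (sub_finite_set sub fin)) hu.
rewrite (mhom_scale hd laE) => /eqP; rewrite mulf_eq0 => /orP[|/eqP//].
by rewrite prodf_seq_eq0 => /hasP[e _ /=]; rewrite expf_eq0 (negPf (la0 e erefl)) andbF.
Qed.

Lemma ellipse_space_curve (s x y : R) : s ^+ 2 = 1 ->
  P * y ^+ 2 + (1 - Q) * x ^+ 2 = 1 - P - Q ->
  spc (s * Num.sqrt ((Q + y ^+ 2) / (1 - Q)), x, y).
Proof.
move=> s2 h; have Q1 := Qc_lt1 hp hq hpq; have Q0 := Qc_gt0 hp hq hpq.
have q1 : 1 - Q != 0 by rewrite subr_eq0 gt_eqF.
have T2 : (s * Num.sqrt ((Q + y ^+ 2) / (1 - Q))) ^+ 2 = (Q + y ^+ 2) / (1 - Q).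
  by rewrite exprMn s2 mul1r sqr_sqrtr// divr_ge0 ?subr_ge0 ?ltW// ltr_wpDr ?sqr_ge0.
rewrite /space_curve /= xpolE ypolE T2; split; last by field.
apply: (mulfI q1); transitivity (1 - P - Q - P * y ^+ 2); first by rewrite -h; ring.
by field.
Qed.

Lemma space_curve_ellipse u : spc u ->
  P * u.2 ^+ 2 + (1 - Q) * u.1.2 ^+ 2 = 1 - P - Q.
Proof. by case=> -> ->; rewrite xpolE ypolE; ring. Qed.

Lemma infinite_space_curve : ~ finite_set spc.
Proof.
have Q1 := Qc_lt1 hp hq hpq; have P0 := Pc_gt0 hp hq hpq; have PQ := PQc_lt1 hp hq hpq.
have q1 : 1 - Q != 0 by rewrite subr_eq0 gt_eqF.
pose D := 1 - P - Q; have D0 : 0 < D by rewrite /D; lra.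
(* Infinitely many ordinates with y < D < 1, so that P y^2 <= D and the ellipse has a real point
   above each of them. *)
pose y (n : nat) : R := D / n.+2%:R.
have yD n : P * y n ^+ 2 <= D.
  have n2 : 1 < n.+2%:R :> R by rewrite ltr1n.
  have y0 : 0 < y n by rewrite divr_gt0.
  have yD : y n < D by rewrite ltr_pdivrMr// ltr_pMr.
  have D1 : D < 1 by rewrite /D; have := Qc_gt0 hp hq hpq; lra.
  have := Pc_lt1 hp hq hpq; nra.
pose g n : R * R * R := (1 * Num.sqrt ((Q + y n ^+ 2) / (1 - Q)),
  Num.sqrt ((D - P * y n ^+ 2) / (1 - Q)), y n).
have hg n : spc (g n).
  apply: ellipse_space_curve; first exact: expr1n.
  rewrite sqr_sqrtr; first by rewrite [(1 - Q) * _]mulrC divfK// addrC subrK.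
  by rewrite divr_ge0 ?subr_ge0// ltW.
move=> fin; apply: infinite_nat; rewrite (_ : [set: nat] = g @^-1` spc).
  apply: finite_preimage fin => m n _ _ /(congr1 snd) /= /mulfI.
  by rewrite lt0r_neq0// => /(_ isT) /invr_inj /eqP; rewrite eqr_nat => /eqP[].
by apply/seteqP; split=> // n _; exact: hg.
Qed.

Definition curve_set : set (RP1_12 R) := [set pt u | u in spc].

Lemma closed_finite (Z : set (RP1_12 R)) : zariski_closed Z ->
  ~ curve_set `<=` Z -> finite_set [set u | spc u /\ Z (pt u)].
Proof.
move=> [S [hS ZE]] nsub; apply: contrapT => inf; apply: nsub => _ [u hu <-].
rewrite ZE => f Sf; apply: vanishes_infinite => //; first exact: hS.
by move=> fin; apply: inf; apply: sub_finite_set fin => v [hv]; rewrite ZE => h; split=> //; exact: h.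
Qed.

(** A closed set that does not contain the curve meets it in finitely many points, so two such sets
    cannot cover it. *)
Lemma curve_set_irreducible : zariski_closed curve_set -> zariski_irreducible curve_set.
Proof.
move=> cl; split=> // [|Z1 Z2 c1 c2 sub].
  apply/set0P/negP => /eqP h0; apply: infinite_space_curve.
  rewrite (_ : space_curve _ _ = set0) //; apply/seteqP; split=> // u hu.
  by have : curve_set (pt u) by [exists u]; rewrite h0.
apply: contrapT => /not_orP[n1 n2]; apply: infinite_space_curve.
apply: (sub_finite_set _ (_ : finite_set ([set u | spc u /\ Z1 (pt u)] `|` [set u | spc u /\ Z2 (pt u)]))).
  by move=> u hu; have [] := sub (pt u); [exists u|left|right].
by rewrite finite_setU; split; exact: closed_finite.
Qed.

Definition point_form e (r : RP1 R) : mpoly nvars R :=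
  mpolyC nvars (hcoord r true) * mvar R e false + - (mpolyC nvars (hcoord r false) * mvar R e true).

Lemma point_form_multihomogeneous e r : multihomogeneous (point_form e r).
Proof.
apply: mhom_multihomogeneous; apply: mhomD; first by apply: mhomCM; exact: mhomX.
by apply: mhomN; apply: mhomCM; exact: mhomX.
Qed.

Lemma vanishes_point_form e r t : vanishes_at (point_form e r) t <-> t e = r.
Proof.
rewrite /vanishes_at /point_form mevalD mevalN !mevalM !mevalC !meval_mvar !hpoint_hvar.
case: (t e) => [x|]; case: r => [y|] /=; rewrite ?(mulr0, mulr1, mul0r, mul1r, oppr0, subr0, addr0, sub0r).
- by split=> [/eqP|[->]]; [rewrite subr_eq0 => /eqP ->|exact: subrr].
- by split=> // /eqP; rewrite oppr_eq0 oner_eq0.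
- by split=> // /eqP; rewrite oner_eq0.
- by [].
Qed.

Lemma multihomogeneousM f g : multihomogeneous f -> multihomogeneous g -> multihomogeneous (f * g).
Proof. by move=> [d hd] [d' hd']; apply: mhom_multihomogeneous; exact: mhomM hd hd'. Qed.

Lemma multihomogeneous1 : multihomogeneous (1 : mpoly nvars R).
Proof. by rewrite -mpolyC1; apply: mhom_multihomogeneous; exact: mhomC. Qed.

Lemma zariski_closed1 f : multihomogeneous f -> zariski_closed (vanishes_at f).
Proof.
move=> hf; exists [set f]; split=> [_ ->//|].
by apply/seteqP; split=> t /= h; [move=> _ ->|exact: h].
Qed.

(** For each edge, Z is covered by the locus where the coordinate is that of t1 and by the zeros of
    a product of linear forms for its other values. The second locus misses t1, so irreducibility
    selects the first. *)
Lemma irreducible_finite (Z : set (RP1_12 R)) t1 t2 : zariski_irreducible Z -> finite_set Z ->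
  Z t1 -> Z t2 -> t1 = t2.
Proof.
move=> [_ _ irr] fin Z1 Z2; apply/funext => e; apply: contrapT => ne.
have /finite_seqP[rs rsE] : finite_set [set t e | t in Z] by exact: finite_image.
pose g := \prod_(r <- rs | r != t1 e) point_form e r.
have hg : multihomogeneous g.
  apply: big_ind; [exact: multihomogeneous1|exact: multihomogeneousM|].
  by move=> *; exact: point_form_multihomogeneous.
have gE t : meval (hpoint t) g = \prod_(r <- rs | r != t1 e) meval (hpoint t) (point_form e r).
  exact: rmorph_prod.
have [] := irr _ _ (zariski_closed1 (point_form_multihomogeneous e (t1 e))) (zariski_closed1 hg).
- move=> t Zt; have [te|te] := eqVneq (t e) (t1 e); first by left; apply/vanishes_point_form.
  right; rewrite /vanishes_at gE; apply/eqP; rewrite prodf_seq_eq0; apply/hasP; exists (t e).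
    by have : [set t e | t in Z] (t e) by [exists t]; rewrite rsE.
  by rewrite te /=; apply/eqP/vanishes_point_form.
- by move=> /(_ _ Z2)/vanishes_point_form /esym.
- move=> /(_ _ Z1); rewrite /vanishes_at gE => /eqP; rewrite prodf_seq_eq0 => /hasP[r _ /andP[rt /eqP]].
  by move/vanishes_point_form => h; rewrite h eqxx in rt.
Qed.

Lemma zariski_closed_point t : zariski_closed [set t].
Proof.
exists [set f | exists e, f = point_form e (t e)]; split=> [_ [e ->]|].
  exact: point_form_multihomogeneous.
apply/seteqP; split=> [_ -> _ [e ->]|t' h]; first exact/vanishes_point_form.
by apply/funext => e; apply/vanishes_point_form; apply: h; exists e.
Qed.

Lemma zariski_irreducible_point t : zariski_irreducible [set t].
Proof.
split; [exact: zariski_closed_point|by exists t|move=> Z1 Z2 _ _ h].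
by have [h1|h2] := h t erefl; [left|right] => _ ->.
Qed.

(** In a chain C0 < C1 < C2 on the curve, C1 is a closed set that does not contain the curve, hence
    finite, hence a point, which leaves no room for C0. *)
Lemma curve_set_dimension : zariski_closed curve_set -> has_dimension curve_set 1.
Proof.
move=> cl; have irr := curve_set_irreducible cl; split.
  have [_ [t Gt] _] := irr; exists (fun i => if i == 0%N then [set t] else curve_set); split=> //.
  - by case=> [|i] _; [exact: zariski_irreducible_point|].
  - case=> // _ /=; rewrite properEneq; split; last by move=> _ ->.
    apply/eqP => tG; apply: infinite_space_curve.
    case: Gt => u hu tE; apply: (sub_finite_set _ (finite_set1 u)) => v hv.
    have : curve_set (pt v) by exists v.
    by rewrite -tG /= -tE => /(point_of_inj hp hq hpq hv hu) ->.
move=> [C [irrC lt12 sub]].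
have [h01 n01] := lt12 0%N isT; have [h12 n12] := lt12 1%N isT.
have sub1 : C 1%N `<=` curve_set by exact: subset_trans h12 sub.
have fin : finite_set (C 1%N).
  apply: (@sub_finite_set _ _ (pt @` [set u | spc u /\ C 1%N (pt u)])).
    by move=> t Ct; have [u hu tE] := sub1 t Ct; exists u => //; split=> //; rewrite tE.
  apply: finite_image; apply: closed_finite; first by case: (irrC 1%N isT).
  by move=> h; apply: n12; exact: subset_trans sub h.
apply: n01 => t Ct; have [_ [t0 C0] _] := irrC 0%N isT.
by rewrite (irreducible_finite (irrC 1%N isT) fin Ct (h01 _ C0)).
Qed.

End ZariskiCurve.

Lemma half_tan_cs_lin (R : realType) (c s : R) : c ^+ 2 + s ^+ 2 = 1 ->
  let X := hcoord (half_tan_cs c s) false in let Y := hcoord (half_tan_cs c s) true in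
  (1 + c) * X = s * Y /\ s * X = (1 - c) * Y.
Proof.
move=> h /=; have [N0 h1 h2] := half_tan_cs_quad h.
set X := hcoord _ false in N0 h1 h2 *; set Y := hcoord _ true in N0 h1 h2 *.
split; apply: (mulIf (lt0r_neq0 N0)); rewrite -[LHS]mulrA [X * _]mulrC mulrA -[RHS]mulrA
  [Y * _]mulrC mulrA ?mulrDl ?mulrBl -?h2 ?mulNr -h1; ring.
Qed.

(** * Multihomogeneous equations of the curve *)

Section Equations.
Variable R : realType.
Variables p q : bool -> R.
Hypotheses (hp : `|p false| < `|p true|) (hq : `|q false| < `|q true|).
Hypothesis hpq : p true ^+ 2 + q true ^+ 2 < 1.
Implicit Types (e : edge) (t : RP1_12 R) (u : R * R * R) (f g : mpoly nvars R).

Local Notation P := (Pc p q).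
Local Notation Q := (Qc p q).
Local Notation spc := (space_curve P Q).
Local Notation pt := (point_of p q).
Local Notation mC := (@mpolyC nvars R).
Local Notation X e := (mvar R e false).
Local Notation Y e := (mvar R e true).

(* Multihomogeneous coordinates of the projective point (1 : x : T : y), which
   is determined by -T, y and T / x. *)
Definition Apol (i : bool) : mpoly nvars R :=
  if i then - (X eT * Y eY * Y eU) else Y eT * Y eY * X eU.
Definition Bpol (j : bool) : mpoly nvars R :=
  if j then X eY * Y eT * X eU else - (X eT * Y eY * X eU).

(** [quad1] and [quad2] are y^2 = (1 - Q) T^2 - Q and x^2 = 1 - P - P T^2, made multihomogeneous in
    the three tangents - T, y and T / x. *)
Definition quad1 : mpoly nvars R :=
  X eY ^+ 2 * Y eT ^+ 2 + mC (- (1 - Q)) * (X eT ^+ 2 * Y eY ^+ 2) + mC Q * (Y eT ^+ 2 * Y eY ^+ 2).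
Definition quad2 : mpoly nvars R :=
  X eT ^+ 2 * Y eU ^+ 2 + mC (- (1 - P)) * (Y eT ^+ 2 * X eU ^+ 2) + mC P * (X eT ^+ 2 * X eU ^+ 2).

(** With cosine and sine known from (1 : x : T : y), proportionality to (s : 1 + c) and to (1 - c :
    s) fixes the tangent at e. Both equations are imposed since either pair may degenerate. *)
Definition lin1 e : mpoly nvars R := (rn p q mC Apol Bpol e + cn p q mC Apol Bpol e) * X e
  + - (sn p q mC Apol Bpol e * Y e).
Definition lin2 e : mpoly nvars R := sn p q mC Apol Bpol e * X e
  + - ((rn p q mC Apol Bpol e + - cn p q mC Apol Bpol e) * Y e).

Definition equations : set (mpoly nvars R) :=
  [set f | f = quad1 \/ f = quad2 \/ exists e, f = lin1 e \/ f = lin2 e].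

Lemma mhom_eq_nat (d d' : edge -> nat) f : mhom d f -> (forall e, d e = d' e) -> mhom d' f.
Proof. by move=> h dd; exact: mhom_eq h. Qed.

Lemma mhom_forms (d : edge -> nat) (A B : bool -> mpoly nvars R) e :
  (forall i, mhom d (A i)) -> (forall i, mhom d (B i)) ->
  [/\ mhom (fun e => d e + d e)%N (cn p q mC A B e), mhom (fun e => d e + d e)%N (sn p q mC A B e) &
      mhom (fun e => d e + d e)%N (rn p q mC A B e)].
Proof.
move=> hA hB; elim/edge_cases: e => i j; rewrite /cn /sn /rn /c2form /s2form /=; split;
  repeat lazymatch goal with
  | |- mhom _ (mpolyC _ _ * _) => apply: mhomCM
  | |- mhom _ (_ + _) => apply: mhomD
  | |- mhom _ (- _) => apply: mhomN
  | |- mhom _ (_ ^+ 2) => apply: mhom_sqr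
  | |- mhom _ (_ * _) => apply: mhomM
  | |- mhom _ (A _) => exact: hA
  | |- mhom _ (B _) => exact: hB
  end.
Qed.

Lemma equations_multihomogeneous : equations `<=` @multihomogeneous R.
Proof.
pose dA e := ((eT == e) + (eY == e) + (eU == e))%N.
have hA i : mhom dA (Apol i).
  by case: i; [apply: mhomN|]; do 2?[apply: mhomM; last exact: mhomX]; exact: mhomX.
have hB i : mhom dA (Bpol i).
  case: i; last by apply: mhomN; do 2?[apply: mhomM; last exact: mhomX]; exact: mhomX.
  apply: (@mhom_eq_nat (fun e => (eY == e) + (eT == e) + (eU == e))%N).
    by do 2?[apply: mhomM; last exact: mhomX]; exact: mhomX.
  by move=> e; rewrite /dA; congr (_ + _)%N; rewrite addnC.
have hforms e := mhom_forms e hA hB.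
move=> f [->|[->|[e [->|->]]]].
- have sq e i : mhom (fun e' => (e == e') + (e == e'))%N (mvar R e i ^+ 2).
    by apply: mhom_sqr; exact: mhomX.
  apply: mhom_multihomogeneous; apply: mhomD; last by apply: mhomCM; apply: mhomM; exact: sq.
  apply: mhomD; last by apply: mhomCM; apply: mhomM; exact: sq.
  apply: (@mhom_eq_nat (fun e => ((eY == e) + (eY == e)) + ((eT == e) + (eT == e)))%N).
    exact: mhomM.
  by move=> e; rewrite addnC.
- have sq e i : mhom (fun e' => (e == e') + (e == e'))%N (mvar R e i ^+ 2).
    by apply: mhom_sqr; exact: mhomX.
  apply: mhom_multihomogeneous; apply: mhomD; last by apply: mhomCM; apply: mhomM; exact: sq.
  by apply: mhomD; [|apply: mhomCM]; apply: mhomM; exact: sq.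
- have [h1 h2 h3] := hforms e; apply: mhom_multihomogeneous.
  exact: (mhomD (mhomM (mhomD h3 h1) (@mhomX R e false)) (mhomN (mhomM h2 (@mhomX R e true)))).
- have [h1 h2 h3] := hforms e; apply: mhom_multihomogeneous.
  exact: (mhomD (mhomM h2 (@mhomX R e false)) (mhomN (mhomM (mhomD h3 (mhomN h1)) (@mhomX R e true)))).
Qed.

Lemma meval_forms h e : [/\
  meval h (cn p q mC Apol Bpol e) = cn p q id (meval h \o Apol) (meval h \o Bpol) e,
  meval h (sn p q mC Apol Bpol e) = sn p q id (meval h \o Apol) (meval h \o Bpol) e &
  meval h (rn p q mC Apol Bpol e) = rn p q id (meval h \o Apol) (meval h \o Bpol) e].
Proof.
have [-> -> ->] := forms_morph p q (meval h) mC Apol Bpol e.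
by have -> : meval h \o mC = id by apply/funext => c; exact: mevalC.
Qed.

Lemma meval_Apol_Bpol t u : t eT = Some (- u.1.1) -> t eY = Some u.2 ->
  u.1.1 * hcoord (t eU) true = u.1.2 * hcoord (t eU) false ->
  meval (hpoint t) \o Apol = (fun i => hcoord (t eU) false * al_of u i) /\
  meval (hpoint t) \o Bpol = (fun i => hcoord (t eU) false * be_of u i).
Proof.
move=> hT hY hU; split; apply/funext => -[]; rewrite /= /al_of /be_of;
  rewrite ?mevalN !mevalM !meval_mvar !hpoint_hvar hT hY /=; first by rewrite mulr1 mulNr opprK hU mulrC.
all: by ring.
Qed.

Lemma point_of_U_coords u : spc u -> hcoord (pt u eU) false != 0 /\
  u.1.1 * hcoord (pt u eU) true = u.1.2 * hcoord (pt u eU) false.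
Proof.
move=> hu; have T0 := spc_T_neq0 hp hq hpq hu.
rewrite (point_of_U hp hq hpq hu); case: (eqVneq u.1.2 0) => [->|x0] /=.
  by rewrite oner_eq0 mulr0 mul0r.
by rewrite mulf_neq0 ?invr_eq0//; split=> //; field.
Qed.

Lemma meval_forms_point u e : spc u -> exists2 k : R, k != 0 & [/\
  meval (hpoint (pt u)) (cn p q mC Apol Bpol e) = k * angle_cos p q (al_of u) (be_of u) e,
  meval (hpoint (pt u)) (sn p q mC Apol Bpol e) = k * angle_sin p q (al_of u) (be_of u) e &
  meval (hpoint (pt u)) (rn p q mC Apol Bpol e) = k].
Proof.
move=> hu; have [U0 UV] := point_of_U_coords hu.
have [EA EB] := meval_Apol_Bpol (point_of_T p q u) (point_of_Y p q u) UV.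
have [-> -> ->] := meval_forms (hpoint (pt u)) e; rewrite EA EB.
have [-> -> ->] := formsZ p q (al_of u) (be_of u) (hcoord (pt u eU) false) e.
have r0 := lt0r_neq0 (rn_affine_gt0 hp hq hpq e hu).
exists (hcoord (pt u eU) false ^+ 2 * rn p q id (al_of u) (be_of u) e).
  by rewrite mulf_neq0// expf_neq0.
by rewrite /angle_cos /angle_sin; split=> //; field.
Qed.

Lemma equations_on_curve u : spc u -> forall f, equations f -> vanishes_at f (pt u).
Proof.
move=> hu f; have [U0 UV] := point_of_U_coords hu.
have [hx hy] := hu; rewrite xpolE in hx; rewrite ypolE in hy.
case=> [->|[->|[e he]]].
- rewrite /vanishes_at /quad1 !(mevalD, mevalM, mevalC) !meval_mvar !hpoint_hvar.
  rewrite point_of_T point_of_Y /=; transitivity (u.2 ^+ 2 - ((1 - Q) * u.1.1 ^+ 2 - Q)).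
    by ring.
  by rewrite hy subrr.
- rewrite /vanishes_at /quad2 !(mevalD, mevalM, mevalC) !meval_mvar !hpoint_hvar.
  rewrite point_of_T /=; set U := hcoord _ false in UV *; set V := hcoord _ true in UV *.
  transitivity ((u.1.1 * V) ^+ 2 - (1 - P - P * u.1.1 ^+ 2) * U ^+ 2); first by ring.
  by rewrite UV -hx; ring.
- have [k k0 [e1 e2 e3]] := meval_forms_point e hu.
  have [h1 h2] := half_tan_cs_lin (angle_affine hp hq hpq e hu).
  case: he => ->; rewrite /vanishes_at /lin1 /lin2 mevalD mevalN !mevalM !mevalD ?mevalN
    !meval_mvar !hpoint_hvar e1 e2 e3; apply/eqP; rewrite subr_eq0; apply/eqP.
    by rewrite -mulrA -h1; ring.
  by rewrite -mulrA h2; ring.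
Qed.

End Equations.

(** * Closedness of the curve and its tangent spaces *)

Section ClosedSmooth.
Variable R : realType.
Variables p q : bool -> R.
Hypotheses (hp : `|p false| < `|p true|) (hq : `|q false| < `|q true|).
Hypothesis hpq : p true ^+ 2 + q true ^+ 2 < 1.
Implicit Types (e : edge) (t : RP1_12 R) (u : R * R * R) (f g : mpoly nvars R).

Local Notation P := (Pc p q).
Local Notation Q := (Qc p q).
Local Notation spc := (space_curve P Q).
Local Notation pt := (point_of p q).
Local Notation mC := (@mpolyC nvars R).
Local Notation Ap := (Apol R).
Local Notation Bp := (Bpol R).

Let Q1 : 0 < 1 - Q. Proof. by have := Qc_lt1 hp hq hpq; lra. Qed.

(** The two quadratic equations exclude infinity at [eT] and [eY] and zero at [eU], after which T, x
    and y can be recovered. *)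
Lemma equations_space_curve t : vanishes_at (quad1 p q) t -> vanishes_at (quad2 p q) t ->
  exists u, [/\ spc u, t eT = Some (- u.1.1), t eY = Some u.2, hcoord (t eU) false != 0 &
    u.1.1 * hcoord (t eU) true = u.1.2 * hcoord (t eU) false].
Proof.
have P0 := Pc_gt0 hp hq hpq; have Q0 := Qc_gt0 hp hq hpq; have q1 := Q1.
rewrite /vanishes_at /quad1 /quad2 !(mevalD, mevalM, mevalC) !meval_mvar !hpoint_hvar.
set U := hcoord (t eU) false; set V := hcoord (t eU) true => h1 h2.
have UV : U = 0 -> V = 1 by rewrite /U /V; case: (t eU) => //= /eqP; rewrite oner_eq0.
have VV : V = 0 -> U = 1 by rewrite /U /V; case: (t eU) => //= ? /eqP; rewrite oner_eq0.
case: (t eT) h1 h2 => [a|] /= h1 h2; last first.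
  (* If the tangent at [eT] were infinite, [quad2] would be a positive definite form in (U, V). *)
  have hh : V ^+ 2 + P * U ^+ 2 = 0 by rewrite -h2; ring.
  have V0 := sqr_ge0 V; have U0 := sqr_ge0 U.
  have PU : 0 <= P * U ^+ 2 by rewrite mulr_ge0// ltW.
  have /VV U1 : V = 0 by apply/eqP; rewrite -sqrf_eq0; apply/eqP; lra.
  by move: hh; rewrite U1; lra.
case: (t eY) h1 => [y|] /= h1; last by exfalso; lra.
have hy : y ^+ 2 = (1 - Q) * a ^+ 2 - Q by apply/eqP; rewrite -subr_eq0 -h1; apply/eqP; ring.
have a0 : a != 0.
  by apply: contraPneq hy => ->; have := sqr_ge0 y => y0 hy; lra.
have U0 : U != 0.
  apply: contra_neq a0 => U0; rewrite U0 (UV U0) in h2.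
  by apply/eqP; rewrite -sqrf_eq0; apply/eqP; rewrite -h2; ring.
exists (- a, - a * V / U, y); rewrite /= opprK divfK//; split=> //.
split=> /=; last by rewrite ypolE hy; ring.
rewrite xpolE sqrrN; apply: (mulIf (expf_neq0 2 U0)).
transitivity (a ^+ 2 * V ^+ 2); first by field.
by apply/eqP; rewrite -subr_eq0 -h2; apply/eqP; ring.
Qed.

Lemma equations_curve_set t : (forall f, equations p q f -> vanishes_at f t) ->
  curve_set p q t.
Proof.
move=> h; have [] := equations_space_curve (h _ (or_introl erefl)) (h _ (or_intror (or_introl erefl))).
move=> u [hu hT hY U0 UV]; exists u => //; apply/esym/funext => e.
have [EA EB] := meval_Apol_Bpol hT hY UV.
set U := hcoord (t eU) false in U0 EA EB.
have r0 := lt0r_neq0 (rn_affine_gt0 hp hq hpq e hu).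
set r := rn p q id (al_of u) (be_of u) e in r0.
have cE : cn p q id (al_of u) (be_of u) e = r * angle_cos p q (al_of u) (be_of u) e.
  by rewrite /angle_cos mulrC divfK.
have sE : sn p q id (al_of u) (be_of u) e = r * angle_sin p q (al_of u) (be_of u) e.
  by rewrite /angle_sin mulrC divfK.
have m0 : U ^+ 2 * r != 0 by rewrite mulf_neq0// expf_neq0.
have e1 := h _ (or_intror (or_intror (ex_intro _ e (or_introl erefl)))).
have e2 := h _ (or_intror (or_intror (ex_intro _ e (or_intror erefl)))).
move: e1 e2; rewrite /vanishes_at /lin1 /lin2 !(mevalD, mevalN, mevalM) !meval_mvar !hpoint_hvar.
have [-> -> ->] := meval_forms p q (hpoint t) e; rewrite EA EB.
have [-> -> ->] := formsZ p q (al_of u) (be_of u) U e; rewrite -/r cE sE => e1 e2.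
apply: half_tan_cs_unique; first exact: angle_affine.
  by apply: (mulfI m0); apply/eqP; rewrite -subr_eq0 -e1; apply/eqP; ring.
by apply: (mulfI m0); apply/eqP; rewrite -subr_eq0 -e2; apply/eqP; ring.
Qed.

Lemma curve_set_closed : zariski_closed (curve_set p q).
Proof.
exists (equations p q); split; first exact: equations_multihomogeneous.
apply/seteqP; split=> [_ [u hu <-]|t]; first exact: equations_on_curve.
exact: equations_curve_set.
Qed.

Section Derivation.
Variables (t : RP1_12 R) (w : edge -> R).

(** A derivation over evaluation at t, so that equations can be linearized by the Leibniz rule,
    factor by factor. *)
Definition chart_diff f : R := \sum_e chart_deriv f t e * w e.

Lemma chart_diffD f g : chart_diff (f + g) = chart_diff f + chart_diff g.
Proof.
rewrite /chart_diff -big_split; apply: eq_bigr => e _.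
by rewrite /chart_deriv mderivD mevalD mulrDl.
Qed.

Lemma chart_diffN f : chart_diff (- f) = - chart_diff f.
Proof.
rewrite /chart_diff -sumrN; apply: eq_bigr => e _.
by rewrite /chart_deriv mderivN mevalN mulNr.
Qed.

Lemma chart_diffM f g : chart_diff (f * g) =
  chart_diff f * meval (hpoint t) g + meval (hpoint t) f * chart_diff g.
Proof.
rewrite /chart_diff mulr_suml mulr_sumr -big_split; apply: eq_bigr => e _.
by rewrite /= /chart_deriv mderivM mevalD !mevalM; ring.
Qed.

Lemma chart_diffC c : chart_diff (mC c) = 0.
Proof.
by rewrite /chart_diff big1// => e _; rewrite /chart_deriv mderivC meval0 mul0r.
Qed.

Lemma chart_diff_sqr f : chart_diff (f ^+ 2) = 2 * meval (hpoint t) f * chart_diff f.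
Proof. by rewrite expr2 chart_diffM [Z in Z + _]mulrC -mulr2n -mulrA mulr_natl. Qed.

Lemma mderiv_mvar e i e' i' : mderiv (hvar e' i') (mvar R e i) = ((e == e') && (i == i'))%:R.
Proof.
rewrite /mvar mderivX mnm1E hvar_eq; case: andP => [[/eqP -> /eqP ->]|_]; last by rewrite scale0r.
have -> : mnm_sub (mnm1 (hvar e' i')) (mnm1 (hvar e' i')) = mnm0.
  by apply/mnmP => k; rewrite mnmBE subnn mnm0E.
by rewrite mpolyX0 scale1r.
Qed.

Lemma chart_diffX e i : chart_diff (mvar R e i) = if i == (t e == None) then w e else 0.
Proof.
rewrite /chart_diff (bigD1 e)//= big1 ?addr0 => [|e' ne].
  rewrite /chart_deriv mderiv_mvar eqxx /=; case: (i == _).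
    by rewrite meval1 mul1r.
  by rewrite meval0 mul0r.
by rewrite /chart_deriv mderiv_mvar eq_sym (negPf ne) /= meval0 mul0r.
Qed.

Lemma chart_diff_forms (A B : bool -> mpoly nvars R) e :
  (forall i, chart_diff (A i) = 0) -> (forall i, chart_diff (B i) = 0) ->
  [/\ chart_diff (cn p q mC A B e) = 0, chart_diff (sn p q mC A B e) = 0 &
      chart_diff (rn p q mC A B e) = 0].
Proof.
move=> hA hB.
have hD f g : chart_diff f = 0 -> chart_diff g = 0 -> chart_diff (f + g) = 0.
  by move=> h1 h2; rewrite chart_diffD h1 h2 addr0.
have hN f : chart_diff f = 0 -> chart_diff (- f) = 0 by rewrite chart_diffN => ->; rewrite oppr0.
have hM f g : chart_diff f = 0 -> chart_diff g = 0 -> chart_diff (f * g) = 0.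
  by move=> h1 h2; rewrite chart_diffM h1 h2 mul0r mulr0 addr0.
have hS f : chart_diff f = 0 -> chart_diff (f ^+ 2) = 0 by move=> h; exact: hM.
elim/edge_cases: e => i j; rewrite /cn /sn /rn /c2form /s2form /=; split;
  repeat lazymatch goal with
  | |- chart_diff (_ + _) = 0 => apply: (hD)
  | |- chart_diff (- _) = 0 => apply: (hN)
  | |- chart_diff (_ ^+ 2) = 0 => apply: (hS)
  | |- chart_diff (_ * _) = 0 => apply: (hM)
  | |- chart_diff (mpolyC _ _) = 0 => exact: chart_diffC
  | |- chart_diff (A _) = 0 => exact: hA
  | |- chart_diff (B _) = 0 => exact: hB
  end.
Qed.

End Derivation.

(** An edge whose tangent is a local parameter of the curve. The coordinate y fails to be one where
    x = 0, at the ends of the y-axis of the ellipse; there the chart x / T at [eU] replaces it. *)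
Definition base_edge u : edge := if u.1.2 == 0 then eU else eY.

(** The linearized quadratic equations kill w at [eT], [eY] and [eU], so the differentials of [Apol]
    and [Bpol] vanish. What remains of [lin1] and [lin2] is (1 + cos) w e = 0 at a finite tangent
    and (1 - cos) w e = 0 at an infinite one, both with a nonzero factor. *)
Lemma tangent_eq0 u w : spc u -> zariski_tangent (curve_set p q) (pt u) w ->
  w (base_edge u) = 0 -> forall e, w e = 0.
Proof.
move=> hu tw wb.
have D f : equations p q f -> chart_diff (pt u) w f = 0.
  move=> hf; apply: tw; first exact: (equations_multihomogeneous hf).
  by move=> _ [v hv <-]; exact: equations_on_curve.
have T0 := spc_T_neq0 hp hq hpq hu.
have [U0 UV] := point_of_U_coords hp hq hpq hu.
have P0 := Pc_gt0 hp hq hpq; have q1 := Q1.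
have [hx hy] := hu; rewrite xpolE in hx; rewrite ypolE in hy.
have tT := point_of_T p q u; have tY := point_of_Y p q u; have tU := point_of_U hp hq hpq hu.
have d1 := D _ (or_introl erefl); have d2 := D _ (or_intror (or_introl erefl)).
have W : [/\ w eT = 0, w eY = 0 & w eU = 0].
  move: d1 d2; rewrite /quad1 /quad2.
  rewrite !(chart_diffD, chart_diffN, chart_diff_sqr, chart_diffM, chart_diffC, chart_diffX).
  rewrite !(mevalD, mevalM, mevalC) !meval_mvar !hpoint_hvar !tT !tY !tU /=.
  move: wb; rewrite /base_edge; have [x0|x0] := eqVneq u.1.2 0 => /= -> d1 d2.
    have wT : w eT = 0.
      apply: (mulfI T0); rewrite mulr0; apply: (mulfI (lt0r_neq0 P0)); rewrite mulr0.
      lra.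
    (* x and y never vanish together, because P + Q < 1. *)
    split=> //; have y0 : u.2 != 0.
      apply: contraPneq hy => y0; rewrite y0 expr0n /= => hy.
      move: hx; rewrite x0 expr0n /= => hx; have PQ := PQc_lt1 hp hq hpq.
      have := Qc_gt0 hp hq hpq => Q0; have := sqr_ge0 u.1.1; nra.
    by apply: (mulfI y0); rewrite mulr0; rewrite wT in d1; lra.
  have wT : w eT = 0.
    apply: (mulfI T0); rewrite mulr0; apply: (mulfI (lt0r_neq0 q1)); rewrite mulr0; lra.
  split=> //; rewrite wT in d2.
  apply: (mulfI (expf_neq0 2 x0)); rewrite mulr0 hx.
  have Tx : u.1.1 / u.1.2 != 0 by rewrite mulf_neq0// invr_eq0.
  by apply: (mulfI Tx); rewrite mulr0; lra.
case: W => wT wY wU.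
have X0 e i : e \in [:: eT; eY; eU] -> chart_diff (pt u) w (mvar R e i) = 0.
  by rewrite chart_diffX !inE => /or3P[] /eqP ->; case: ifP => // _.
have hA i : chart_diff (pt u) w (Ap i) = 0.
  by case: i; rewrite /Apol !(chart_diffN, chart_diffM) !X0// !(mulr0, mul0r, addr0, oppr0).
have hB i : chart_diff (pt u) w (Bp i) = 0.
  by case: i; rewrite /Bpol !(chart_diffN, chart_diffM) !X0// !(mulr0, mul0r, addr0, oppr0).
move=> e; have [f1 f2 f3] := chart_diff_forms e hA hB.
have d3 := D _ (or_intror (or_intror (ex_intro _ e (or_introl erefl)))).
have d4 := D _ (or_intror (or_intror (ex_intro _ e (or_intror erefl)))).
move: d3 d4; rewrite /lin1 /lin2.
rewrite !(chart_diffD, chart_diffN, chart_diffM) f1 f2 f3 !chart_diffX.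
have [k k0 [e1 e2 e3]] := meval_forms_point hp hq hpq e hu.
rewrite !(mevalD, mevalN) e1 e2 e3 !(mul0r, oppr0, addr0, add0r).
case E : (pt u e) => [z|] /=; rewrite ?mulr0 ?oppr0 ?addr0 ?add0r => /eqP + /eqP.
  move=> + _; rewrite mulf_eq0 => /orP[|/eqP//].
  rewrite -{1}[k]mulr1 -mulrDr mulf_eq0 (negPf k0) /= addrC addr_eq0 => /eqP c1.
  by move: E; rewrite /point_of /curve_point /half_tan_cs c1 eqxx.
move=> _; rewrite oppr_eq0 mulf_eq0 => /orP[|/eqP//].
rewrite -{1}[k]mulr1 -mulrBr mulf_eq0 (negPf k0) /= subr_eq0 => /eqP c1.
move: E; rewrite /point_of /curve_point /half_tan_cs -c1; case: eqP => //.
by move=> /eqP; rewrite -subr_eq0 opprK -mulr2n pnatr_eq0.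
Qed.

End ClosedSmooth.

(** * Real analytic germs *)

Section PowerSeries.
Variable R : realType.
Implicit Types (a b h k : nat -> R) (f g : R -> R) (r s z M N : R).

Definition psum a z n : R := \sum_(0 <= i < n) a i * z ^+ i.
Definition conv a b n : R := \sum_(0 <= i < n.+1) a i * b (n - i)%N.

(* With explicit bounds, no argument on convergence is needed before
   [analytic0_analytic_at]. *)
Definition is_psum f a r M := [/\ 0 < r, forall n, psum (fun i => `|a i|) r n <= M &
  forall z n, `|z| < r -> `|f z - psum a z n| <= M * (`|z| / r) ^+ n].

Lemma is_psum_ge0 f a r M : is_psum f a r M -> 0 <= M.
Proof. by case=> _ h _; have := h 0%N; rewrite /psum big_geq. Qed.

Lemma psum_abs_le a r s n : 0 <= s -> s <= r ->
  psum (fun i => `|a i|) s n <= psum (fun i => `|a i|) r n.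
Proof.
move=> s0 sr; apply: ler_sum => i _; rewrite ler_wpM2l//.
by rewrite lerXn2r ?nnegrE// (le_trans s0).
Qed.

Lemma is_psum_shrink f a r M s : is_psum f a r M -> 0 < s -> s <= r -> is_psum f a s M.
Proof.
move=> hf s0 sr; have M0 := is_psum_ge0 hf; case: hf => r0 h1 h2; split=> // [n|z n zs].
  by apply: le_trans (h1 n); apply: psum_abs_le => //; exact: ltW.
apply: (le_trans (h2 z n (lt_le_trans zs sr))); rewrite ler_wpM2l//.
have zr0 : 0 <= `|z| / r by rewrite divr_ge0// ltW.
have zs0 : 0 <= `|z| / s by rewrite divr_ge0// ltW.
by rewrite lerXn2r// ler_pdivrMr// mulrAC ler_pdivlMr// ler_wpM2l.
Qed.

(** With rho = |z| / r <= 1, a term of the tail contains |z|^i = r^i rho^i <= r^i rho^n. *)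
Lemma psum_near a r M z n m : 0 < r -> (forall n, psum (fun i => `|a i|) r n <= M) ->
  `|z| < r -> (n <= m)%N -> `|psum a z m - psum a z n| <= M * (`|z| / r) ^+ n.
Proof.
move=> r0 h1 zr nm; have rho0 : 0 <= `|z| / r by rewrite divr_ge0// ltW.
have rho1 : `|z| / r <= 1 by rewrite ler_pdivrMr// mul1r ltW.
rewrite /psum (big_cat_nat (leq0n n) nm)//= addrAC subrr add0r.
apply: (le_trans (ler_norm_sum _ _ _)).
apply: (@le_trans _ _ (\sum_(n <= i < m) `|a i| * r ^+ i * (`|z| / r) ^+ n)).
  rewrite big_seq [leRHS]big_seq; apply: ler_sum => i; rewrite mem_index_iota => /andP[ni _].
  rewrite normrM normrX -mulrA ler_wpM2l//.
  have -> : `|z| ^+ i = r ^+ i * (`|z| / r) ^+ i.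
    by rewrite -exprMn mulrC divfK// lt0r_neq0.
  by rewrite ler_wpM2l ?exprn_ge0 ?(ltW r0)// ler_wiXn2l.
rewrite -mulr_suml ler_wpM2r ?exprn_ge0//; apply: le_trans (h1 m).
rewrite [leRHS]/psum (big_cat_nat (leq0n n) nm)//=.
rewrite ler_wpDl// sumr_ge0// => i _.
by rewrite mulr_ge0// exprn_ge0// ltW.
Qed.

Lemma is_psum_of_cvg f a r M : 0 < r -> (forall n, psum (fun i => `|a i|) r n <= M) ->
  (forall z, `|z| < r -> series (fun i => a i * z ^+ i) @ \oo --> f z) -> is_psum f a r M.
Proof.
move=> r0 h1 hf; split=> // z n zr; apply/ler_addgt0Pl => e e0.
have /cvgrPdist_lt /(_ e e0) [m _ hm] := hf z zr.
have := hm (maxn m n) (leq_maxl _ _) => /= h.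
have -> : f z - psum a z n = (f z - psum a z (maxn m n)) + (psum a z (maxn m n) - psum a z n) by ring.
apply: (le_trans (ler_normD _ _)); apply: lerD; first exact: ltW.
by apply: psum_near; rewrite ?leq_maxr.
Qed.

Lemma is_psum_exists a r M : 0 < r -> (forall n, psum (fun i => `|a i|) r n <= M) ->
  exists f, is_psum f a r M.
Proof.
move=> r0 h1; exists (fun z => limn (series (fun i => a i * z ^+ i))).
apply: is_psum_of_cvg => // z zr; apply: normed_cvg; apply: nondecreasing_is_cvgn.
  by apply/nondecreasing_seqP => n; rewrite /normed_series_of seriesSr lerDl; exact: normr_ge0.
exists M => _ [n _ <-]; apply: le_trans (h1 n); apply: ler_sum => i _.
by rewrite /= normrM normrX ler_wpM2l// lerXn2r ?nnegrE// ltW.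
Qed.

Lemma geometric_small M r z e : `|z| < r -> 0 < e -> exists n, M * (`|z| / r) ^+ n < e.
Proof.
move=> zr e0; have r0 : 0 < r := le_lt_trans (normr_ge0 z) zr.
have : M * (`|z| / r) ^+ n @[n --> \oo] --> 0.
  rewrite -[X in _ --> X](mulr0 M); apply: cvgM; first exact: cvg_cst.
  apply: cvg_expr; rewrite ger0_norm; first by rewrite ltr_pdivrMr// mul1r.
  by rewrite divr_ge0// ltW.
move/cvgrPdist_lt => /(_ e e0) [n _ hn]; exists n.
have := hn n (leqnn n); rewrite /= sub0r normrN => h.
exact: le_lt_trans (ler_norm _) h.
Qed.

Lemma is_psum_cvg f a r M z : is_psum f a r M -> `|z| < r ->
  series (fun i => a i * z ^+ i) @ \oo --> f z.
Proof.
move=> hf zr; have M0 := is_psum_ge0 hf; case: hf => r0 h1 h2.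
apply/cvgrPdist_lt => e e0; have [n hn] := geometric_small M zr e0.
exists n => // m /= nm; apply: le_lt_trans (h2 z m zr) _; apply: le_lt_trans hn.
have rho0 : 0 <= `|z| / r by rewrite divr_ge0// ltW.
have rho1 : `|z| / r <= 1 by rewrite ler_pdivrMr// mul1r ltW.
by rewrite ler_wpM2l// ler_wiXn2l.
Qed.

Lemma is_psum_eq f g a r s M N z : is_psum f a r M -> is_psum g a s N ->
  `|z| < r -> `|z| < s -> f z = g z.
Proof. by move=> hf hg zr zs; apply: (cvg_unique _ (is_psum_cvg hf zr) (is_psum_cvg hg zs)). Qed.

Lemma is_psum_ext f g a r M : (forall z, `|z| < r -> f z = g z) ->
  is_psum f a r M -> is_psum g a r M.
Proof. by move=> fg [r0 h1 h2]; split=> // z n zr; rewrite -fg//; exact: h2. Qed.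

Lemma is_psum_delta c n0 : is_psum (fun z => c * z ^+ n0) (fun i => if i == n0 then c else 0) 1 `|c|.
Proof.
have E (F : nat -> R) n : \sum_(0 <= i < n) (if i == n0 then F i else 0) = if (n0 < n)%N then F n0 else 0.
  elim: n => [|n IH]; first by rewrite big_geq.
  rewrite big_nat_recr//= IH ltnS; have [->|ne] := eqVneq n n0; first by rewrite ltnn leqnn add0r.
  by rewrite addr0 [(n0 <= n)%N]leq_eqVlt [n0 == n]eq_sym (negPf ne).
split=> // [n|z n z1]; rewrite /psum.
  under eq_bigr do rewrite expr1n mulr1 (fun_if (fun x => `|x|)) normr0.
  by rewrite (E (fun=> `|c|)); case: ifP.
have -> : \sum_(0 <= i < n) (if i == n0 then c else 0) * z ^+ i = if (n0 < n)%N then c * z ^+ n0 else 0.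
  by rewrite -(E (fun i => c * z ^+ i)); apply: eq_bigr => i _; case: ifP => // _; rewrite mul0r.
rewrite divr1; case: ifPn => [_|]; first by rewrite subrr normr0 mulr_ge0 ?exprn_ge0.
by rewrite -leqNgt subr0 normrM normrX => nn; rewrite ler_wpM2l// ler_wiXn2l// ltW.
Qed.

Lemma is_psumD f g a b r M N : is_psum f a r M -> is_psum g b r N ->
  is_psum (fun z => f z + g z) (fun i => a i + b i) r (M + N).
Proof.
move=> [r0 h1 h2] [_ k1 k2]; split=> // [n|z n zr].
  apply: le_trans (lerD (h1 n) (k1 n)); rewrite -big_split; apply: ler_sum => i _ /=.
  by rewrite -mulrDl ler_wpM2r ?exprn_ge0 ?(ltW r0)// ler_normD.
have -> : f z + g z - psum (fun i => a i + b i) z n = (f z - psum a z n) + (g z - psum b z n).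
  rewrite /psum; under eq_bigr do rewrite mulrDl.
  by rewrite big_split /=; ring.
by rewrite mulrDl; apply: le_trans (ler_normD _ _) _; apply: lerD; [exact: h2|exact: k2].
Qed.

Lemma triangle_sum (F : nat -> nat -> R) n :
  \sum_(0 <= m < n) \sum_(0 <= i < m.+1) F i (m - i)%N = \sum_(0 <= i < n) \sum_(0 <= j < n - i) F i j.
Proof.
elim: n => [|n IH]; first by rewrite !big_geq.
rewrite big_nat_recr//= IH [RHS]big_nat_recr//= subSnn big_nat1 [\sum_(0 <= i < n.+1) _]big_nat_recr//= subnn addrA.
congr (_ + _); rewrite -big_split /= big_seq [RHS]big_seq; apply: eq_bigr => i.
by rewrite mem_index_iota => /andP[_ lt_in]; rewrite subSn 1?ltnW// big_nat_recr.
Qed.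

Lemma psum_conv a b z n : psum (conv a b) z n =
  \sum_(0 <= i < n) \sum_(0 <= j < n - i) (a i * z ^+ i) * (b j * z ^+ j).
Proof.
rewrite -(triangle_sum (fun i j => (a i * z ^+ i) * (b j * z ^+ j))) /psum.
apply: eq_bigr => m _; rewrite /conv mulr_suml big_seq [RHS]big_seq; apply: eq_bigr => i.
by rewrite mem_index_iota ltnS => /andP[_ im]; rewrite mulrACA -exprD subnKC.
Qed.

Lemma psum_conv_abs a b r n : 0 <= r ->
  psum (fun i => `|conv a b i|) r n <=
  \sum_(0 <= i < n) \sum_(0 <= j < n - i) (`|a i| * r ^+ i) * (`|b j| * r ^+ j).
Proof.
move=> r0; rewrite -(psum_conv (fun i => `|a i|) (fun i => `|b i|)); apply: ler_sum => i _.
rewrite ler_wpM2r ?exprn_ge0//; apply: le_trans (ler_norm_sum _ _ _) _.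
by apply: ler_sum => j _; rewrite normrM.
Qed.

(** With A and B the n-th partial sums, f g - conv = (f - A) g + A (g - B) + (A B - conv). Each of
    the three terms is at most M N rho^n, which explains the factor 3; the last one collects the
    products of order i + j >= n. *)
Lemma is_psumM f g a b r M N : is_psum f a r M -> is_psum g b r N ->
  is_psum (fun z => f z * g z) (conv a b) r (3 * M * N).
Proof.
move=> hf hg; have M0 := is_psum_ge0 hf; have N0 := is_psum_ge0 hg.
case: hf hg => r0 h1 h2 [_ k1 k2].
have MN0 : 0 <= M * N by rewrite mulr_ge0.
have sub n (A B : nat -> R) : (forall i, 0 <= A i) -> (forall i, 0 <= B i) ->
    (\sum_(0 <= i < n) A i <= M) -> (\sum_(0 <= i < n) B i <= N) ->
    \sum_(0 <= i < n) \sum_(0 <= j < n) A i * B j <= M * N.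
  move=> A0 B0 hA hB; rewrite (eq_bigr (fun i => A i * \sum_(0 <= j < n) B j)).
    by rewrite -mulr_suml ler_pM// sumr_ge0.
  by move=> i _; rewrite mulr_sumr.
pose A i := `|a i| * r ^+ i; pose B i := `|b i| * r ^+ i.
have A0 i : 0 <= A i by rewrite mulr_ge0// exprn_ge0// ltW.
have B0 i : 0 <= B i by rewrite mulr_ge0// exprn_ge0// ltW.
split=> // [n|z n zr].
  apply: le_trans (psum_conv_abs _ _ _ (ltW r0)) _.
  apply: (@le_trans _ _ (M * N)); last by rewrite -mulrA; lra.
  apply: le_trans (sub n A B A0 B0 (h1 n) (k1 n)); apply: ler_sum => i _.
  have le_n : (n - i <= n)%N := leq_subr i n.
  rewrite [leRHS](big_cat_nat (leq0n (n - i)) le_n)//= lerDl.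
  by rewrite sumr_ge0// => j _; rewrite mulr_ge0.
set rho := `|z| / r.
have rho0 : 0 <= rho by rewrite divr_ge0// ltW.
have rho1 : rho <= 1 by rewrite ler_pdivrMr// mul1r ltW.
have zE : `|z| = r * rho by rewrite mulrC divfK// lt0r_neq0.
have h2z : `|f z - psum a z n| <= M * rho ^+ n := h2 z n zr.
have k2z : `|g z - psum b z n| <= N * rho ^+ n := k2 z n zr.
clearbody rho.
have gz : `|g z| <= N.
  by have := k2 z 0%N zr; rewrite /psum big_geq// subr0 expr0 mulr1.
have az : `|psum a z n| <= M.
  apply: le_trans (h1 n); apply: le_trans (ler_norm_sum _ _ _) _; apply: ler_sum => i _.
  by rewrite normrM normrX ler_wpM2l// lerXn2r ?nnegrE// ltW.
have tail : `|psum a z n * psum b z n - psum (conv a b) z n| <= M * N * rho ^+ n.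
  rewrite psum_conv {1}/psum mulr_suml -sumrB.
  apply: le_trans (ler_norm_sum _ _ _) _.
  apply: (@le_trans _ _ (\sum_(0 <= i < n) \sum_(0 <= j < n) A i * B j * rho ^+ n)); last first.
    rewrite (eq_bigr (fun i => (\sum_(0 <= j < n) A i * B j) * rho ^+ n)).
      rewrite -mulr_suml ler_wpM2r ?exprn_ge0//.
      exact: (sub n A B A0 B0 (h1 n) (k1 n)).
    by move=> i _; rewrite mulr_suml.
  rewrite big_seq [leRHS]big_seq; apply: ler_sum => i; rewrite mem_index_iota => /andP[_ lt_in].
  have le_n : (n - i <= n)%N := leq_subr i n.
  rewrite /psum (big_cat_nat (leq0n (n - i)) le_n)//= mulrDr mulr_sumr addrAC subrr add0r.
  rewrite mulr_sumr; apply: le_trans (ler_norm_sum _ _ _) _.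
  rewrite [leRHS](big_cat_nat (leq0n (n - i)) le_n)//= ler_wpDl//.
    rewrite sumr_ge0// => j _; apply: mulr_ge0; last exact: exprn_ge0.
    by apply: mulr_ge0; [exact: A0|exact: B0].
  rewrite big_seq [leRHS]big_seq; apply: ler_sum => j; rewrite mem_index_iota => /andP[ij _].
  have -> : `|a i * z ^+ i * (b j * z ^+ j)| = A i * B j * rho ^+ (i + j).
    by rewrite !normrM !normrX zE !exprMn exprD /A /B; ring.
  rewrite ler_wpM2l//; first by apply: mulr_ge0; [exact: A0|exact: B0].
  rewrite ler_wiXn2l//.
  by rewrite -leq_subLR.
have -> : f z * g z - psum (conv a b) z n = (f z - psum a z n) * g z
    + psum a z n * (g z - psum b z n) + (psum a z n * psum b z n - psum (conv a b) z n) by ring.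
apply: le_trans (ler_normD _ _) _.
have e1 : `|(f z - psum a z n) * g z| <= M * N * rho ^+ n.
  by rewrite normrM mulrAC ler_pM.
have e2 : `|psum a z n * (g z - psum b z n)| <= M * N * rho ^+ n.
  by rewrite normrM -mulrA ler_pM.
have := ler_normD ((f z - psum a z n) * g z) (psum a z n * (g z - psum b z n)).
by move=> e3; lra.
Qed.

End PowerSeries.

Section Analytic.
Variable R : realType.
Implicit Types (a b h k : nat -> R) (f g : R -> R) (r s z M N c : R).

(** Course-of-values recursion through the list of the values found so far. *)
Lemma strong_recursion (F : nat -> (nat -> R) -> R) :
  (forall n b b', (forall j, (j < n)%N -> b j = b' j) -> F n b = F n b') ->
  exists b, forall n, b n = F n b.
Proof.
move=> hF; pose B := fix B n := if n is m.+1 then rcons (B m) (F m (nth 0 (B m))) else [::].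
have sB n : size (B n) = n by elim: n => //= n IH; rewrite size_rcons IH.
have nB n m j : (j < n)%N -> (n <= m)%N -> nth 0 (B m) j = nth 0 (B n) j.
  move=> jn; elim: m => [|m IH]; first by rewrite leqn0 => /eqP n0; rewrite n0 in jn.
  rewrite leq_eqVlt => /orP[/eqP -> //|nm] /=; rewrite nth_rcons sB.
  by rewrite (leq_trans jn nm) IH.
exists (fun n => nth 0 (B n.+1) n) => n.
rewrite /= nth_rcons sB ltnn eqxx; apply: hF => j jn.
by rewrite -(nB j.+1 n j).
Qed.

Lemma is_psum_coef0 f a r M : is_psum f a r M -> a 0%N = f 0.
Proof.
case=> r0 _ h2; have := h2 0 1%N; rewrite normr0 => /(_ r0).
rewrite mul0r expr1 mulr0 normr_le0 subr_eq0 => /eqP ->.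
by rewrite /psum big_nat1 expr0 mulr1.
Qed.

Lemma is_psumZ c f a r M : is_psum f a r M ->
  is_psum (fun z => c * f z) (fun i => c * a i) r (`|c| * M).
Proof.
move=> [r0 h1 h2]; split=> // [n|z n zr].
  apply: le_trans (ler_wpM2l (normr_ge0 c) (h1 n)); rewrite /psum mulr_sumr.
  by apply: ler_sum => i _; rewrite normrM mulrA.
have -> : c * f z - psum (fun i => c * a i) z n = c * (f z - psum a z n).
  by rewrite mulrBr /psum mulr_sumr; congr (_ - _); apply: eq_bigr => i _; rewrite mulrA.
by rewrite normrM -mulrA ler_wpM2l// h2.
Qed.

(** When the radius is multiplied by x <= 1, every term of positive order shrinks at least by the
    factor x. *)
Lemma psum_abs_small f a r M e : is_psum f a r M -> a 0%N = 0 -> 0 < e ->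
  exists s, [/\ 0 < s, s <= r & forall n, psum (fun i => `|a i|) s n <= e].
Proof.
move=> hf a0 e0; have M0 := is_psum_ge0 hf; case: hf => r0 h1 _.
have D0 : 0 < M + 1 + e by lra.
pose x := e / (M + 1 + e); have x0 : 0 < x by rewrite divr_gt0.
have x1 : x <= 1 by rewrite ler_pdivrMr// mul1r; lra.
exists (x * r); split; [exact: mulr_gt0|by rewrite ler_piMl// ltW|move=> n].
apply: (@le_trans _ _ (x * M)); last first.
  by rewrite /x mulrAC ler_pdivrMr// ler_wpM2l ?ltW//; lra.
apply: le_trans (ler_wpM2l (ltW x0) (h1 n)); rewrite /psum mulr_sumr.
apply: ler_sum => -[|i] _; first by rewrite a0 normr0 !mul0r mulr0.
rewrite mulrCA ler_wpM2l// exprMn ler_wpM2r ?exprn_ge0 ?(ltW r0)//.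
by rewrite exprS ler_piMr ?(ltW x0)// exprn_ile1// ltW.
Qed.

(** Without constant terms, i + j <= n leaves only positive i and j, hence both below n. This drop
    of the index by one drives the induction in [quadratic_fixpoint]. *)
Lemma triangle_le (A B : nat -> R) n : (forall i, 0 <= A i) -> (forall i, 0 <= B i) ->
  A 0%N = 0 -> B 0%N = 0 ->
  \sum_(0 <= i < n.+1) \sum_(0 <= j < n.+1 - i) A i * B j <=
  (\sum_(0 <= i < n) A i) * (\sum_(0 <= j < n) B j).
Proof.
move=> A0 B0 a0 b0; rewrite big_nat_recr//= subSnn big_nat1 b0 mulr0 addr0 mulr_suml.
apply: ler_sum => -[|i] _; first by rewrite a0 mul0r big1// => j _; rewrite mul0r.
rewrite mulr_sumr subSS; have le_n : (n - i <= n)%N := leq_subr i n.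
rewrite [leRHS](big_cat_nat (leq0n (n - i)) le_n)//= lerDl sumr_ge0// => j _.
by rewrite mulr_ge0.
Qed.

(* Implicit function theorem for [g = h + k g + c g^2]: the recursion for the
   coefficients of g is majorized by the same equation for the sums of their
   absolute values, which keeps these sums below a fixed bound. *)
Lemma quadratic_fixpoint (hf kf : R -> R) h k c r M N : is_psum hf h r M -> is_psum kf k r N ->
  hf 0 = 0 -> kf 0 = 0 -> exists g b s L, [/\ is_psum g b s L,
    forall z, `|z| < s -> g z = hf z + kf z * g z + c * (g z * g z) &
    forall z, `|z| < s -> `|g z| < 1].
Proof.
move=> hh hk hz kz.
have eh : h 0%N = 0 by rewrite (is_psum_coef0 hh).
have ek : k 0%N = 0 by rewrite (is_psum_coef0 hk).
(* Truncation makes the recursion well founded. It changes nothing in the end, as the coefficient of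
   order n is only ever multiplied by a constant term, which is zero. *)
pose tr n b j : R := if (j < n)%N then b j else 0.
pose F n b : R := if n == 0%N then 0 else h n + conv k (tr n b) n + c * conv (tr n b) (tr n b) n.
have [b bF] : exists b, forall n, b n = F n b.
  apply: strong_recursion => n b b' bb; rewrite /F.
  suff -> : tr n b = tr n b' by [].
  by apply/funext => j; rewrite /tr; case: ifP => // /bb.
have b0 : b 0%N = 0 by rewrite bF.
have bE n : b n = h n + conv k b n + c * conv b b n.
  case: n => [|n]; first by rewrite /conv !big_nat1 b0 eh !mulr0 !addr0.
  rewrite bF /F /=; congr (_ + _ + c * _); rewrite /conv.
    rewrite big_seq [RHS]big_seq; apply: eq_bigr => -[|i]; first by rewrite ek !mul0r.
    by move=> _; rewrite /tr subSS ltnS leq_subr.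
  rewrite big_seq [RHS]big_seq; apply: eq_bigr => -[|i]; first by rewrite b0 /tr /= b0 !mul0r.
  rewrite mem_index_iota ltnS /tr subSS [(n - i < n.+1)%N]ltnS leq_subr /= => i_n.
  case: ltnP => // n_i; have -> : i = n by apply/anti_leq; rewrite -ltnS i_n -ltnS n_i.
  by rewrite subnn b0 !mulr0.
(* With this bound |c| sg <= 1/4, so the three terms of the recursion contribute at most sg / 4
   each. Moreover sg <= 1/4 yields |g| < 1. *)
pose sg : R := (4 * (`|c| + 1))^-1.
have c0 : 0 < `|c| + 1 by rewrite ltr_wpDl.
have sg0 : 0 < sg by rewrite invr_gt0 mulr_gt0.
have csg : `|c| * sg <= 4^-1.
  by rewrite /sg invfM mulrCA -[leRHS]mulr1 ler_wpM2l ?invr_ge0// ler_pdivrMr// mul1r lerDl.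
have sg1 : sg <= 4^-1.
  rewrite /sg invfM -[leRHS]mulr1 ler_wpM2l ?invr_ge0// invf_le1// lerDr//.
have sg4 : 0 < sg / 4 by rewrite divr_gt0.
have q4 : 0 < 4^-1 :> R by rewrite invr_gt0.
have [s1 [s10 s1r H1]] := psum_abs_small hh eh sg4.
have [s2 [s20 s2r H2]] := psum_abs_small hk ek q4.
pose s := Num.min s1 s2.
have s0 : 0 < s by rewrite lt_min s10 s20.
have ss1 : s <= s1 by rewrite ge_min lexx.
have ss2 : s <= s2 by rewrite ge_min lexx orbT.
have H n : psum (fun i => `|h i|) s n <= sg / 4.
  by apply: le_trans (H1 n); apply: psum_abs_le => //; exact: ltW.
have K n : psum (fun i => `|k i|) s n <= 4^-1.
  by apply: le_trans (H2 n); apply: psum_abs_le => //; exact: ltW.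
clearbody s.
pose A (u : nat -> R) i := `|u i| * s ^+ i.
have A0 u i : 0 <= A u i by rewrite mulr_ge0// exprn_ge0// ltW.
have S0 (u : nat -> R) n : 0 <= psum (fun i => `|u i|) s n.
  rewrite /psum sumr_ge0// => i _.
  by rewrite mulr_ge0 ?exprn_ge0 ?(ltW s0).
have bound n : psum (fun i => `|b i|) s n <= sg.
  elim: n => [|n IH]; first by rewrite /psum big_geq// ltW.
  have cv u v : u 0%N = 0 -> v 0%N = 0 -> psum (fun i => `|conv u v i|) s n.+1 <=
      psum (fun i => `|u i|) s n * psum (fun i => `|v i|) s n.
    move=> u0 v0; apply: le_trans (psum_conv_abs _ _ _ (ltW s0)) _.
    by apply: (triangle_le n (A0 u) (A0 v)); rewrite /A ?u0 ?v0 normr0 mul0r.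
  have hb := cv k b ek b0; have bb := cv b b b0 b0.
  apply: (@le_trans _ _ (psum (fun i => `|h i|) s n.+1 + psum (fun i => `|conv k b i|) s n.+1
    + `|c| * psum (fun i => `|conv b b i|) s n.+1)).
    rewrite /psum mulr_sumr -!big_split; apply: ler_sum => i _ /=.
    rewrite bE mulrA -!mulrDl ler_wpM2r ?exprn_ge0 ?(ltW s0)//.
    by rewrite (le_trans (ler_normD _ _))// normrM lerD2r ler_normD.
  set SB := psum (fun i => `|b i|) s n in IH hb bb.
  have SB0 : 0 <= SB := S0 b n.
  have e1 : psum (fun i => `|k i|) s n * SB <= 4^-1 * sg by apply: ler_pM.
  have e2 : `|c| * (SB * SB) <= 4^-1 * sg.
    by rewrite mulrA; apply: ler_pM => //; [rewrite mulr_ge0|apply: le_trans csg; rewrite ler_wpM2l].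
  have e3 : `|c| * psum (fun i => `|conv b b i|) s n.+1 <= `|c| * (SB * SB) by rewrite ler_wpM2l.
  have := H n.+1; lra.
have [g gP] := is_psum_exists s0 bound; exists g, b, s, sg; split=> //; last first.
  move=> z zs; case: gP => _ _ /(_ z 0%N zs); rewrite /psum big_geq// subr0 expr0 mulr1 => gz.
  by apply: (le_lt_trans gz); lra.
have sr : s <= r := le_trans ss1 s1r.
have hP := is_psum_shrink hh s0 sr; have kP := is_psum_shrink hk s0 sr.
have := is_psumD (is_psumD hP (is_psumM kP gP)) (is_psumZ c (is_psumM gP gP)).
have -> : (fun i => h i + conv k b i + c * conv b b i) = b by apply/funext => i; rewrite -bE.
by move=> rhs z zs; exact: (is_psum_eq gP rhs zs zs).
Qed.

Definition analytic0 f := exists a r M, is_psum f a r M.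

Lemma analytic0_ext f g r : 0 < r -> (forall z, `|z| < r -> f z = g z) ->
  analytic0 f -> analytic0 g.
Proof.
move=> r0 fg [a [s [M hf]]]; exists a, (Num.min r s), M.
have s0 : 0 < s by case: hf.
apply: (@is_psum_ext _ f); first by move=> z; rewrite lt_min => /andP[/fg].
by apply: is_psum_shrink hf _ _; rewrite ?lt_min ?r0 ?s0// ge_min lexx orbT.
Qed.

Lemma analytic0_cst c : analytic0 (fun=> c).
Proof.
have := is_psum_delta c 0 => /(@is_psum_ext _ _ (fun=> c)) h.
by do 3!eexists; apply: h => z _; rewrite expr0 mulr1.
Qed.

Lemma analytic0_pair f g : analytic0 f -> analytic0 g ->
  exists a b r M N, is_psum f a r M /\ is_psum g b r N.
Proof.
move=> [a [r [M hf]]] [b [s [N hg]]]; exists a, b, (Num.min r s), M, N.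
have r0 : 0 < r by case: hf. have s0 : 0 < s by case: hg.
by split; [apply: is_psum_shrink hf _ _|apply: is_psum_shrink hg _ _];
  rewrite ?lt_min ?r0 ?s0// ge_min lexx ?orbT.
Qed.

Lemma analytic0D f g : analytic0 f -> analytic0 g -> analytic0 (fun z => f z + g z).
Proof.
move=> /analytic0_pair h /h[a [b [r [M [N [hf hg]]]]]].
by do 3!eexists; exact: is_psumD hf hg.
Qed.

Lemma analytic0M f g : analytic0 f -> analytic0 g -> analytic0 (fun z => f z * g z).
Proof.
move=> /analytic0_pair h /h[a [b [r [M [N [hf hg]]]]]].
by do 3!eexists; exact: is_psumM hf hg.
Qed.

Lemma analytic0Z c f : analytic0 f -> analytic0 (fun z => c * f z).
Proof. by apply: analytic0M; exact: analytic0_cst. Qed.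

Lemma analytic0N f : analytic0 f -> analytic0 (fun z => - f z).
Proof.
by move=> hf; apply: analytic0_ext (ltr01 : 0 < 1 :> R) _ (analytic0Z (-1) hf) => z _; rewrite mulN1r.
Qed.

Lemma analytic0B f g : analytic0 f -> analytic0 g -> analytic0 (fun z => f z - g z).
Proof. by move=> hf hg; apply: analytic0D => //; exact: analytic0N. Qed.

Lemma analytic0X f n : analytic0 f -> analytic0 (fun z => f z ^+ n).
Proof.
move=> hf; elim: n => [|n IH]; first exact: analytic0_cst.
by apply: analytic0_ext (ltr01 : 0 < 1 :> R) _ (analytic0M hf IH) => z _; rewrite exprS.
Qed.

Lemma quadratic_fixpoint0 (hf kf : R -> R) c : analytic0 hf -> analytic0 kf ->
  hf 0 = 0 -> kf 0 = 0 -> exists g s, [/\ analytic0 g, 0 < s,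
    forall z, `|z| < s -> g z = hf z + kf z * g z + c * (g z * g z) &
    forall z, `|z| < s -> `|g z| < 1].
Proof.
move=> /analytic0_pair h /h[a [b [r [M [N [h1 h2]]]]]] z1 z2.
have [g [d [s [L [gP e1 e2]]]]] := quadratic_fixpoint c h1 h2 z1 z2.
by exists g, s; split=> //; [exists d, s, L|case: gP].
Qed.

(** With k = 1 - f / f(0), the reciprocal is (1 + g) / f(0) where g = k + k g. *)
Lemma analytic0V f : analytic0 f -> f 0 != 0 -> analytic0 (fun z => (f z)^-1).
Proof.
move=> hf f0; pose k z := 1 - (f 0)^-1 * f z.
have ak : analytic0 k by apply: analytic0B; [exact: analytic0_cst|exact: analytic0Z].
have k0 : k 0 = 0 by rewrite /k mulVf// subrr.
have [g [s [ag s0 gE _]]] := quadratic_fixpoint0 0 ak ak k0 k0.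
apply: (analytic0_ext s0 _ (analytic0Z (f 0)^-1 (analytic0D (analytic0_cst 1) ag))) => z zs.
have e : f z * ((f 0)^-1 * (1 + g z)) = 1.
  transitivity ((1 - k z) * (1 + g z)); first by rewrite /k; ring.
  have := gE z zs; rewrite mul0r addr0 => e.
  by transitivity (1 + g z - (k z + k z * g z)); [ring|rewrite -e; ring].
have fz : f z != 0 by apply: contraPneq e => ->; rewrite mul0r => /esym/eqP; rewrite oner_eq0.
by apply: (mulfI fz); rewrite e divff.
Qed.

(** The equation (1 + g)^2 = f / f(0) reads g = h - g^2 / 2 with h = (f / f(0) - 1) / 2, and |g| < 1
    selects the nonnegative root. *)
Lemma analytic0_sqrt f : analytic0 f -> 0 < f 0 -> analytic0 (fun z => Num.sqrt (f z)).
Proof.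
move=> hf f0; have fn0 := lt0r_neq0 f0.
pose h z := 2^-1 * ((f 0)^-1 * f z - 1).
have ah : analytic0 h.
  by apply: analytic0Z; apply: analytic0B; [exact: analytic0Z|exact: analytic0_cst].
have h0 : h 0 = 0 by rewrite /h mulVf// subrr mulr0.
have [g [s [ag s0 gE g1]]] := quadratic_fixpoint0 (- 2^-1) ah (analytic0_cst 0) h0 erefl.
apply: (analytic0_ext s0 _ (analytic0Z (Num.sqrt (f 0)) (analytic0D (analytic0_cst 1) ag))) => z zs.
have gz : 0 <= 1 + g z by have := g1 z zs; rewrite ltr_norml => /andP[]; lra.
rewrite -[LHS]ger0_norm ?mulr_ge0 ?sqrtr_ge0// -sqrtr_sqr exprMn sqr_sqrtr ?ltW//.
congr Num.sqrt; have := gE z zs; rewrite mul0r addr0 => e.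
have e2 : (1 + g z) ^+ 2 = (f 0)^-1 * f z.
  transitivity (1 + 2 * g z + g z * g z); first by ring.
  by rewrite {1}e /h; field.
by rewrite e2 mulrA divff// mul1r.
Qed.

Lemma analytic0_analytic_at f : analytic0 f -> analytic_at f 0.
Proof.
move=> [a [r [M hf]]]; have r0 : 0 < r by case: hf.
exists a; have : \forall y \near (0 : R), `|y| < r.
  by apply: filterS (nbhsx_ballx 0 r r0) => y; rewrite /ball /= sub0r normrN.
by apply: filterS => y yr; rewrite /pseries subr0; exact: (is_psum_cvg hf yr).
Qed.

Lemma analytic0_derivable f : analytic0 f -> derivable f 0 1.
Proof.
move=> [a [r [M hf]]]; have M0 := is_psum_ge0 hf; have a0 := is_psum_coef0 hf.
case: hf => r0 _ h2; apply/cvg_ex; exists (a 1%N).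
apply/cvgrPdist_le => e e0.
have D0 : 0 < M / r ^+ 2 + 1 by rewrite ltr_wpDl// divr_ge0// exprn_ge0// ltW.
have nr : \forall h \near (0 : R)^', `|h| < r.
  apply: nbhs_dnbhs; apply: filterS (nbhsx_ballx 0 r r0) => y.
  by rewrite /ball /= sub0r normrN.
have ne : \forall h \near (0 : R)^', `|h| < e / (M / r ^+ 2 + 1).
  apply: nbhs_dnbhs; apply: filterS (nbhsx_ballx 0 (e / (M / r ^+ 2 + 1)) (divr_gt0 e0 D0)) => y.
  by rewrite /ball /= sub0r normrN.
have nz : \forall h \near (0 : R)^', h != 0 by exact: nbhs_dnbhs_neq.
near=> h.
have hr : `|h| < r by near: h. have he : `|h| < e / (M / r ^+ 2 + 1) by near: h.
have hz : h != 0 by near: h.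
have h0 : 0 < `|h| by rewrite normr_gt0.
have := h2 h 2%N hr; rewrite /psum !big_nat_recr//= big_geq// expr0 expr1 mulr1 add0r a0 => le.
rewrite /= addr0 [h *: _]mulr1 -normrN.
have -> : - (a 1%N - h^-1 *: (f h - f 0)) = h^-1 * (f h - (f 0 + a 1%N * h)).
  by rewrite /GRing.scale /=; field.
rewrite normrM normfV mulrC ler_pdivrMr//; apply: (le_trans le).
rewrite expr_div_n [`|h| ^+ 2]expr2.
have : `|h| * (M / r ^+ 2 + 1) <= e by rewrite -ler_pdivlMr// ltW.
have -> : M * (`|h| * `|h| / r ^+ 2) = (M / r ^+ 2 * `|h|) * `|h| by ring.
by move=> hh; rewrite ler_pM2r//; lra.
Unshelve. all: by end_near. Qed.

Lemma analytic0_of_coef f (a : nat -> R) : (forall n, `|a n| <= 1) ->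
  (forall z, series (fun i => a i * z ^+ i) @ \oo --> f z) -> analytic0 f.
Proof.
(* At radius 1/2 the geometric series bounds the sums of absolute values by 2. *)
move=> a1 hf; exists a, 2^-1, 2; apply: is_psum_of_cvg => // n.
have le n' : psum (fun i => `|a i|) 2^-1 n' <= 2 - 2 * 2^-1 ^+ n'.
  elim: n' => [|n' IH]; first by rewrite /psum big_geq// expr0; lra.
  rewrite /psum big_nat_recr//= exprS; have := a1 n' => an.
  have p0 : 0 <= 2^-1 ^+ n' :> R by rewrite exprn_ge0.
  have := ler_wpM2r p0 an; rewrite mul1r => e; move: IH; rewrite /psum; lra.
by apply: le_trans (le n) _; have p0 : 0 <= 2^-1 ^+ n :> R by [rewrite exprn_ge0]; lra.
Qed.

Lemma analytic0_cos : analytic0 cos.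
Proof.
apply: (@analytic0_of_coef _ (fun n => (~~ odd n)%:R * (-1) ^+ n./2 * (n`!%:R)^-1)) => [n|z].
  rewrite !normrM normrX normrN normr1 expr1n mulr1 normfV !normr_nat.
  case: odd => /=; rewrite ?mul0r ?mul1r// invf_le1 ?ler1n ?ltr0n ?fact_gt0//.
by rewrite cosE; have := @is_cvg_series_cos_coeff R z; rewrite cos_coeffE.
Qed.

Lemma analytic0_sin : analytic0 sin.
Proof.
apply: (@analytic0_of_coef _ (fun n => (odd n)%:R * (-1) ^+ n.-1./2 * (n`!%:R)^-1)) => [n|z].
  rewrite !normrM normrX normrN normr1 expr1n mulr1 normfV !normr_nat.
  case: odd => /=; rewrite ?mul0r ?mul1r// invf_le1 ?ler1n ?ltr0n ?fact_gt0//.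
by rewrite sinE; have := @is_cvg_series_sin_coeff R z; rewrite sin_coeffE.
Qed.

End Analytic.

(** * Parametrization of the curve *)

Section Topology.
Variable R : realType.

Lemma continuous_to_RP1_12 (X : topologicalType) (f : X -> RP1_12 R) (a : X) :
  (forall e, {for a, continuous (fun u => f u e)}) -> {for a, continuous f}.
Proof.
move=> cf; apply/cvg_sup => e U [V [[W oW <-] Wfa] WU].
apply: filterS WU _; apply: (cf e).
exact: open_nbhs_nbhs.
Qed.

Lemma hausdorff_RP1_12 : hausdorff_space (RP1_12 R).
Proof.
apply: hausdorff_product => e; apply: one_point_compactification_hausdorff.
  exact: locally_compactR.
exact: Rhausdorff.
Qed.

Lemma cos_sin_inj (x y : R) : cos x = cos y -> sin x = sin y -> `|x - y| < 2 * pi -> x = y.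
Proof.
move=> hc hs xy; apply/eqP; rewrite -subr_eq0; apply/negPn/negP => d0.
have c1 : cos `|x - y| = 1 by rewrite cos_norm cosB hc hs -!expr2 cos2Dsin2.
have : 0 < sin (`|x - y| / 2).
  apply: sin_gt0_pi; rewrite divr_gt0 ?normr_gt0//= ltr_pdivrMr// mulrC; lra.
have : cos `|x - y| = 1 - sin (`|x - y| / 2) ^+ 2 *+ 2.
  have {1}-> : `|x - y| = (`|x - y| / 2) *+ 2 by rewrite -mulr_natr divfK.
  by rewrite cos_mulr2n cos2sin2; ring.
rewrite c1 => e s0; have : 0 < sin (`|x - y| / 2) ^+ 2 by rewrite exprn_gt0.
by move: e; rewrite -mulr_natl; lra.
Qed.

End Topology.

(** [Cl] stands for any class of functions closed under ring operations; it is instantiated with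
    analytic germs and with continuity at a point. *)
Lemma forms_closed (R : realType) (p q : bool -> R) (X : Type) (Cl : (X -> R) -> Prop)
    (al be : X -> bool -> R) e :
  (forall k, Cl (fun=> k)) -> (forall f g, Cl f -> Cl g -> Cl (fun x => f x + g x)) ->
  (forall f g, Cl f -> Cl g -> Cl (fun x => f x * g x)) ->
  (forall i, Cl (fun x => al x i)) -> (forall j, Cl (fun x => be x j)) ->
  [/\ Cl (fun x => cn p q id (al x) (be x) e), Cl (fun x => sn p q id (al x) (be x) e) &
      Cl (fun x => rn p q id (al x) (be x) e)].
Proof.
move=> cC cD cM ca cb.
have cN f : Cl f -> Cl (fun x => - f x).
  by move=> /(cM _ _ (cC (-1))); under eq_fun do rewrite mulN1r.
have cX f : Cl f -> Cl (fun x => f x ^+ 2) by move=> cf; exact: (cM _ _ cf cf).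
elim/edge_cases: e => i j; rewrite /cn /sn /rn /c2form /s2form /=; split;
  repeat lazymatch goal with
  | |- Cl (fun z => al z _) => exact: ca
  | |- Cl (fun z => be z _) => exact: cb
  | |- Cl (fun z => _ ^+ 2) => apply: cX
  | |- Cl (fun z => - _) => apply: cN
  | |- Cl (fun z => _ + _) => apply: (cD _ _ _ _)
  | |- Cl (fun z => _ * _) => apply: (cM _ _ _ _)
  | |- Cl (fun z => _) => exact: cC
  end.
Qed.

(** * The angle on the ellipse as a parameter *)

Section AngleParameter.
Variable R : realType.
Variables p q : bool -> R.
Hypotheses (hp : `|p false| < `|p true|) (hq : `|q false| < `|q true|).
Hypothesis hpq : p true ^+ 2 + q true ^+ 2 < 1.
Implicit Types (e : edge) (t : RP1_12 R) (u : R * R * R) (s tau z : R).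

Local Notation P := (Pc p q).
Local Notation Q := (Qc p q).
Local Notation spc := (space_curve P Q).
Local Notation pt := (point_of p q).

Let P0 : 0 < P. Proof. exact: Pc_gt0. Qed.
Let Q0 : 0 < Q. Proof. exact: Qc_gt0. Qed.
Let Q1 : 0 < 1 - Q. Proof. by have := Qc_lt1 hp hq hpq; lra. Qed.
Let D0 : 0 < 1 - P - Q. Proof. by have := PQc_lt1 hp hq hpq; lra. Qed.

Definition axis_x : R := Num.sqrt ((1 - P - Q) / (1 - Q)).
Definition axis_y : R := Num.sqrt ((1 - P - Q) / P).

Lemma axis_x_gt0 : 0 < axis_x. Proof. by rewrite sqrtr_gt0 divr_gt0. Qed.
Lemma axis_y_gt0 : 0 < axis_y. Proof. by rewrite sqrtr_gt0 divr_gt0. Qed.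

Lemma axis_x_sqr : axis_x ^+ 2 = (1 - P - Q) / (1 - Q).
Proof. by rewrite sqr_sqrtr// divr_ge0// ltW. Qed.
Lemma axis_y_sqr : axis_y ^+ 2 = (1 - P - Q) / P.
Proof. by rewrite sqr_sqrtr// divr_ge0// ltW. Qed.

Definition ellipse_point s tau : R * R * R :=
  (s * Num.sqrt ((Q + (axis_y * sin tau) ^+ 2) / (1 - Q)), axis_x * cos tau, axis_y * sin tau).

Lemma ellipse_pointP s tau : s ^+ 2 = 1 -> spc (ellipse_point s tau).
Proof.
move=> s2; apply: (ellipse_space_curve hp hq hpq) => //.
rewrite !exprMn axis_x_sqr axis_y_sqr.
transitivity ((1 - P - Q) * (cos tau ^+ 2 + sin tau ^+ 2)); last by rewrite cos2Dsin2 mulr1.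
by field; rewrite !lt0r_neq0.
Qed.

Lemma ellipse_point_surj u : spc u -> exists s tau,
  [/\ is_sign s, - pi <= tau <= pi, u = ellipse_point s tau & 0 < s * u.1.1].
Proof.
move=> hu; have T0 := spc_T_neq0 hp hq hpq hu; have h := space_curve_ellipse hu.
have [_ hy] := hu; rewrite ypolE in hy.
have ax := lt0r_neq0 axis_x_gt0; have ay := lt0r_neq0 axis_y_gt0.
have cs : (u.1.2 / axis_x) ^+ 2 + (u.2 / axis_y) ^+ 2 = 1.
  rewrite !expr_div_n axis_x_sqr axis_y_sqr.
  transitivity ((P * u.2 ^+ 2 + (1 - Q) * u.1.2 ^+ 2) / (1 - P - Q)).
    by field; rewrite !lt0r_neq0.
  by rewrite h divff// lt0r_neq0.
have [tau [ht hc hs]] : exists tau, [/\ - pi <= tau <= pi, cos tau = u.1.2 / axis_x & sin tau = u.2 / axis_y].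
  have c1 := unit_circle_bound cs; have a0 := acos_ge0 c1; have api := acos_lepi c1.
  have pp := @pi_ge0 R.
  have ss : Num.sqrt (1 - (u.1.2 / axis_x) ^+ 2) = `|u.2 / axis_y|.
    by rewrite -sqrtr_sqr; congr Num.sqrt; lra.
  have [s0|s0] := leP 0 (u.2 / axis_y).
    exists (acos (u.1.2 / axis_x)); rewrite acosK ?inE//= sin_acos// ss ger0_norm//; split=> //.
    by apply/andP; split=> //; lra.
  exists (- acos (u.1.2 / axis_x)); rewrite cosN sinN acosK ?inE//= sin_acos// ss ltr0_norm// opprK.
  by split=> //; apply/andP; split; lra.
have sT : Num.sqrt ((Q + u.2 ^+ 2) / (1 - Q)) = `|u.1.1|.
  rewrite -sqrtr_sqr hy; congr Num.sqrt; field.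
  by rewrite lt0r_neq0.
exists (Num.sg u.1.1), tau; split=> //.
- by have [s0|s0] := ltP 0 u.1.1; [left; rewrite gtr0_sg|right; rewrite ltr0_sg// lt_neqAle T0].
- rewrite /ellipse_point hc hs [axis_x * _]mulrC [axis_y * _]mulrC !divfK// sT -numEsg.
  by case: (u) => -[].
- by rewrite -normrEsg normr_gt0.
Qed.

Lemma ellipse_point_inj s s' tau tau' : is_sign s -> is_sign s' ->
  ellipse_point s tau = ellipse_point s' tau' -> [/\ s = s', cos tau = cos tau' & sin tau = sin tau'].
Proof.
move=> hs hs' [h1 /(mulfI (lt0r_neq0 axis_x_gt0)) hc /(mulfI (lt0r_neq0 axis_y_gt0)) hn].
split=> //; apply: (mulIf _ (_ : s * Num.sqrt ((Q + (axis_y * sin tau) ^+ 2) / (1 - Q)) = _)).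
  by rewrite lt0r_neq0// sqrtr_gt0 divr_gt0// ltr_pwDl ?sqr_ge0.
by rewrite h1 hn.
Qed.

Lemma analytic_ellipse_point s tau : s ^+ 2 = 1 -> [/\
  analytic0 (fun z => (ellipse_point s (tau + z)).1.1),
  analytic0 (fun z => (ellipse_point s (tau + z)).1.2) &
  analytic0 (fun z => (ellipse_point s (tau + z)).2)].
Proof.
move=> s2.
have ac : analytic0 (fun z => cos (tau + z)).
  under eq_fun do rewrite cosD; apply: analytic0B; apply: analytic0Z.
    exact: analytic0_cos.
  exact: analytic0_sin.
have as_ : analytic0 (fun z => sin (tau + z)).
  under eq_fun do rewrite sinD; apply: analytic0D; apply: analytic0Z.
    exact: analytic0_cos.
  exact: analytic0_sin.
have ay : analytic0 (fun z => axis_y * sin (tau + z)) by exact: analytic0Z.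
split=> //=; last exact: analytic0Z.
apply: analytic0Z; apply: analytic0_sqrt.
  apply: analytic0M; last exact: analytic0_cst.
  by apply: analytic0D; [exact: analytic0_cst|exact: analytic0X].
by rewrite divr_gt0// ltr_pwDl ?sqr_ge0.
Qed.

Lemma analytic_angles s tau e : s ^+ 2 = 1 ->
  analytic0 (fun z => angle_cos p q (al_of (ellipse_point s (tau + z))) (be_of (ellipse_point s (tau + z))) e) /\
  analytic0 (fun z => angle_sin p q (al_of (ellipse_point s (tau + z))) (be_of (ellipse_point s (tau + z))) e).
Proof.
move=> s2; have [h1 h2 h3] := analytic_ellipse_point tau s2.
have ha i : analytic0 (fun z => al_of (ellipse_point s (tau + z)) i).
  by case: i => //; exact: analytic0_cst.
have hb j : analytic0 (fun z => be_of (ellipse_point s (tau + z)) j) by case: j.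
have [a1 a2 a3] := forms_closed p q e (@analytic0_cst R) (@analytic0D R) (@analytic0M R) ha hb.
have r0 := lt0r_neq0 (rn_affine_gt0 hp hq hpq e (ellipse_pointP (tau + 0) s2)).
by split; apply: analytic0M => //; apply: analytic0V.
Qed.

Definition flex_point s tau : RP1_12 R := pt (ellipse_point s tau).

Lemma analytic0_shift_continuous (g : R -> R) tau : analytic0 (fun z => g (tau + z)) ->
  {for tau, continuous g}.
Proof.
move=> /analytic0_derivable /derivable1_diffP /differentiable_continuous cg.
have -> : g = (fun z => g (tau + z)) \o (fun y => y - tau).
  by apply/funext => y /=; rewrite addrC subrK.
apply: continuous_comp; first by apply: cvgB; [exact: cvg_id|exact: cvg_cst].
by rewrite subrr.
Qed.

Lemma continuous_flex_point s : s ^+ 2 = 1 -> continuous (flex_point s).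
Proof.
move=> s2 tau; apply: continuous_to_RP1_12 => e.
have [a1 a2] := analytic_angles tau e s2.
pose C z := angle_cos p q (al_of (ellipse_point s z)) (be_of (ellipse_point s z)) e.
pose S z := angle_sin p q (al_of (ellipse_point s z)) (be_of (ellipse_point s z)) e.
apply: (@continuous_half_tan_cs _ _ C S).
- by move=> z; exact: (angle_affine hp hq hpq e (ellipse_pointP z s2)).
- exact: (@analytic0_shift_continuous C _ a1).
- exact: (@analytic0_shift_continuous S _ a2).
Qed.

End AngleParameter.

Section ChainRule.
Variable R : realType.

Lemma is_derive_trig (a b : R) :
  is_derive (0 : R) 1 (fun z => a * cos z + b * sin z) b.
Proof.
have h := is_deriveD (is_deriveZ a (is_derive_cos 0)) (is_deriveZ b (is_derive_sin (0 : R))).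
by apply: (is_derive_eq h); rewrite sin0 cos0 oppr0 scaler0 add0r [_ *: _]mulr1.
Qed.

Lemma is_derive_meval (h : R -> 'I_nvars -> R) (d : 'I_nvars -> R) (f : mpoly nvars R) :
  (forall k, is_derive (0 : R) 1 (fun z => h z k) (d k)) ->
  is_derive (0 : R) 1 (fun z => meval (h z) f) (\sum_k meval (h 0) (mderiv k f) * d k).
Proof.
move=> hd; elim/mpoly_ring_ind: f => [c|e i|f g hf hg|f g hf hg].
- under eq_fun do rewrite mevalC.
  by apply: is_derive_eq; rewrite big1// => k _; rewrite mderivC meval0 mul0r.
- under eq_fun do rewrite meval_mvar.
  apply: is_derive_eq; rewrite (bigD1 (hvar e i))//= big1 => [|k].
    by rewrite mderiv_mvar !eqxx meval1 mul1r addr0.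
  elim/hvar_ind: k => e' i'; rewrite hvar_eq mderiv_mvar [e == _]eq_sym [i == _]eq_sym.
  by move=> /negPf ->; rewrite meval0 mul0r.
- under eq_fun do rewrite mevalD.
  have H := is_deriveD hf hg; apply: (is_derive_eq H).
  by rewrite -big_split; apply: eq_bigr => k _ /=; rewrite mderivD mevalD mulrDl.
- under eq_fun do rewrite mevalM.
  have H := is_deriveM hf hg; apply: (is_derive_eq H).
  rewrite !scaler_sumr -big_split; apply: eq_bigr => k _ /=.
  by rewrite mderivM mevalD !mevalM /GRing.scale /=; ring.
Qed.

End ChainRule.

(** * The two ovals as connected components *)

Section LocalParameter.
Variable R : realType.
Variables p q : bool -> R.
Hypotheses (hp : `|p false| < `|p true|) (hq : `|q false| < `|q true|).
Hypothesis hpq : p true ^+ 2 + q true ^+ 2 < 1.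
Implicit Types (e : edge) (t : RP1_12 R) (u : R * R * R) (s tau z : R).

Local Notation P := (Pc p q).
Local Notation Q := (Qc p q).
Local Notation spc := (space_curve P Q).
Local Notation pt := (point_of p q).
Local Notation ell := (ellipse_point p q).
Local Notation flex := (flex_point p q).

Definition half_curve s : set (RP1_12 R) := [set pt u | u in [set u | spc u /\ 0 < s * u.1.1]].

Lemma sign_sqr s : is_sign s -> s ^+ 2 = 1.
Proof. by case=> ->; rewrite ?sqrrN expr1n. Qed.

Lemma sign_of_neq0 s u : is_sign s -> spc u -> ~ 0 < s * u.1.1 -> 0 < - s * u.1.1.
Proof.
move=> hs hu ns; have T0 := spc_T_neq0 hp hq hpq hu.
rewrite mulNr oppr_gt0 lt_neqAle leNgt; apply/andP; split; last exact/negP.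
by rewrite mulf_neq0//; case: hs => ->; rewrite ?oppr_eq0 oner_eq0.
Qed.

Lemma ellipse_point_sign s tau : is_sign s -> 0 < s * (ell s tau).1.1.
Proof.
move=> hs; rewrite /ellipse_point /= mulrA -expr2 (sign_sqr hs) mul1r sqrtr_gt0.
have Q1 := Qc_lt1 hp hq hpq; have Q0 := Qc_gt0 hp hq hpq.
by rewrite divr_gt0 ?subr_gt0// ltr_pwDl ?sqr_ge0.
Qed.

Lemma half_curveE s : is_sign s -> half_curve s = flex s @` `[- pi, pi].
Proof.
move=> hs; apply/seteqP; split=> [_ [u [hu su] <-]|_ [tau _ <-]].
  have [s' [tau [hs' ht uE su']]] := ellipse_point_surj hp hq hpq hu.
  suff -> : s = s' by exists tau; rewrite /= ?in_itv// /flex_point -uE.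
  by case: hs hs' su su' => -> [] -> //; lra.
exists (ell s tau) => //; split; first exact: (ellipse_pointP hp hq hpq tau (sign_sqr hs)).
exact: ellipse_point_sign.
Qed.

Lemma half_curve_compact s : is_sign s -> compact (half_curve s).
Proof.
move=> hs; rewrite half_curveE//; apply: continuous_compact; last exact: segment_compact.
by apply: continuous_subspaceT; exact: (continuous_flex_point hp hq hpq (sign_sqr hs)).
Qed.

Lemma half_curve_connected s : is_sign s -> connected (half_curve s).
Proof.
move=> hs; rewrite half_curveE//; apply: connected_continuous_connected; first exact: segment_connected.
by apply: continuous_subspaceT; exact: (continuous_flex_point hp hq hpq (sign_sqr hs)).
Qed.

Lemma curve_set_half s : is_sign s -> curve_set p q = half_curve s `|` half_curve (- s).
Proof.
move=> hs; apply/seteqP; split=> [_ [u hu <-]|_ [] [u [hu _] <-]]; last 2 first.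
- by exists u.
- by exists u.
have [su|su] := pselect (0 < s * u.1.1); first by left; exists u.
by right; exists u => //; split=> //; exact: sign_of_neq0.
Qed.

Lemma half_curve_disjoint s t : half_curve s t -> half_curve (- s) t -> False.
Proof.
move=> [u [hu su] <-] [v [hv sv] /(point_of_inj hp hq hpq hv hu) vu].
by move: su sv; rewrite vu mulNr; lra.
Qed.

Lemma is_signN s : is_sign s -> is_sign (- s).
Proof. by case=> ->; [right|left; rewrite opprK]. Qed.

Lemma half_curve_nonempty s : is_sign s -> half_curve s !=set0.
Proof.
move=> hs; rewrite half_curveE//; exists (flex s 0), 0 => //=.
by rewrite in_itv /= oppr_le0 pi_ge0.
Qed.

(** The ovals are compact in a Hausdorff space, hence closed; being disjoint, each is open and
    closed in the curve. *)
Lemma connected_component_half s t : is_sign s -> half_curve s t ->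
  connected_component (curve_set p q) t = half_curve s.
Proof.
move=> hs st; have cG := curve_set_half hs; apply/seteqP; split; last first.
  apply: connected_component_max => //; last exact: half_curve_connected.
  by rewrite cG => x; left.
have closed_half s' : is_sign s' -> closed (half_curve s').
  by move=> hs'; apply: compact_closed; [exact: hausdorff_RP1_12|exact: half_curve_compact].
set K := connected_component _ t; have Kt : K t.
  by apply: connected_component_refl; rewrite cG; left.
have KG : K `<=` curve_set p q by exact: connected_component_sub.
have cK : connected K by exact: component_connected.
suff <- : K `&` half_curve s = K by move=> x [].
apply: cK; first by exists t.
  exists (~` half_curve (- s)); first by apply: closed_openC; exact: closed_half (is_signN hs).
  apply/seteqP; split=> x [Kx hx]; split=> //.
    by move=> hx'; exact: (half_curve_disjoint hx hx').
  by have := KG x Kx; rewrite cG => -[].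
by exists (half_curve s) => //; exact: closed_half.
Qed.

End LocalParameter.

(** * Local analytic parametrization *)

Section LocalParameter.
Variable R : realType.
Variables p q : bool -> R.
Hypotheses (hp : `|p false| < `|p true|) (hq : `|q false| < `|q true|).
Hypothesis hpq : p true ^+ 2 + q true ^+ 2 < 1.
Implicit Types (e : edge) (t : RP1_12 R) (u : R * R * R) (s tau z : R).

Local Notation P := (Pc p q).
Local Notation Q := (Qc p q).
Local Notation ell := (ellipse_point p q).
Local Notation flex := (flex_point p q).
Local Notation half := (half_curve p q).
Local Notation C u e := (angle_cos p q (al_of u) (be_of u) e).
Local Notation S u e := (angle_sin p q (al_of u) (be_of u) e).

Section AtPoint.
Variables (s tau : R).
Hypothesis hs : is_sign s.

Let s2 : s ^+ 2 = 1. Proof. exact: sign_sqr. Qed.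
Local Notation u0 := (ell s tau).
Let c z := flex s (tau + z).
Let CS z e : C (ell s z) e ^+ 2 + S (ell s z) e ^+ 2 = 1.
Proof. exact: (angle_affine hp hq hpq e (ellipse_pointP hp hq hpq z s2)). Qed.

Lemma chart_flex e : (fun z => chart (flex s tau e) (c z e)) =
  if flex s tau e is Some _ then (fun z => S (ell s (tau + z)) e / (1 + C (ell s (tau + z)) e))
  else (fun z => S (ell s (tau + z)) e / (1 - C (ell s (tau + z)) e)).
Proof.
by case: (flex s tau e) => [x|]; apply/funext => z; [exact: chart_some|exact: chart_none].
Qed.

Lemma flex_none e : (flex s tau e == None) = (C (ell s tau) e == -1).
Proof.
by rewrite /flex_point /point_of /curve_point /half_tan_cs; case: (C (ell s tau) e == -1).
Qed.

Lemma flex_denominator e : if flex s tau e is Some _ then 1 + C (ell s tau) e != 0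
  else 1 - C (ell s tau) e != 0.
Proof.
have := flex_none e; case: (flex s tau e) => [x|] /=.
  by rewrite addrC addr_eq0 => /esym ->.
by move=> /esym/eqP ->; rewrite opprK -mulr2n pnatr_eq0.
Qed.

Lemma analytic_chart e : analytic0 (fun z => chart (flex s tau e) (c z e)).
Proof.
rewrite chart_flex; have := flex_denominator e.
have [aC aS] := analytic_angles hp hq hpq tau e s2.
case: (flex s tau e) => [x|] h; apply: analytic0M => //; apply: analytic0V; rewrite ?addr0//.
  by apply: analytic0D => //; exact: analytic0_cst.
by apply: analytic0B => //; exact: analytic0_cst.
Qed.

Definition velocity e : R := derive1 (fun z => chart (flex s tau e) (c z e)) 0.

Lemma is_derive_chart e : is_derive (0 : R) 1 (fun z => chart (flex s tau e) (c z e)) (velocity e).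
Proof. by rewrite /velocity derive1E; apply/derivableP; exact: analytic0_derivable (analytic_chart e). Qed.

Lemma velocity_base : velocity (base_edge u0) != 0.
Proof.
rewrite /velocity /base_edge derive1E; have hu := ellipse_pointP hp hq hpq tau s2.
have ax := lt0r_neq0 (axis_x_gt0 hp hq hpq); have ay := lt0r_neq0 (axis_y_gt0 hp hq hpq).
case: (eqVneq u0.1.2 0) => [x0|x0].
  (* At infinity the chart of T / x is x / T; as x = 0 at the point, its derivative is that of x
     divided by T. *)
  have fE z : chart (flex s tau eU) (c z eU) = (ell s (tau + z)).1.2 * ((ell s (tau + z)).1.1)^-1.
    rewrite {1}/flex_point (point_of_U hp hq hpq hu) x0 eqxx.
    rewrite /c /flex_point (point_of_U hp hq hpq (ellipse_pointP hp hq hpq _ s2)).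
    by case: eqVneq => [->|x1] /=; rewrite ?mul0r// invf_div.
  under eq_fun do rewrite fE; have [aT aX _] := analytic_ellipse_point hp hq hpq tau s2.
  have T0 := spc_T_neq0 hp hq hpq hu.
  have aT0 : (ell s (tau + 0)).1.1 != 0 by rewrite addr0.
  have dT := analytic0_derivable (analytic0V aT aT0).
  have dX : is_derive (0 : R) 1 (fun z => (ell s (tau + z)).1.2) (- axis_x p q * sin tau).
    have -> : (fun z => (ell s (tau + z)).1.2) =
        (fun z => (axis_x p q * cos tau) * cos z + (- axis_x p q * sin tau) * sin z).
      by apply/funext => z; rewrite /ellipse_point /= cosD; ring.
    exact: is_derive_trig.
  have := is_deriveM dX (derivableP dT) => hM.
  have c0 : cos tau = 0 by apply: (mulfI ax); rewrite mulr0.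
  rewrite (@derive_val _ _ _ _ _ _ _ hM) /= addr0 c0 mulr0 scale0r add0r.
  rewrite scaler_eq0 negb_or invr_eq0 T0 /= mulf_neq0 ?oppr_eq0//.
  apply: contraPneq (cos2Dsin2 tau) => ->; rewrite c0 expr0n addr0 => /esym/eqP.
  by rewrite oner_eq0.
have fE z : chart (flex s tau eY) (c z eY) = (ell s (tau + z)).2.
  by rewrite /c /flex_point !point_of_Y.
under eq_fun do rewrite fE.
have dY : is_derive (0 : R) 1 (fun z => (ell s (tau + z)).2) (axis_y p q * cos tau).
  have -> : (fun z => (ell s (tau + z)).2) =
      (fun z => (axis_y p q * sin tau) * cos z + (axis_y p q * cos tau) * sin z).
    by apply/funext => z; rewrite /ellipse_point /= sinD; ring.
  exact: is_derive_trig.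
rewrite derive_val mulf_neq0//; apply: contra_neq x0 => c0.
by rewrite /ellipse_point /= c0 mulr0.
Qed.

Lemma flex_local_parametrization : local_parametrization (curve_set p q) (flex s tau) c.
Proof.
have cont := continuous_flex_point hp hq hpq.
split; first by rewrite /c addr0.
split; last split.
- exists 1 => //; have inj (s' z z' : R) : is_sign s' -> `|z - z'| < 2 * pi -> flex s z = flex s' z' ->
      s = s' /\ z = z'.
    move=> hs' zz /(point_of_inj hp hq hpq (ellipse_pointP hp hq hpq _ s2) (ellipse_pointP hp hq hpq _ (sign_sqr hs'))).
    move=> /(ellipse_point_inj hp hq hpq hs hs') [-> hc hn].
    by split=> //; exact: cos_sin_inj.
  have pi2 := @pi_ge2 R.
  split.
  + move=> z _; apply: continuous_comp; last exact: cont.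
    by apply: cvgD; [exact: cvg_cst|exact: cvg_id].
  + move=> z z'; rewrite !in_itv /= => /andP[z1 z2] /andP[z1' z2'] czz.
    have zz : `|(tau + z) - (tau + z')| < 2 * pi by rewrite ltr_norml; apply/andP; split; lra.
    by have [_ /addrI] := inj s _ _ hs zz czz.
  + have hN := is_signN hs; have hN2 := sign_sqr hN.
    (* K is the rest of the curve: the complementary arc of this oval and the other oval. It is
       compact, so its complement is the required open set. *)
    pose K := flex s @` `[tau + 1, tau + 2 * pi - 1] `|` half (- s).
    have cK : compact K.
      have cf : compact (flex s @` `[tau + 1, tau + 2 * pi - 1]).
        apply: continuous_compact; last exact: segment_compact.
        by apply: continuous_subspaceT; exact: cont.
      exact: compactU cf (half_curve_compact hp hq hpq hN).
    have clK : closed K by apply: compact_closed => //; exact: hausdorff_RP1_12.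
    exists (~` K); first exact: closed_openC.
    apply/seteqP; split=> [t [Gt nK]|t [z]].
      have [st|st] : half s t \/ half (- s) t by rewrite (curve_set_half hp hq hpq hs) in Gt.
        2: by exfalso; apply: nK; right.
      case: st => u [hu su] tE.
      have [s' [z [hs' _ uE su']]] := ellipse_point_surj hp hq hpq hu.
      have ss' : s = s' by move: su su'; case: hs hs' => -> [] -> //; lra.
      have tz : t = flex s z by rewrite /flex_point ss' -uE.
      have per (n : nat) y : flex s (y + (2 * pi) *+ n) = flex s y /\ flex s (y - (2 * pi) *+ n) = flex s y.
        have tp : (2 * pi : R) = pi *+ 2 by rewrite mulr_natl.
        have cp m x : cos (x + (pi *+ 2) *+ m) = cos x :> R by exact: periodicn (@cosD2pi R) _ _.
        have sp m x : sin (x + (pi *+ 2) *+ m) = sin x :> R by exact: periodicn (@sinD2pi R) _ _.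
        rewrite /flex_point /ellipse_point tp cp sp; split=> //.
        by rewrite -(cp n (y - _)) -(sp n (y - _)) subrK.
      have [k [hk fk]] : exists k : R, tau - 1 <= k < tau - 1 + 2 * pi /\ t = flex s k.
        (* Reduction of z modulo 2 pi to the period that starts at tau - 1. *)
        pose m := Num.floor ((z - (tau - 1)) / (2 * pi)).
        have p0 : 0 < 2 * pi :> R by lra.
        exists (z - (2 * pi) * m%:~R); split.
          have := floor_itv ((z - (tau - 1)) / (2 * pi)); rewrite -/m ler_pdivlMr// ltr_pdivrMr//.
          by rewrite intrD mulrDl mul1r; case/andP=> *; apply/andP; split; lra.
        rewrite tz; case: m => n.
          by have [_ <-] := per n z; rewrite -pmulrn mulr_natr.
        by have [<- _] := per n.+1 z; rewrite NegzE mulrNz mulrN opprK -pmulrn mulr_natr.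
      exists (k - tau); last by rewrite /c addrC subrK.
      rewrite /= in_itv /= ltrBlDr ltrBrDr; case/andP: hk => k1 k2.
      rewrite addrC [1 + _]addrC; apply/andP; split.
        rewrite lt_neqAle k1 andbT; apply/eqP => kE; apply: nK; left.
        exists (k + 2 * pi); last by rewrite fk; have [<- _] := per 1%N k; rewrite mulr1n.
        by rewrite /= in_itv /=; apply/andP; split; lra.
      rewrite ltNge; apply/negP => k3; apply: nK; left; exists k => //.
      by rewrite /= in_itv /= k3 /=; lra.
    rewrite /= in_itv /= => /andP[z1 z2] <-; split.
      by exists (ell s (tau + z)) => //; exact: (ellipse_pointP hp hq hpq _ s2).
    case=> [[z' + zz']|].
      rewrite /= in_itv /= => /andP[z1' z2'].
      have zz : `|(tau + z) - z'| < 2 * pi by rewrite ltr_norml; apply/andP; split; lra.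
      by have [_ zE] := inj s _ _ hs zz (esym zz'); lra.
    apply: (half_curve_disjoint hp hq hpq); exists (ell s (tau + z)) => //.
    by split; [exact: (ellipse_pointP hp hq hpq _ s2)|exact: (ellipse_point_sign hp hq hpq)].
- by move=> e; apply: analytic0_analytic_at; exact: analytic_chart.
- by exists (base_edge u0); exact: velocity_base.
Qed.

End AtPoint.

End LocalParameter.

(** * Smoothness and essentiality *)

Section LocalParameter.
Variable R : realType.
Variables p q : bool -> R.
Hypotheses (hp : `|p false| < `|p true|) (hq : `|q false| < `|q true|).
Hypothesis hpq : p true ^+ 2 + q true ^+ 2 < 1.
Implicit Types (e : edge) (t : RP1_12 R) (u : R * R * R) (s tau z : R).

Local Notation P := (Pc p q).
Local Notation Q := (Qc p q).
Local Notation pt := (point_of p q).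
Local Notation ell := (ellipse_point p q).
Local Notation flex := (flex_point p q).

Lemma sum_hvar (F : 'I_nvars -> R) : \sum_k F k = \sum_e (F (hvar e true) + F (hvar e false)).
Proof.
rewrite (reindex (@enum_rank _)) /=; last by apply: onW_bij; exact: enum_rank_bij.
transitivity (\sum_(j : edge * bool) F (enum_rank (j.1, j.2))).
  by apply: eq_bigr => -[].
rewrite -(pair_bigA _ (fun e i => F (enum_rank (e, i)))) /=.
by apply: eq_bigr => e _; rewrite big_bool.
Qed.

(** Near the point, homogeneous coordinates are normalized by keeping at 1 the coordinate that is 1
    at the point itself. Then f vanishes along a differentiable path, and the chain rule gives the
    tangency condition. *)
Lemma velocity_tangent s tau : is_sign s ->
  zariski_tangent (curve_set p q) (flex s tau) (velocity p q s tau).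
Proof.
move=> hs f [d hf] Gf; have s2 := sign_sqr hs.
set t := flex s tau; pose c z := flex s (tau + z).
have c0 : c 0 = t by rewrite /c addr0.
have Gc z : curve_set p q (c z).
  by exists (ell s (tau + z)) => //; exact: (ellipse_pointP hp hq hpq _ s2).
(* The only point of the projective line outside the chart around t e. *)
pose bad e : RP1 R := if t e is Some _ then None else Some 0.
have c_good : \forall z \near (0 : R), forall e, c z e <> bad e.
  have cg e : \forall z \near (0 : R), c z e <> bad e; last first.
    have HH := @filter_forall _ edge (fun e z => c z e <> bad e) (nbhs (0 : R)) _ cg.
    exact: HH.
  have cont : {for 0, continuous (fun z => c z e)}.
    have cc : {for 0, continuous c}.
      apply: continuous_comp; last exact: (continuous_flex_point hp hq hpq s2).
      by apply: cvgD; [exact: cvg_cst|exact: cvg_id].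
    have pc : continuous (fun y : RP1_12 R => y e) := @proj_continuous _ _ e.
    exact: (continuous_comp cc (pc _)).
  apply: (cont (~` [set bad e])); apply: open_nbhs_nbhs; split; last first.
    by rewrite /= c0 /bad; case: (t e).
  apply: closed_openC; apply: accessible_closed_set1; apply: hausdorff_accessible.
  by apply: one_point_compactification_hausdorff; [exact: locally_compactR|exact: Rhausdorff].
pose h z (k : 'I_nvars) : R := let e := (enum_val k).1 in
  if (enum_val k).2 == (t e == None) then chart (t e) (c z e) else 1.
pose dh (k : 'I_nvars) : R := let e := (enum_val k).1 in
  if (enum_val k).2 == (t e == None) then velocity p q s tau e else 0.
have hE z e i : h z (hvar e i) = if i == (t e == None) then chart (t e) (c z e) else 1.
  by rewrite /h /hvar enum_rankK.
have dhE e i : dh (hvar e i) = if i == (t e == None) then velocity p q s tau e else 0.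
  by rewrite /dh /hvar enum_rankK.
have h0 : h 0 = hpoint t.
  apply/funext; elim/hvar_ind => e i; rewrite hE hpoint_hvar c0.
  by case: (t e) => [x|]; case: i.
have hz : \forall z \near (0 : R), meval (h z) f = 0.
  apply: filterS c_good => z cz.
  pose la e : R := if t e is Some _ then 1 else if c z e is Some x then x^-1 else 1.
  rewrite (@mhom_scale _ d f la _ (hpoint (c z)) hf); first by rewrite (Gf _ (Gc z)) mulr0.
  move=> e i; rewrite hE hpoint_hvar /la; have := cz e; rewrite /bad.
  case: (t e) => [x|]; case: (c z e) => [y|]; case: i => //= ne; rewrite ?mul1r ?mulr1//.
  by rewrite mulVf//; apply: contra_notN ne => /eqP ->.
have dder : is_derive (0 : R) 1 (fun z => meval (h z) f) (\sum_k meval (h 0) (mderiv k f) * dh k).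
  apply: is_derive_meval; elim/hvar_ind => e i; rewrite dhE.
  under eq_fun do rewrite hE.
  by case: (i == _); [exact: (is_derive_chart hp hq hpq tau hs e)|exact: is_derive_cst].
transitivity (\sum_k meval (h 0) (mderiv k f) * dh k); last first.
  rewrite -(@derive_val _ _ _ _ _ _ _ dder).
  rewrite (@near_eq_derive _ _ _ _ (cst 0)) ?derive_cst//.
rewrite sum_hvar h0; apply: eq_bigr => e _; rewrite !dhE /chart_deriv.
by case: (t e) => [x|] /=; rewrite mulr0 ?addr0 ?add0r.
Qed.

(** Subtracting from a tangent vector the multiple of the velocity with the same component at
    [base_edge] leaves a vector to which [tangent_eq0] applies. *)
Lemma curve_set_smooth t : curve_set p q t -> smooth_point_of_curve (curve_set p q) t.
Proof.
move=> [u hu <-]; have [s [tau [hs _ uE _]]] := ellipse_point_surj hp hq hpq hu.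
have tE : pt u = flex s tau by rewrite uE.
have vb := velocity_base hp hq hpq tau hs; have vt := velocity_tangent tau hs.
rewrite -tE in vt; rewrite -uE in vb; move: (velocity p q s tau) vb vt => v vb vt.
exists v; first by exists (base_edge u).
have lin a w : zariski_tangent (curve_set p q) (pt u) w ->
    zariski_tangent (curve_set p q) (pt u) (fun e => w e - a * v e).
  move=> tw f hf Gf; under eq_bigr do rewrite mulrBr mulrCA.
  by rewrite sumrB -mulr_sumr tw// vt// mulr0 subr0.
apply/seteqP; split=> [w tw|_ [a _ <-] f hf Gf]; last first.
  by under eq_bigr do rewrite mulrCA; rewrite -mulr_sumr vt// mulr0.
exists (w (base_edge u) / v (base_edge u)) => //; apply/funext => e; apply/esym/eqP.
rewrite -subr_eq0; apply/eqP; apply: (tangent_eq0 hp hq hpq hu (lin _ _ tw)).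
by rewrite divfK// subrr.
Qed.

End LocalParameter.

Section LocalParameter.
Variable R : realType.
Variables p q : bool -> R.
Hypotheses (hp : `|p false| < `|p true|) (hq : `|q false| < `|q true|).
Hypothesis hpq : p true ^+ 2 + q true ^+ 2 < 1.
Implicit Types (e : edge) (t : RP1_12 R) (u : R * R * R) (s tau z : R).

Local Notation P := (Pc p q).
Local Notation Q := (Qc p q).
Local Notation spc := (space_curve P Q).
Local Notation pt := (point_of p q).
Local Notation ell := (ellipse_point p q).
Local Notation S u e := (angle_sin p q (al_of u) (be_of u) e).

Lemma sn_affine_neq0 u e : spc u -> u.1.2 != 0 -> u.2 != 0 -> sn p q id (al_of u) (be_of u) e != 0.
Proof.
move=> hu x0 y0; have T0 := spc_T_neq0 hp hq hpq hu.
have sp := sqr_p_lt hp; have sq := sqr_q_lt hq.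
have P0 := Pc_gt0 hp hq hpq; have Q0 := Qc_gt0 hp hq hpq.
have al0 i : al_of u i != 0 by case: i => //; exact: oner_neq0.
have be0 j : be_of u j != 0 by case: j.
have sg0 k : sg R k != 0 by rewrite signr_eq0.
have mq j : Num.sqrt (1 - q j ^+ 2) != 0 by rewrite lt0r_neq0// sqrtr_gt0 (one_sub_q_gt0 hp hq hpq).
have mp i : Num.sqrt (1 - p i ^+ 2) != 0 by rewrite lt0r_neq0// sqrtr_gt0 (one_sub_p_gt0 hp hq hpq).
case: (hu); rewrite xpolE ypolE => hx hy.
have T2 : 0 < u.1.1 ^+ 2 by rewrite lt_neqAle sqr_ge0 eq_sym sqrf_eq0 T0.
elim/edge_cases: e => i j; rewrite /sn /=.
- rewrite !mulf_neq0 ?oppr_eq0 ?mulf_neq0 //.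
  (* An equality p_2 = p_1 x would give p_2^2 = p_1^2 x^2 <= p_1^2. *)
  rewrite subr_eq0; apply/negP => /eqP /(congr1 (fun z => z ^+ 2)).
  rewrite mulr1 exprMn hx; have : 0 <= p false ^+ 2 * (P + P * u.1.1 ^+ 2); last lra.
  have := mulr_gt0 P0 T2; have := P0; have := sqr_ge0 (p false) => a b c.
  by rewrite mulr_ge0// ltW// addr_gt0.
- rewrite !mulf_neq0 ?oppr_eq0 ?mulf_neq0 //.
  rewrite subr_eq0; apply/negP => /eqP /(congr1 (fun z => z ^+ 2)).
  rewrite !exprMn hy; have : 0 <= q false ^+ 2 * (Q + Q * u.1.1 ^+ 2).
    have := mulr_gt0 Q0 T2; have := Q0; have := sqr_ge0 (q false) => a b c.
    by rewrite mulr_ge0// ltW// addr_gt0.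
  have : 0 < (q true ^+ 2 - q false ^+ 2) * u.1.1 ^+ 2 by rewrite mulr_gt0// subr_gt0.
  lra.
- by rewrite !mulf_neq0 ?oppr_eq0 ?mulf_neq0.
Qed.

(** At tau = pi / 4 both x and y are nonzero, so no dihedral angle is a multiple of pi: one point
    serves all twelve edges. *)
Lemma curve_set_essential : essential (curve_set p q).
Proof.
have hu := ellipse_pointP hp hq hpq (pi / 4) (expr1n _ 2).
have pi0 := @pi_gt0 R.
have x0 : (ell 1 (pi / 4)).1.2 != 0.
  rewrite mulf_neq0 ?lt0r_neq0 ?(axis_x_gt0 hp hq hpq)//.
  by apply: cos_gt0_pihalf; apply/andP; split; lra.
have y0 : (ell 1 (pi / 4)).2 != 0.
  rewrite mulf_neq0 ?lt0r_neq0 ?(axis_y_gt0 hp hq hpq)//.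
  by apply: sin_gt0_pi; apply/andP; split; lra.
move=> e; have r0 := rn_affine_gt0 hp hq hpq e hu.
have s0 : S (ell 1 (pi / 4)) e != 0.
  by rewrite mulf_neq0 ?invr_eq0 ?(lt0r_neq0 r0) ?sn_affine_neq0.
have [n1 n2] := half_tan_cs_neq (angle_affine hp hq hpq e hu) s0.
have Gu : curve_set p q (pt (ell 1 (pi / 4))) by exists (ell 1 (pi / 4)).
by split=> h; [apply: n1|apply: n2]; rewrite -(h _ Gu).
Qed.

Lemma essential_component_curve_set : essential_component (curve_set p q) (curve_set p q).
Proof.
have cl := curve_set_closed hp hq hpq; have irr := curve_set_irreducible hp hq hpq cl.
split; last exact: curve_set_essential.
  by split=> // Z _ ZG GZ; apply/seteqP; split.
exact: curve_set_dimension.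
Qed.

Lemma essential_component_unique Z : essential_component (curve_set p q) Z -> Z = curve_set p q.
Proof.
move=> [[_ ZG mZ] _ _]; apply/esym/mZ => //.
by have [[]] := essential_component_curve_set.
Qed.

End LocalParameter.

(** * The flexion *)

Section FlexedPoints.
Variable R : realType.
Variables p q : bool -> R.
Hypotheses (hp : `|p false| < `|p true|) (hq : `|q false| < `|q true|).
Hypothesis hpq : p true ^+ 2 + q true ^+ 2 < 1.
Implicit Types (t : RP1_12 R) (s z th : R) (al be : bool -> R).

Local Notation P := (Pc p q).
Local Notation Q := (Qc p q).
Local Notation half := (half_curve p q).

Definition theta_min : R := asin `|q true|.
Definition theta_max : R := acos `|p true|.

Let p1 : -1 <= `|p true| <= 1.
Proof.
have h := hpq; have := sqr_ge0 (q true); have := normr_ge0 (p true).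
rewrite -[p true ^+ 2]real_normK ?num_real// in h *; move: `|p true| h => x h *.
by apply/andP; split; nra.
Qed.

Let q1 : -1 <= `|q true| <= 1.
Proof.
have h := hpq; have := sqr_ge0 (p true); have := normr_ge0 (q true).
rewrite -[q true ^+ 2]real_normK ?num_real// in h *; move: `|q true| h => x h *.
by apply/andP; split; nra.
Qed.

Lemma cos_theta_max : cos theta_max = `|p true|. Proof. by rewrite acosK. Qed.
Lemma sin_theta_min : sin theta_min = `|q true|. Proof. by rewrite asinK. Qed.

Lemma theta_max_itv : 0 <= theta_max <= pi.
Proof. by rewrite acos_ge0 ?acos_lepi. Qed.
Lemma theta_min_itv : - (pi / 2) <= theta_min <= pi / 2.
Proof. by rewrite asin_geNpi2 ?asin_lepi2. Qed.

Lemma lt_theta_max th : 0 <= th <= pi -> (th < theta_max) = (`|p true| < cos th).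
Proof. by move=> h; rewrite -cos_theta_max ltr_cos ?in_itv//; exact: theta_max_itv. Qed.

Lemma lt_theta_min th : - (pi / 2) <= th <= pi / 2 -> (theta_min < th) = (`|q true| < sin th).
Proof. by move=> h; rewrite -sin_theta_min ltr_sin ?in_itv//; exact: theta_min_itv. Qed.

Lemma le_theta_max th : 0 <= th <= pi -> (th <= theta_max) = (`|p true| <= cos th).
Proof. by move=> h; rewrite !leNgt -cos_theta_max ltr_cos ?in_itv//; exact: theta_max_itv. Qed.

Lemma le_theta_min th : - (pi / 2) <= th <= pi / 2 -> (theta_min <= th) = (`|q true| <= sin th).
Proof. by move=> h; rewrite !leNgt -sin_theta_min ltr_sin ?in_itv//; exact: theta_min_itv. Qed.

Lemma theta_min_gt0 : 0 < theta_min.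
Proof.
have pp := @pi_ge0 R; rewrite ltNge; apply/negP => h.
have : `|q true| <= sin 0 by rewrite -sin_theta_min leNgt ltr_sin ?in_itv /= -?leNgt//; have := theta_min_itv; case/andP=> *; apply/andP; split; lra.
by rewrite sin0 leNgt (le_lt_trans _ hq).
Qed.

Lemma theta_max_lt_pihalf : theta_max < pi / 2.
Proof.
have pp := @pi_ge0 R; rewrite ltNge; apply/negP => h.
have : `|p true| <= 0.
  by rewrite -cos_pihalf -le_theta_max//; apply/andP; split; lra.
by rewrite leNgt (le_lt_trans (normr_ge0 _) hp).
Qed.

Lemma theta_range th : theta_min <= th <= theta_max ->
  [/\ 0 < th < pi / 2, 0 < cos th, 0 < sin th, `|p true| <= cos th & `|q true| <= sin th].
Proof.
move=> /andP[h1 h2]; have h3 := theta_min_gt0; have h4 := theta_max_lt_pihalf.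
have t1 : 0 < th < pi / 2 by apply/andP; split; lra.
case/andP: (t1) => t2 t3; split=> //.
- by apply: cos_gt0_pihalf; apply/andP; split; lra.
- by apply: sin_gt0_pi; apply/andP; split; lra.
- by rewrite -le_theta_max//; apply/andP; split; lra.
- by rewrite -le_theta_min//; apply/andP; split; lra.
Qed.

(** cos theta_min = sqrt (1 - q_2^2) exceeds |p_2| because p_2^2 + q_2^2 < 1. *)
Lemma theta_min_lt_max : theta_min < theta_max.
Proof.
have h3 := theta_min_gt0; have := theta_min_itv; case/andP=> h1 h2.
rewrite lt_theta_max; last by apply/andP; split; lra.
rewrite cos_asin// -[ltLHS]sqrtr_sqr ltr_sqrt; first by have h := hpq; rewrite real_normK ?num_real//; lra.
by have := kk_gt0 hp hq hpq false true; rewrite /kk real_normK ?num_real//; have := sqr_ge0 (p false); lra.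
Qed.

Definition amplitude (c d1 d2 : R) (x : bool -> R) : bool -> R :=
  fun i => (if i then d2 else d1) * Num.sqrt (c ^+ 2 - x i ^+ 2).

Definition flexed_point th d1 d2 e1 e2 : RP1_12 R :=
  curve_point p q (amplitude (cos th) d1 d2 p) (amplitude (sin th) e1 e2 q).

Lemma amplitude_sqr c d1 d2 (x : bool -> R) i : is_sign d1 -> is_sign d2 ->
  `|x false| < `|x true| -> `|x true| <= c -> amplitude c d1 d2 x i ^+ 2 = c ^+ 2 - x i ^+ 2.
Proof.
move=> h1 h2 x01 xc; rewrite /amplitude exprMn (_ : (if i then d2 else d1) ^+ 2 = 1); last first.
  by case: i; exact: sign_sqr.
rewrite mul1r sqr_sqrtr// subr_ge0 -[x i ^+ 2]real_normK ?num_real//.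
by rewrite ler_sqr ?nnegrE ?(le_trans _ xc)//; case: i => //; rewrite (le_trans (ltW x01)).
Qed.

Lemma on_curve_flexed th d1 d2 e1 e2 : theta_min <= th <= theta_max ->
  is_sign d1 -> is_sign d2 -> is_sign e1 -> is_sign e2 -> let al := amplitude (cos th) d1 d2 p in
  let be := amplitude (sin th) e1 e2 q in
  [/\ on_curve p q al be, cos th ^+ 2 = al false ^+ 2 + p false ^+ 2,
      sin th ^+ 2 = be false ^+ 2 + q false ^+ 2, 0 < d1 * al false & 0 < e1 * be false].
Proof.
move=> /theta_range[_ c0 s0 hc hs] sd1 sd2 se1 se2 al be.
have ha i : al i ^+ 2 = cos th ^+ 2 - p i ^+ 2 by exact: amplitude_sqr.
have hb j : be j ^+ 2 = sin th ^+ 2 - q j ^+ 2 by exact: amplitude_sqr.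
have pos c (x : bool -> R) : `|x false| < `|x true| -> `|x true| <= c -> 0 < Num.sqrt (c ^+ 2 - x false ^+ 2).
  move=> h1 h2; rewrite sqrtr_gt0 subr_gt0 -[x false ^+ 2]real_normK ?num_real//.
  by rewrite ltr_sqr ?nnegrE// ?(lt_le_trans h1 h2)// (le_trans _ h2).
split; first by split; rewrite ?ha ?hb /kk; have := cos2Dsin2 th; lra.
- by rewrite ha subrK.
- by rewrite hb subrK.
- by rewrite mulrA -expr2 sign_sqr// mul1r pos.
- by rewrite mulrA -expr2 sign_sqr// mul1r pos.
Qed.

Lemma flexed_point_half th d1 d2 e1 e2 : theta_min <= th <= theta_max ->
  is_sign d1 -> is_sign d2 -> is_sign e1 -> is_sign e2 ->
  half (d1 * e1) (flexed_point th d1 d2 e1 e2).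
Proof.
move=> ht sd1 sd2 se1 se2; have [h _ _ a0 b0] := on_curve_flexed ht sd1 sd2 se1 se2.
rewrite /flexed_point (curve_point_affine hp hq h).
exists (affine_of (amplitude (cos th) d1 d2 p) (amplitude (sin th) e1 e2 q)) => //.
split; first exact: affine_space_curve.
have [an0 _] := on_curve_neq0 hp hq h; move: a0 b0 an0 => /=.
move: (amplitude _ _ _ p false) (amplitude _ _ _ q false) => a b a0 b0 an0.
suff -> : d1 * e1 * (b / a) = (d1 * a) * (e1 * b) / a ^+ 2.
  by rewrite divr_gt0// ?(mulr_gt0 a0 b0)// lt_neqAle sqr_ge0 eq_sym sqrf_eq0 an0.
by field.
Qed.

(** Never zero, unlike [Num.sg]: the result has to be a sign also where al_2 or be_2 vanishes. *)
Definition sgp (x : R) : R := if 0 <= x then 1 else -1.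

Lemma sgp_sign x : is_sign (sgp x).
Proof. by rewrite /sgp; case: ifP => _; [left|right]. Qed.

Lemma sgp_norm x : sgp x * `|x| = x.
Proof. by rewrite /sgp; case: leP => h; [rewrite mul1r ger0_norm|rewrite mulN1r ltr0_norm ?opprK]. Qed.

Lemma sgp_unique s x : is_sign s -> 0 < s * x -> sgp x = s.
Proof. by rewrite /sgp => -[] -> sx; case: ifPn => // h; exfalso; lra. Qed.

Definition theta_of al : R := acos (Num.sqrt (al false ^+ 2 + p false ^+ 2)).

Lemma theta_ofP al be : on_curve p q al be ->
  [/\ theta_min <= theta_of al <= theta_max, 0 < cos (theta_of al), 0 < sin (theta_of al),
   cos (theta_of al) ^+ 2 = al false ^+ 2 + p false ^+ 2 &
   sin (theta_of al) ^+ 2 = be false ^+ 2 + q false ^+ 2].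
Proof.
move=> h; have c2 := on_curve_c2 hp hq h; have s2 := on_curve_s2 hp hq h.
have cs := on_curve_cs h; set c := Num.sqrt (al false ^+ 2 + p false ^+ 2).
have cE : c ^+ 2 = al false ^+ 2 + p false ^+ 2 by rewrite sqr_sqrtr// ltW.
have c0 : 0 < c by rewrite sqrtr_gt0.
have c1 : -1 <= c <= 1 by apply/andP; split; nra.
have ct : cos (theta_of al) = c by rewrite /theta_of acosK.
have th0 : 0 <= theta_of al by exact: acos_ge0.
have thpi : theta_of al <= pi by exact: acos_lepi.
have pp := @pi_ge0 R.
have th2 : theta_of al <= pi / 2.
  rewrite leNgt -ltr_cos ?in_itv /=; last 2 first.
  - by apply/andP; split; lra.
  - by rewrite th0.
  by rewrite cos_pihalf ct -leNgt ltW.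
have st : 0 <= sin (theta_of al) by apply: sin_ge0_pi; rewrite th0.
have sE : sin (theta_of al) ^+ 2 = be false ^+ 2 + q false ^+ 2.
  by rewrite sin2cos2 ct cE; lra.
have s0 : 0 < sin (theta_of al).
  by rewrite lt_neqAle st eq_sym -sqrf_eq0 sE lt0r_neq0.
split; rewrite ?ct//; apply/andP; split.
  rewrite le_theta_min; last by apply/andP; split; lra.
  rewrite -ler_sqr ?nnegrE// real_normK ?num_real// sE.
  by have := on_curve_be true h; have := sqr_ge0 (be true); lra.
rewrite le_theta_max; last by rewrite th0.
rewrite -ler_sqr ?nnegrE ?ct ?(ltW c0)// real_normK ?num_real// cE.
by have := on_curve_al true h; have := sqr_ge0 (al true); lra.
Qed.

Lemma amplitude_sgp al be : on_curve p q al be -> let th := theta_of al in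
  amplitude (cos th) (sgp (al false)) (sgp (al true)) p = al /\
  amplitude (sin th) (sgp (be false)) (sgp (be true)) q = be.
Proof.
move=> h /=; have [_ _ _ hc hs] := theta_ofP h.
split; apply/funext => i; rewrite /amplitude -fun_if ?hc ?hs -?(on_curve_al i h) -?(on_curve_be i h) sqrtr_sqr.
  by case: i; exact: sgp_norm.
by case: i; exact: sgp_norm.
Qed.

Lemma flexed_octahedron_oct th d1 d2 e1 e2 : 0 < cos th -> 0 < sin th ->
  flexed_octahedron (p false) (p true) (q false) (q true) th d1 d2 e1 e2 =
  oct_of p q (cos th) (sin th) (amplitude (cos th) d1 d2 p) (amplitude (sin th) e1 e2 q).
Proof. exact: flexed_octahedronE. Qed.

Lemma half_tans_flexed th d1 d2 e1 e2 : theta_min <= th <= theta_max ->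
  is_sign d1 -> is_sign d2 -> is_sign e1 -> is_sign e2 ->
  has_half_tans (flexed_octahedron (p false) (p true) (q false) (q true) th d1 d2 e1 e2)
    (flexed_point th d1 d2 e1 e2).
Proof.
move=> ht sd1 sd2 se1 se2; have [h hc hs _ _] := on_curve_flexed ht sd1 sd2 se1 se2.
have [_ c0 s0 _ _] := theta_range ht; rewrite flexed_octahedron_oct//.
have := (half_tans_oct hp hq hpq (flexed_point th d1 d2 e1 e2) hc hs h (rotation1 R)).2 erefl.
by rewrite mulmx1_oct.
Qed.

Section Lengths.
Variable l : edge -> R.
Hypothesis hl : forall u v, adjacent u v -> cos (l (edge_of u v)) = gram p q u v.
Hypothesis hl0 : forall e, 0 < l e < pi.

Lemma flexed_is_octahedron th d1 d2 e1 e2 : theta_min <= th <= theta_max ->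
  is_sign d1 -> is_sign d2 -> is_sign e1 -> is_sign e2 ->
  let Q := flexed_octahedron (p false) (p true) (q false) (q true) th d1 d2 e1 e2 in
  is_octahedron Q /\ has_edge_lengths Q l.
Proof.
move=> ht sd1 sd2 se1 se2; have [h hc hs _ _] := on_curve_flexed ht sd1 sd2 se1 se2.
have [_ c0 s0 _ _] := theta_range ht; rewrite /= flexed_octahedron_oct//.
by have := oct_edge_lengths hp hq hpq hl hl0 hc hs h (rotation1 R); rewrite mulmx1_oct.
Qed.

Lemma octahedron_flexed s t Q : is_sign s -> half s t -> is_octahedron Q -> has_edge_lengths Q l ->
  has_half_tans Q t -> exists th d1 d2 e1 e2 g,
  [/\ theta_min <= th <= theta_max, [/\ is_sign d1, is_sign d2, is_sign e1 & is_sign e2],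
      d1 * e1 = s, is_rotation g &
      forall u, Q u =
        flexed_octahedron (p false) (p true) (q false) (q true) th d1 d2 e1 e2 u *m g].
Proof.
move=> ss [v [hv sv] tE] [Q1 _] lQ ht.
have [c [s' [al [be [g [c0 s0 hc hs [h hg QE]]]]]]] :=
  octahedron_classification hp hq Q1 ((edge_lengthsP hl hl0 Q1).1 lQ).
have tE' : t = curve_point p q al be.
  apply/(half_tans_oct hp hq hpq _ hc hs h hg).
  by have <- : Q = (fun u => oct_of p q c s' al be u *m g) by apply/funext.
have vE : affine_of al be = v.
  apply: (point_of_inj hp hq hpq) => //; first exact: affine_space_curve.
  by rewrite tE -curve_point_affine.
have [ht' c0' s0' hc' hs'] := theta_ofP h; have [aE bE] := amplitude_sgp h.
have cE : cos (theta_of al) = c.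
  by apply/eqP; rewrite -(@eqrXn2 _ 2)// ?ltW// hc hc'.
have sE : sin (theta_of al) = s'.
  by apply/eqP; rewrite -(@eqrXn2 _ 2)// ?ltW// hs hs'.
exists (theta_of al), (sgp (al false)), (sgp (al true)), (sgp (be false)), (sgp (be true)), g.
split=> //; first by split; exact: sgp_sign.
  have [a0 b0] := on_curve_neq0 hp hq h; move: sv; rewrite -vE /= => sv.
  have sab : 0 < s * (al false * be false).
    have -> : s * (al false * be false) = s * (be false / al false) * al false ^+ 2 by field.
    by rewrite mulr_gt0// lt_neqAle sqr_ge0 eq_sym sqrf_eq0 a0.
  have sgE x : x != 0 -> 0 < sgp x * x.
    by move=> x0; rewrite -[X in _ * X]sgp_norm mulrA -expr2 (sign_sqr (sgp_sign x)) mul1r normr_gt0.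
  have sp : 0 < (sgp (al false) * sgp (be false)) * (al false * be false).
    by rewrite mulrACA mulr_gt0// sgE.
  move: sab sp; case: ss => ->; case: (sgp_sign (al false)) => ->; case: (sgp_sign (be false)) => ->; lra.
by move=> u; rewrite flexed_octahedron_oct// aE bE cE sE.
Qed.

End Lengths.

End FlexedPoints.

(** * One period of the flexion *)

Section FlexedPoints.
Variable R : realType.
Variables p q : bool -> R.
Hypotheses (hp : `|p false| < `|p true|) (hq : `|q false| < `|q true|).
Hypothesis hpq : p true ^+ 2 + q true ^+ 2 < 1.
Implicit Types (t : RP1_12 R) (s z th : R) (al be : bool -> R).

Local Notation P := (Pc p q).
Local Notation Q := (Qc p q).
Local Notation half := (half_curve p q).

Local Notation tmin := (theta_min q).
Local Notation tmax := (theta_max p).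

(** From (1 + T^2) al_1^2 = kk, the affine coordinates determine al_1 up to sign, and the positive
    product fixes the sign. *)
Lemma affine_of_inj al be al' be' : on_curve p q al be -> on_curve p q al' be' ->
  0 < al false * al' false -> affine_of al be = affine_of al' be' -> al = al' /\ be = be'.
Proof.
move=> h h' s0 [eT eX eY]; have [a0 _] := on_curve_neq0 hp hq h.
have [a0' _] := on_curve_neq0 hp hq h'.
have fE : al false = al' false.
  have bE : be false = al false * (be' false / al' false) by rewrite -eT mulrC divfK.
  have bE' : be' false = al' false * (be' false / al' false) by rewrite mulrC divfK.
  have kE := on_curve_kk false false h; rewrite -(on_curve_kk false false h') in kE.
  have := sqr_ge0 (be' false / al' false); move: (be' false / al' false) bE bE' => y bE bE'.
  rewrite bE bE' in kE.
  move=> T0; have : (1 + y ^+ 2) * ((al false - al' false) * (al false + al' false)) = 0 by move: kE; lra.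
  have y1 : (1 + y ^+ 2 == 0) = false by rewrite gt_eqF// ltr_pwDl.
  move/eqP; rewrite !mulf_eq0 y1 subr_eq0 addr_eq0 /= => /orP[/eqP //|].
  move=> /eqP aE; exfalso; move: s0; rewrite aE mulNr oppr_gt0 -expr2.
  by rewrite ltNge sqr_ge0.
have dE (x y z z' : R) : z != 0 -> z = z' -> x / z = y / z' -> x = y.
  by move=> z0 <- /(mulIf (invr_neq0 z0)).
by split; apply/funext => -[] //; apply: (dE _ _ (al false) (al' false)).
Qed.

Lemma flexed_point_inj th th' d1 d2 d2' e1 e2 e2' :
  tmin <= th <= tmax -> tmin <= th' <= tmax -> is_sign d1 -> is_sign d2 -> is_sign d2' ->
  is_sign e1 -> is_sign e2 -> is_sign e2' ->
  flexed_point p q th d1 d2 e1 e2 = flexed_point p q th' d1 d2' e1 e2' ->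
  [/\ th = th', amplitude (cos th) d1 d2 p = amplitude (cos th') d1 d2' p &
      amplitude (sin th) e1 e2 q = amplitude (sin th') e1 e2' q].
Proof.
move=> ht ht' sd1 sd2 sd2' se1 se2 se2'.
have [h hc _ a0 _] := on_curve_flexed hp hq hpq ht sd1 sd2 se1 se2.
have [h' hc' _ a0' _] := on_curve_flexed hp hq hpq ht' sd1 sd2' se1 se2'.
have sv := affine_space_curve hp hq hpq h; have sv' := affine_space_curve hp hq hpq h'.
rewrite /flexed_point (curve_point_affine hp hq h) (curve_point_affine hp hq h').
move=> /(point_of_inj hp hq hpq sv sv') aff.
have aa : 0 < amplitude (cos th) d1 d2 p false * amplitude (cos th') d1 d2' p false.
  by have := mulr_gt0 a0 a0'; rewrite mulrACA -expr2 sign_sqr// mul1r.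
have [aE bE] := affine_of_inj h h' aa aff.
split=> //; have [t1 c0 _ _ _] := theta_range hp hq hpq ht.
have [t1' c0' _ _ _] := theta_range hp hq hpq ht'.
have cE : cos th = cos th'.
  by apply/eqP; rewrite -(@eqrXn2 _ 2)// ?ltW// hc hc' aE.
have pp := @pi_ge0 R; case/andP: t1 => ? ?; case/andP: t1' => ? ?.
by apply: cos_inj cE; rewrite in_itv /=; apply/andP; split; lra.
Qed.

(** The factor of delta_2 vanishes at theta_max and that of epsilon_2 at theta_min; this is what
    allows these signs to change there. *)
Lemma flexed_point_eq th d1 d2 d2' e1 e2 e2' : tmin <= th <= tmax ->
  (th < tmax -> d2 = d2') -> (tmin < th -> e2 = e2') ->
  flexed_point p q th d1 d2 e1 e2 = flexed_point p q th d1 d2' e1 e2'.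
Proof.
move=> ht hd he; have [t1 c0 s0 cp sq] := theta_range hp hq hpq ht.
have [t2 t3] := andP t1; have [t4 t5] := andP ht; have pp := @pi_ge0 R.
have sqE (x y : R) : `|x| = y -> y ^+ 2 - x ^+ 2 = 0.
  by move=> <-; rewrite real_normK ?num_real// subrr.
rewrite /flexed_point; congr curve_point; apply/funext => -[] //; rewrite /amplitude.
- have [/hd -> //|t6] := ltP th tmax.
  have -> : th = tmax by lra.
  by rewrite (sqE _ _ (esym (cos_theta_max hpq))) sqrtr0 !mulr0.
- have [/he -> //|t6] := ltP tmin th.
  have -> : th = tmin by lra.
  by rewrite (sqE _ _ (esym (sin_theta_min hpq))) sqrtr0 !mulr0.
Qed.

Lemma amplitude_sign_inj (c d1 d2 d2' : R) (x : bool -> R) : `|x true| < c ->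
  amplitude c d1 d2 x = amplitude c d1 d2' x -> d2 = d2'.
Proof.
move=> xc /(congr1 (@^~ true)) /mulIf; apply; rewrite lt0r_neq0// sqrtr_gt0 subr_gt0.
have c0 : 0 <= c by rewrite (le_trans _ (ltW xc)).
by rewrite -[x true ^+ 2]real_normK ?num_real// ltr_sqr ?nnegrE.
Qed.

(** A triangle wave written with absolute values, from which continuity and range follow without
    cases. *)
Lemma loop_thetaE a b tau : loop_theta a b tau = a + (1 - `|1 - `|tau - 2| |) * (b - a) :> R.
Proof.
rewrite /loop_theta; have [t1|t1] := leP tau 1.
  by rewrite (@ler0_norm _ (tau - 2)) ?(@ler0_norm _ (1 - _)); lra.
have [t2|t2] := leP tau 2.
  by rewrite (@ler0_norm _ (tau - 2)) ?(@ger0_norm _ (1 - _)); lra.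
have [t3|t3] := leP tau 3.
  by rewrite (@ger0_norm _ (tau - 2)) ?(@ger0_norm _ (1 - _)); lra.
by rewrite (@ger0_norm _ (tau - 2)) ?(@ler0_norm _ (1 - _)); lra.
Qed.

Lemma loop_theta_range tau : 0 <= tau <= 4 -> tmin <= loop_theta tmin tmax tau <= tmax.
Proof.
move=> /andP[t0 t4]; have D := theta_min_lt_max hp hq hpq; rewrite loop_thetaE.
have h1 : `|tau - 2| <= 2 by rewrite ler_norml; apply/andP; split; lra.
have h2 : `|1 - `|tau - 2| | <= 1.
  by rewrite ler_norml; have := normr_ge0 (tau - 2) => ?; apply/andP; split; lra.
have h3 := normr_ge0 (1 - `|tau - 2|); move: (`|1 - _|) h2 h3 => x h2 h3.
by apply/andP; split; nra.
Qed.

Lemma loop_d2_sign tau : is_sign (loop_d2 tau : R).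
Proof. by rewrite /loop_d2; case: ifP => _; [right|left]. Qed.
Lemma loop_e2_sign tau : is_sign (loop_e2 tau : R).
Proof. by rewrite /loop_e2; case: ifP => _; [right|left]. Qed.

Lemma loop_quadrant (x : R) : 0 <= x < 4 ->
   [\/ [/\ 0 <= x <= 1, 1 - `|1 - `|x - 2| | = x, loop_d2 x = 1 :> R & loop_e2 x = 1 :> R],
       [/\ 1 < x <= 2, 1 - `|1 - `|x - 2| | = 2 - x, loop_d2 x = -1 :> R & loop_e2 x = 1 :> R],
       [/\ 2 < x < 3, 1 - `|1 - `|x - 2| | = x - 2, loop_d2 x = -1 :> R & loop_e2 x = -1 :> R] |
       [/\ 3 <= x < 4, 1 - `|1 - `|x - 2| | = 4 - x, loop_d2 x = 1 :> R & loop_e2 x = -1 :> R]].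
Proof.
move=> /andP[x0 x4]; rewrite /loop_d2 /loop_e2.
have := loop_thetaE 0 1 x; rewrite add0r subr0 mulr1 => <-; rewrite /loop_theta !subr0 !add0r !mulr1.
have ltF (a b : R) : b <= a -> (a < b) = false by move=> h; apply/negbTE; rewrite -leNgt.
have [x1|x1] := leP x 1; first by apply: Or41; rewrite x0 /= (ltF 2) /=; [split|lra].
have [x2|x2] := leP x 2; first by apply: Or42; rewrite (_ : x < 3)//; lra.
have [x3|x3] := leP x 3.
  have [x3'|x3'] := ltP x 3; first by apply: Or43; rewrite x4.
  by apply: Or44; rewrite x4; split=> //; lra.
by apply: Or44; rewrite x4 (ltF x 3) /= ?(ltW x3)//; split.
Qed.

(** The disjunctions reflect what equality of two flexed points provides: a sign is determined only
    where its factor is nonzero. *)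
Lemma loop_parameter_inj (x y : R) : 0 <= x < 4 -> 0 <= y < 4 ->
  1 - `|1 - `|x - 2| | = 1 - `|1 - `|y - 2| | ->
  1 - `|1 - `|x - 2| | = 1 \/ loop_d2 x = loop_d2 y :> R ->
  1 - `|1 - `|x - 2| | = 0 \/ loop_e2 x = loop_e2 y :> R -> x = y.
Proof.
move=> /loop_quadrant qx /loop_quadrant qy hE dE eE; rewrite hE in dE eE qx.
case: qx => -[/andP[i1 i2] h1 u1 v1]; case: qy => -[/andP[j1 j2] h2 u2 v2];
  rewrite u1 u2 h2 in dE; rewrite v1 v2 h2 in eE; rewrite h2 in h1;
  clear - i1 i2 j1 j2 h1 dE eE; case: dE => dE; case: eE => eE; lra.
Qed.

Definition loop_point s d1 tau : RP1_12 R :=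
  flexed_point p q (loop_theta tmin tmax tau) d1 (loop_d2 tau) (s * d1) (loop_e2 tau).

Section Loop.
Variables s d1 : R.
Hypotheses (hs : is_sign s) (hd1 : is_sign d1).

Let hsd : is_sign (s * d1).
Proof. by case: hs hd1 => -> [] ->; rewrite ?mul1r ?mulN1r ?opprK; [left|right|right|left]. Qed.
Let s2 : s ^+ 2 = 1. Proof. exact: sign_sqr. Qed.
Let d12 : d1 ^+ 2 = 1. Proof. exact: sign_sqr. Qed.

Lemma loop_point_half tau : 0 <= tau <= 4 -> half s (loop_point s d1 tau).
Proof.
move=> ht; have := flexed_point_half hp hq hpq (loop_theta_range ht) hd1 (loop_d2_sign tau) hsd (loop_e2_sign tau).
by rewrite mulrCA -expr2 d12 mulr1.
Qed.

Lemma loop_point_closed : loop_point s d1 0 = loop_point s d1 4.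
Proof.
have n0 : `|1 - `|0 - 2| | = 1 :> R.
  by rewrite (@ler0_norm _ (0 - 2)) ?(@ler0_norm _ (1 - _)); lra.
have n4 : `|1 - `|4 - 2| | = 1 :> R.
  by rewrite (@ger0_norm _ (4 - 2)) ?(@ler0_norm _ (1 - _)); lra.
rewrite /loop_point !loop_thetaE n0 n4; congr flexed_point.
- rewrite /loop_d2; case: ifPn => [/andP[? ?]|_]; first by exfalso; lra.
  by case: ifPn => [/andP[? ?]|//]; exfalso; lra.
- rewrite /loop_e2; case: ifPn => [/andP[? ?]|_]; first by exfalso; lra.
  by case: ifPn => [/andP[? ?]|//]; exfalso; lra.
Qed.

Lemma loop_point_inj : {in `[0, 4[ &, injective (loop_point s d1)}.
Proof.
move=> t t'; rewrite !in_itv /= => /andP[t0 t4] /andP[t0' t4'].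
have r : 0 <= t <= 4 by rewrite t0 ltW.
have r' : 0 <= t' <= 4 by rewrite t0' ltW.
move=> /(flexed_point_inj (loop_theta_range r) (loop_theta_range r') hd1 (loop_d2_sign t)
  (loop_d2_sign t') hsd (loop_e2_sign t) (loop_e2_sign t'))[thE dE eE].
have D := theta_min_lt_max hp hq hpq; have [k1 c0 _ _ _] := theta_range hp hq hpq (loop_theta_range r).
have pp := @pi_ge0 R; have [k2 k3] := andP k1.
have dE' : loop_theta tmin tmax t = tmax \/ loop_d2 t = loop_d2 t' :> R.
  have [/eqP|ne] := boolP (loop_theta tmin tmax t == tmax); first by left.
  right; move: dE; rewrite -thE; apply: amplitude_sign_inj.
  rewrite -(lt_theta_max hpq) ?lt_neqAle ?ne /=; last by apply/andP; split; lra.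
  by have /andP[] := loop_theta_range r.
have eE' : loop_theta tmin tmax t = tmin \/ loop_e2 t = loop_e2 t' :> R.
  have [/eqP|ne] := boolP (loop_theta tmin tmax t == tmin); first by left.
  right; move: eE; rewrite -thE; apply: amplitude_sign_inj.
  rewrite -(lt_theta_min hpq) ?lt_neqAle 1?eq_sym ?ne /=; last by apply/andP; split; lra.
  by have /andP[] := loop_theta_range r.
have hE : 1 - `|1 - `|t - 2| | = 1 - `|1 - `|t' - 2| |.
  move: thE; rewrite !loop_thetaE => /addrI /mulIf; apply.
  by rewrite subr_eq0 gt_eqF.
have thE0 h : h * (tmax - tmin) = 0 -> h = 0.
  by move/eqP; rewrite mulf_eq0 subr_eq0 (gt_eqF D) orbF => /eqP.
have dE2 : 1 - `|1 - `|t - 2| | = 1 \/ loop_d2 t = loop_d2 t' :> R.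
  case: dE' => [|]; [left|by right].
  move: a; rewrite loop_thetaE => hh; have := thE0 (1 - `|1 - `|t - 2| | - 1); rewrite mulrBl mul1r => H.
  by apply/eqP; rewrite -subr_eq0; apply/eqP/H; lra.
have eE2 : 1 - `|1 - `|t - 2| | = 0 \/ loop_e2 t = loop_e2 t' :> R.
  case: eE' => [|]; [left|by right].
  by move: a; rewrite loop_thetaE => hh; apply: thE0; lra.
by apply: (loop_parameter_inj _ _ hE dE2 eE2); apply/andP.
Qed.

End Loop.

End FlexedPoints.

Section FlexedPoints.
Variable R : realType.
Variables p q : bool -> R.
Hypotheses (hp : `|p false| < `|p true|) (hq : `|q false| < `|q true|).
Hypothesis hpq : p true ^+ 2 + q true ^+ 2 < 1.
Implicit Types (t : RP1_12 R) (s z th : R) (al be : bool -> R).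

Local Notation P := (Pc p q).
Local Notation Q := (Qc p q).
Local Notation spc := (space_curve P Q).
Local Notation pt := (point_of p q).
Local Notation half := (half_curve p q).

Local Notation tmin := (theta_min q).
Local Notation tmax := (theta_max p).
Local Notation curve := (curve_set p q).

Lemma continuous_curve_point (X : topologicalType) (al be : X -> bool -> R) :
  (forall i, continuous (fun x => al x i)) -> (forall j, continuous (fun x => be x j)) ->
  (forall x, on_curve p q (al x) (be x)) -> continuous (fun x => curve_point p q (al x) (be x)).
Proof.
move=> ha hb h a; apply: continuous_to_RP1_12 => e.
pose ct (f : X -> R) := {for a, continuous f}.
have cM f g : ct f -> ct g -> ct (fun x => f x * g x) by move=> cf cg; apply: cvgM.
have cD f g : ct f -> ct g -> ct (fun x => f x + g x) by move=> cf cg; apply: cvgD.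
have cC (k : R) : ct (fun=> k) by exact: cvg_cst.
have ca i : ct (fun x => al x i) by exact: ha.
have cb j : ct (fun x => be x j) by exact: hb.
have [c1 c2 c3] := forms_closed p q e cC cD cM ca cb.
have cV : ct (fun x => (rn p q id (al x) (be x) e)^-1).
  apply: cvgV; last exact: c3.
  exact: lt0r_neq0 (rn_gt0 hp hq hpq e (h a)).
apply: (continuous_half_tan_cs (f := fun x => angle_cos p q (al x) (be x) e)
  (g := fun x => angle_sin p q (al x) (be x) e)).
- by move=> x; exact: (angle_sqr hp hq hpq e (h x)).
- exact: cM c1 cV.
- exact: cM c2 cV.
Qed.

Section FunctionsOnCurve.
Variable d1 : R.
Hypothesis hd1 : is_sign d1.

Let d12 : d1 ^+ 2 = 1. Proof. exact: sign_sqr. Qed.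

Definition affine_point t : R * R * R := xget (0, 0, 0) [set u | spc u /\ pt u = t].

Lemma affine_point_of u : spc u -> affine_point (pt u) = u.
Proof.
move=> hu; rewrite /affine_point; case: xgetP => [v _ [hv vu]|/(_ u) []] //.
exact: (point_of_inj hp hq hpq).
Qed.

(** Of the two representatives of a point, the one with delta_1 = d1. *)
Definition al_at t i : R := d1 * radius p q (affine_point t) * al_of (affine_point t) i.
Definition be_at t j : R := d1 * radius p q (affine_point t) * be_of (affine_point t) j.

Lemma on_curve_at t : curve t -> on_curve p q (al_at t) (be_at t).
Proof. by move=> [u hu <-]; rewrite /al_at /be_at affine_point_of//; exact: on_curve_of. Qed.

Lemma curve_point_at t : curve t -> curve_point p q (al_at t) (be_at t) = t.
Proof. by move=> [u hu <-]; rewrite /al_at /be_at affine_point_of//; exact: point_of_scaled. Qed.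

Lemma sgp_al_at t : curve t -> sgp (al_at t false) = d1.
Proof.
move=> [u hu <-]; apply: sgp_unique => //; rewrite /al_at affine_point_of// mulr1 mulrA -expr2 d12 mul1r.
exact: radius_gt0.
Qed.

Lemma sgp_be_at s t : is_sign s -> half s t -> sgp (be_at t false) = s * d1.
Proof.
move=> hs [u [hu su] <-]; apply: sgp_unique.
  by case: hs hd1 => -> [] ->; rewrite ?mul1r ?mulN1r ?opprK; [left|right|right|left].
rewrite /be_at affine_point_of//=.
have -> : s * d1 * (d1 * radius p q u * u.1.1) = d1 ^+ 2 * radius p q u * (s * u.1.1) by ring.
by rewrite d12 mul1r mulr_gt0 ?(radius_gt0 hp hq hpq).
Qed.

Lemma flexed_point_at t : curve t ->
  flexed_point p q (theta_of p (al_at t)) d1 (sgp (al_at t true)) (sgp (be_at t false)) (sgp (be_at t true)) = t.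
Proof.
move=> ht; have h := on_curve_at ht; have [aE bE] := amplitude_sgp hp hq hpq h.
rewrite /flexed_point -{1}(sgp_al_at ht) aE bE; exact: curve_point_at.
Qed.

Lemma half_sub s t : half s t -> curve t.
Proof. by move=> [u [hu _] <-]; exists u. Qed.

Section Loop.
Variable s : R.
Hypothesis hs : is_sign s.

Let hsd : is_sign (s * d1).
Proof. by case: hs hd1 => -> [] ->; rewrite ?mul1r ?mulN1r ?opprK; [left|right|right|left]. Qed.

Lemma loop_point_surj t : half s t -> exists2 tau, 0 <= tau <= 4 & loop_point p q s d1 tau = t.
Proof.
move=> st; have ht := half_sub st.
have [hth _ _ _ _] := theta_ofP hp hq hpq (on_curve_at ht).
have := flexed_point_at ht; rewrite (sgp_be_at hs st).
move: (sgp_sign (al_at t true)) (sgp_sign (be_at t true)).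
move: (sgp (al_at t true)) (sgp (be_at t true)) (theta_of p (al_at t)) hth => d2 e2 th hth sd2 se2 <-.
have D := theta_min_lt_max hp hq hpq; have D0 : 0 < tmax - tmin by rewrite subr_gt0.
have [h1 h2] := andP hth; set a := (th - tmin) / (tmax - tmin).
have aE : a * (tmax - tmin) = th - tmin by rewrite divfK// lt0r_neq0.
have a0 : 0 <= a by rewrite divr_ge0 ?subr_ge0// ltW.
have a1 : a <= 1 by rewrite ler_pdivrMr// mul1r lerB.
have red tau : 0 <= tau <= 4 -> 1 - `|1 - `|tau - 2| | = a ->
    (a < 1 -> loop_d2 tau = d2) -> (0 < a -> loop_e2 tau = e2) ->
    exists2 tau, 0 <= tau <= 4 & loop_point p q s d1 tau = flexed_point p q th d1 d2 (s * d1) e2.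
  move=> t4 tE hd he; exists tau => //; rewrite /loop_point loop_thetaE tE aE addrC subrK.
  apply: (flexed_point_eq hp hq hpq) => // hth'.
  - by apply: hd; rewrite ltr_pdivrMr// mul1r; lra.
  - by apply: he; rewrite divr_gt0// subr_gt0.
have absE (x : R) : loop_theta 0 1 x = 1 - `|1 - `|x - 2| |.
  by rewrite loop_thetaE add0r subr0 mulr1.
have itv (x y : R) : x <= y -> (y < x) = false by move=> h; apply/negbTE; rewrite -leNgt.
(* The pairs (d2, e2) = (1, 1), (1, -1), (-1, 1), (-1, -1) are met at tau = a, 4 - a, 2 - a and 2 +
   a respectively. *)
case: sd2 red => ->; case: se2 => -> red.
- apply: (red a); first by apply/andP; split; lra.
  + by rewrite -absE /loop_theta a1 subr0 add0r mulr1.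
  + by move=> _; rewrite /loop_d2 (itv a 1).
  + by move=> _; rewrite /loop_e2 (itv a 2)//; lra.
- apply: (red (4 - a)); first by apply/andP; split; lra.
  + rewrite -absE /loop_theta; case: ifPn => [?|?]; first by lra.
    by case: ifPn => [?|?]; [|case: ifPn => ?]; lra.
  + by move=> ?; rewrite /loop_d2; case: ifPn => // /andP[? ?]; exfalso; lra.
  + by move=> ?; rewrite /loop_e2; case: ifPn => // /negP[]; apply/andP; split; lra.
- apply: (red (2 - a)); first by apply/andP; split; lra.
  + rewrite -absE /loop_theta; case: ifPn => [?|?]; first by lra.
    by case: ifPn => [?|?]; [|case: ifPn => ?]; lra.
  + by move=> ?; rewrite /loop_d2; case: ifPn => // /negP[]; apply/andP; split; lra.
  + by move=> ?; rewrite /loop_e2; case: ifPn => // /andP[? ?]; exfalso; lra.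
- apply: (red (2 + a)); first by apply/andP; split; lra.
  + rewrite -absE /loop_theta; case: ifPn => [?|?]; first by lra.
    by case: ifPn => [?|?]; [|case: ifPn => ?]; lra.
  + by move=> ?; rewrite /loop_d2; case: ifPn => // /negP[]; apply/andP; split; lra.
  + by move=> ?; rewrite /loop_e2; case: ifPn => // /negP[]; apply/andP; split; lra.
Qed.

(** The signs jump, but only where the square roots that they multiply vanish. Composition with
    [clamp] reduces the claim to continuity on the whole line. *)
Lemma loop_point_continuous : {within `[0, 4], continuous (loop_point p q s d1)}.
Proof.
pose clamp (x : R) := Num.max 0 (Num.min x 4).
have cid : continuous (fun x : R => x) by move=> x; exact: cvg_id.
have cmin (f : R -> R) (k : R) : continuous f -> continuous (fun x => Num.min (f x) k).
  by move=> cf x; apply: continuous_min; [exact: cf|exact: cvg_cst].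
have cmax (f : R -> R) (k : R) : continuous f -> continuous (fun x => Num.max k (f x)).
  by move=> cf x; apply: continuous_max; [exact: cvg_cst|exact: cf].
have clampE x : 0 <= x <= 4 -> clamp x = x.
  by move=> /andP[x0 x4]; rewrite /clamp min_l// max_r.
have clampR x : 0 <= clamp x <= 4 by rewrite le_max lexx /= ge_max ler0n ge_min lexx orbT.
have cclamp : continuous clamp by apply: cmax; exact: cmin.
suff cl : continuous (loop_point p q s d1 \o clamp).
  apply: (@subspace_eq_continuous _ _ _ (loop_point p q s d1 \o clamp)); last first.
    exact: continuous_subspaceT.
  by move=> x; rewrite inE /= in_itv /= => hx; rewrite clampE.
have cth : continuous (loop_theta tmin tmax).
  have -> : loop_theta tmin tmax = (fun tau => tmin + (1 - `|1 - `|tau - 2| |) * (tmax - tmin)).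
    by apply/funext => tau; exact: loop_thetaE.
  have cn (f : R -> R) (k : R) : continuous f -> continuous (fun x => k - `|f x|).
    move=> cf x; apply: cvgB; first exact: cvg_cst.
    exact: (continuous_comp (cf x) (@norm_continuous _ _ _)).
  have cs : continuous (fun x : R => x - 2) by move=> x; apply: cvgB; [exact: cvg_id|exact: cvg_cst].
  move=> x; apply: cvgD; first exact: cvg_cst.
  by apply: cvgM; [exact: (cn _ 1 (cn _ 1 cs) x)|exact: cvg_cst].
pose F (x : bool -> R) (trig : R -> R) i tau := Num.sqrt (trig (loop_theta tmin tmax tau) ^+ 2 - x i ^+ 2).
have cF x trig i : continuous trig -> continuous (F x trig i).
  move=> ct; have cc : continuous (fun tau => trig (loop_theta tmin tmax tau)).
    by move=> y; exact: (continuous_comp (cth y) (ct _)).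
  have c2 : continuous (fun tau => trig (loop_theta tmin tmax tau) ^+ 2 - x i ^+ 2).
    by move=> y; apply: cvgB; [apply: cvgM; exact: cc|exact: cvg_cst].
  by move=> y; exact: (continuous_comp (c2 y) (@sqrt_continuous _ _)).
have FcE : Num.sqrt (cos tmax ^+ 2 - p true ^+ 2) = 0.
  by rewrite (cos_theta_max hpq) real_normK ?num_real// subrr sqrtr0.
have FsE : Num.sqrt (sin tmin ^+ 2 - q true ^+ 2) = 0.
  by rewrite (sin_theta_min hpq) real_normK ?num_real// subrr sqrtr0.
have absE (x : R) : loop_theta 0 1 x = 1 - `|1 - `|x - 2| |.
  by rewrite loop_thetaE add0r subr0 mulr1.
have th13 x : x = 1 \/ x = 3 -> loop_theta tmin tmax x = tmax.
  rewrite loop_thetaE -absE => -[] ->; rewrite /loop_theta.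
    by rewrite lexx subr0 add0r !mul1r addrC subrK.
  do 2 (case: ifPn => [?|_]; first by exfalso; lra).
  by rewrite lexx; lra.
have th24 x : x = 2 \/ x = 4 -> loop_theta tmin tmax x = tmin.
  rewrite loop_thetaE -absE => -[] ->; rewrite /loop_theta.
    by case: ifPn => [?|_]; [exfalso; lra|rewrite lexx; lra].
  by do 3 (case: ifPn => [?|_]; first by exfalso; lra); lra.
(* Gluing by min and max: two of the three terms are always evaluated at 1 or 3, where F is zero,
   and the remaining one carries the correct sign. *)
have G x : 0 <= x <= 4 -> loop_d2 x * F p cos true x =
    F p cos true (Num.min x 1) - F p cos true (Num.max 1 (Num.min x 3)) + F p cos true (Num.max 3 x).
  move=> /andP[x0 x4]; rewrite /loop_d2.
  have F1 y : y = 1 \/ y = 3 -> F p cos true y = 0 by move=> /th13 yE; rewrite /F yE.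
  have e1 := F1 _ (or_introl erefl); have e3 := F1 _ (or_intror erefl).
  have [x1|] := boolP (x <= 1); last rewrite -ltNge => x1.
    rewrite (@min_l _ _ x 1)// (@min_l _ _ x 3) ?(@max_l _ _ 1 x) ?(@max_l _ _ 3 x)//; try lra.
    by case: ifPn => [/andP[? ?]|_]; lra.
  have [x3|] := boolP (x <= 3); last rewrite -ltNge => x3.
    rewrite (@min_r _ _ x 1) ?(ltW x1)// (@min_l _ _ x 3)// (@max_r _ _ 1 x) ?(ltW x1)// (@max_l _ _ 3 x)//.
    have [x3'|x3'] := boolP (x < 3); last first.
      by have xE : x = 3 by [lra]; rewrite xE e3 e1; lra.
    by case: ifPn => [_|/negP[]]; [lra|rewrite x1].
  rewrite (@min_r _ _ x 1) ?(ltW x1)// (@min_r _ _ x 3) ?(ltW x3)// (@max_r _ _ 1 3) ?(@max_r _ _ 3 x) ?(ltW x3)//; try lra.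
  by case: ifPn => [/andP[? ?]|_]; lra.
have H x : 0 <= x <= 4 -> loop_e2 x * F q sin true x =
    F q sin true (Num.min x 2) - F q sin true (Num.max 2 x).
  move=> /andP[x0 x4]; rewrite /loop_e2.
  have F2 y : y = 2 \/ y = 4 -> F q sin true y = 0 by move=> /th24 yE; rewrite /F yE.
  have e2 := F2 _ (or_introl erefl); have e4 := F2 _ (or_intror erefl).
  have [x2|] := boolP (x <= 2); last rewrite -ltNge => x2.
    rewrite (@min_l _ _ x 2)// (@max_l _ _ 2 x)//.
    by case: ifPn => [/andP[? ?]|_]; lra.
  rewrite (@min_r _ _ x 2) ?(ltW x2)// (@max_r _ _ 2 x) ?(ltW x2)//.
  have [x4'|x4'] := boolP (x < 4); last first.
    by have xE : x = 4 by [lra]; rewrite xE e4 e2; lra.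
  by case: ifPn => [_|/negP[]]; [lra|rewrite x2].
apply: (continuous_curve_point (al := fun z => amplitude (cos (loop_theta tmin tmax (clamp z))) d1 (loop_d2 (clamp z)) p)
  (be := fun z => amplitude (sin (loop_theta tmin tmax (clamp z))) (s * d1) (loop_e2 (clamp z)) q)).
- case=> /=; last first.
    move=> z; apply: cvgM; first exact: cvg_cst.
    exact: (continuous_comp (cclamp z) (cF p cos false (@continuous_cos R) _)).
  have -> : (fun z => amplitude (cos (loop_theta tmin tmax (clamp z))) d1 (loop_d2 (clamp z)) p true) =
    (fun z => F p cos true (Num.min (clamp z) 1) - F p cos true (Num.max 1 (Num.min (clamp z) 3)) +
       F p cos true (Num.max 3 (clamp z))).
    by apply/funext => z; rewrite -G.
  have cFp := cF p cos true (@continuous_cos R).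
  move=> z; apply: cvgD; [apply: cvgB|].
  + exact: (continuous_comp (cmin _ 1 cclamp z) (cFp _)).
  + exact: (continuous_comp (cmax _ 1 (cmin _ 3 cclamp) z) (cFp _)).
  + exact: (continuous_comp (cmax _ 3 cclamp z) (cFp _)).
- case=> /=; last first.
    move=> z; apply: cvgM; first exact: cvg_cst.
    exact: (continuous_comp (cclamp z) (cF q sin false (@continuous_sin R) _)).
  have -> : (fun z => amplitude (sin (loop_theta tmin tmax (clamp z))) (s * d1) (loop_e2 (clamp z)) q true) =
    (fun z => F q sin true (Num.min (clamp z) 2) - F q sin true (Num.max 2 (clamp z))).
    by apply/funext => z; rewrite -H.
  have cFq := cF q sin true (@continuous_sin R).
  move=> z; apply: cvgB.
  + exact: (continuous_comp (cmin _ 2 cclamp z) (cFq _)).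
  + exact: (continuous_comp (cmax _ 2 cclamp z) (cFq _)).
- move=> z; have [] // := on_curve_flexed hp hq hpq (loop_theta_range hp hq hpq (clampR z)) hd1
    (loop_d2_sign (clamp z)) hsd (loop_e2_sign (clamp z)).
Qed.

End Loop.

End FunctionsOnCurve.

End FlexedPoints.

(** * Theta and the vertices as functions on the curve *)

Section FlexedPoints.
Variable R : realType.
Variables p q : bool -> R.
Hypotheses (hp : `|p false| < `|p true|) (hq : `|q false| < `|q true|).
Hypothesis hpq : p true ^+ 2 + q true ^+ 2 < 1.
Implicit Types (t : RP1_12 R) (s z th : R) (al be : bool -> R).

Local Notation P := (Pc p q).
Local Notation Q := (Qc p q).
Local Notation spc := (space_curve P Q).
Local Notation half := (half_curve p q).

Local Notation tmin := (theta_min q).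
Local Notation tmax := (theta_max p).
Local Notation curve := (curve_set p q).

Section FunctionsOnCurve.
Variable d1 : R.
Hypothesis hd1 : is_sign d1.

Let d12 : d1 ^+ 2 = 1. Proof. exact: sign_sqr. Qed.

Local Notation al_at := (al_at p q d1).
Local Notation be_at := (be_at p q d1).

Definition theta_at t : R := theta_of p (al_at t).

Lemma theta_at_range t : curve t -> tmin <= theta_at t <= tmax.
Proof. by move=> ht; have [] := theta_ofP hp hq hpq (on_curve_at hp hq hpq hd1 ht). Qed.

(** Replaces the signs, which jump along the curve, by the amplitudes [al_at] and [be_at], in which
    they are absorbed. *)
Lemma flexed_octahedron_at t : curve t ->
  flexed_octahedron (p false) (p true) (q false) (q true) (theta_at t) d1
    (sgp (al_at t true)) (sgp (be_at t false)) (sgp (be_at t true)) =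
  oct_of p q (Num.sqrt (al_at t false ^+ 2 + p false ^+ 2))
    (Num.sqrt (be_at t false ^+ 2 + q false ^+ 2)) (al_at t) (be_at t).
Proof.
move=> ht; have h := on_curve_at hp hq hpq hd1 ht.
have [_ c0 s0 cE sE] := theta_ofP hp hq hpq h; have [aE bE] := amplitude_sgp hp hq hpq h.
rewrite flexed_octahedron_oct// -{1}(sgp_al_at hp hq hpq hd1 ht) aE bE -cE -sE.
by rewrite !sqrtr_sqr !gtr0_norm.
Qed.

Section Half.
Variable s : R.
Hypothesis hs : is_sign s.

Let hsd : is_sign (s * d1).
Proof. by case: hs hd1 => -> [] ->; rewrite ?mul1r ?mulN1r ?opprK; [left|right|right|left]. Qed.

Let half_flexed th d2 e2 : tmin <= th <= tmax -> is_sign d2 -> is_sign e2 ->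
  half s (flexed_point p q th d1 d2 (s * d1) e2).
Proof.
move=> ht sd2 se2; have := flexed_point_half hp hq hpq ht hd1 sd2 hsd se2.
by rewrite mulrCA -expr2 d12 mulr1.
Qed.

Lemma theta_at_flexed th d2 e2 : tmin <= th <= tmax -> is_sign d2 -> is_sign e2 ->
  theta_at (flexed_point p q th d1 d2 (s * d1) e2) = th.
Proof.
move=> ht sd2 se2; have st := half_flexed ht sd2 se2; have ct := half_sub st.
have := flexed_point_at hp hq hpq hd1 ct; rewrite (sgp_be_at hp hq hpq hd1 hs st).
move/(flexed_point_inj hp hq hpq (theta_at_range ct) ht hd1 (sgp_sign _) sd2 hsd (sgp_sign _) se2).
by case.
Qed.

Lemma theta_at_image : theta_at @` half s = `[tmin, tmax]%classic.
Proof.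
apply/seteqP; split=> [_ [t st <-]|th]; first by rewrite /= in_itv /= theta_at_range//; exact: half_sub st.
rewrite /= in_itv /= => ht; have s1 : is_sign (1 : R) by left.
by exists (flexed_point p q th d1 1 (s * d1) 1); [exact: half_flexed|exact: theta_at_flexed].
Qed.

Lemma theta_at_fiber th : tmin < th < tmax -> (half s `&` theta_at @^-1` [set th] #= `I_4)%card.
Proof.
move=> /andP[h1 h2]; have ht : tmin <= th <= tmax by rewrite !ltW.
have [t1 c0 s0 cp sq] := theta_range hp hq hpq ht; have pp := @pi_ge0 R; have [t2 t3] := andP t1.
(* The two binary digits of n < 4 encode delta_2 and epsilon_2. *)
pose f n : RP1_12 R := flexed_point p q th d1 ((-1) ^+ odd n) (s * d1) ((-1) ^+ (1 < n)%N).
have sgn (b : bool) : is_sign ((-1) ^+ b : R) by case: b; [right|left].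
have sgnV (x : R) : is_sign x -> exists b : bool, x = (-1) ^+ b.
  by case=> ->; [exists false|exists true].
have sgn_inj (b b' : bool) : (-1) ^+ b = (-1) ^+ b' :> R -> b = b'.
  by case: b b' => [] [] //; rewrite expr0 expr1 => ?; exfalso; lra.
rewrite (_ : _ `&` _ = f @` `I_4); last first.
  apply/seteqP; split=> [t [st /= tE]|_ [n n4 <-]]; last first.
    by split; [exact: half_flexed|exact: theta_at_flexed].
  have := flexed_point_at hp hq hpq hd1 (half_sub st).
  rewrite -/(theta_at t) tE (sgp_be_at hp hq hpq hd1 hs st) => <-.
  have [b ->] := sgnV _ (sgp_sign (al_at t true)); have [b' ->] := sgnV _ (sgp_sign (be_at t true)).
  by exists (b + b'.*2)%N; rewrite /f; case: b b' => [] [].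
apply: inj_card_eq => n m /set_mem n4 /set_mem m4.
move=> /(flexed_point_inj hp hq hpq ht ht hd1 (sgn _) (sgn _) hsd (sgn _) (sgn _))[_].
have cp' : `|p true| < cos th by rewrite -(lt_theta_max hpq)//; apply/andP; split; lra.
have sq' : `|q true| < sin th by rewrite -(lt_theta_min hpq)//; apply/andP; split; lra.
move=> /(amplitude_sign_inj cp')/sgn_inj o1 /(amplitude_sign_inj sq')/sgn_inj o2.
have {}n4 : (n < 4)%N by []; have {}m4 : (m < 4)%N by [].
by move: n m n4 m4 o1 o2 => [|[|[|[|n]]]] [|[|[|[|m]]]].
Qed.

End Half.

(** In the angle parameter al and be are analytic, and cos theta and sin theta are square roots of
    positive germs, hence analytic and invertible. *)
Lemma analytic_vertex u (i : 'I_4) : analytic_on curve (fun t =>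
  flexed_octahedron (p false) (p true) (q false) (q true) (theta_at t) d1
    (sgp (al_at t true)) (sgp (be_at t false)) (sgp (be_at t true)) u 0 i).
Proof.
move=> _ [v hv <-]; have [s [tau [hs _ -> _]]] := ellipse_point_surj hp hq hpq hv.
have s2 := sign_sqr hs; pose w z := ellipse_point p q s (tau + z).
have hw z : spc (w z) := ellipse_pointP hp hq hpq (tau + z) s2.
exists (fun z => flex_point p q s (tau + z)); first exact: flex_local_parametrization.
pose al z i := d1 * radius p q (w z) * al_of (w z) i.
pose be z i := d1 * radius p q (w z) * be_of (w z) i.
have h z : on_curve p q (al z) (be z) := on_curve_of hp hq hpq d12 (hw z).
have [aT ax ay] := analytic_ellipse_point hp hq hpq tau s2.
have cst (k : R) : analytic0 (fun=> k) by exact: analytic0_cst.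
have ar : analytic0 (fun z => d1 * radius p q (w z)).
  apply: analytic0Z; apply: analytic0_sqrt; last first.
    by rewrite divr_gt0 ?(kk_gt0 hp hq hpq)// ltr_pwDl// sqr_ge0.
  apply: analytic0M => //; apply: analytic0V; last by rewrite lt0r_neq0// ltr_pwDl// sqr_ge0.
  by apply: analytic0D => //; exact: analytic0X.
have aal j : analytic0 (fun z => al z j).
  by apply: analytic0M ar _; case: j; [exact: ax|exact: cst].
have abe j : analytic0 (fun z => be z j).
  by apply: analytic0M ar _; case: j; [exact: ay|exact: aT].
have ac : analytic0 (fun z => Num.sqrt (al z false ^+ 2 + p false ^+ 2)).
  apply: analytic0_sqrt; last exact: (on_curve_c2 hp hq (h 0)).
  by apply: analytic0D => //; exact: analytic0X.
have as_ : analytic0 (fun z => Num.sqrt (be z false ^+ 2 + q false ^+ 2)).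
  apply: analytic0_sqrt; last exact: (on_curve_s2 hp hq (h 0)).
  by apply: analytic0D => //; exact: analytic0X.
have c0 : Num.sqrt (al 0 false ^+ 2 + p false ^+ 2) != 0.
  by rewrite lt0r_neq0// sqrtr_gt0 (on_curve_c2 hp hq (h 0)).
have s0 : Num.sqrt (be 0 false ^+ 2 + q false ^+ 2) != 0.
  by rewrite lt0r_neq0// sqrtr_gt0 (on_curve_s2 hp hq (h 0)).
apply: analytic0_analytic_at.
rewrite (_ : _ \o _ = fun z => oct_of p q (Num.sqrt (al z false ^+ 2 + p false ^+ 2))
  (Num.sqrt (be z false ^+ 2 + q false ^+ 2)) (al z) (be z) u 0 i); last first.
  apply/funext => z /=; rewrite flexed_octahedron_at; last by exists (w z).
  have aE : al_at (flex_point p q s (tau + z)) = al z.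
    by apply/funext => j; rewrite /al_at (affine_point_of hp hq hpq (hw z)).
  have bE : be_at (flex_point p q s (tau + z)) = be z.
    by apply/funext => j; rewrite /be_at (affine_point_of hp hq hpq (hw z)).
  by rewrite aE bE.
elim/vertex_cases: u => j; rewrite /oct_of /vec4 /=; under eq_fun do rewrite mxE;
  case: i => [[|[|[|[|//]]]] hi] //=; try exact: cst.
- by apply: analytic0M => //; exact: analytic0V.
- by apply: analytic0M => //; exact: analytic0V.
- by apply: analytic0M => //; exact: analytic0V.
- by apply: analytic0M => //; exact: analytic0V.
- exact: analytic0Z.
Qed.

End FunctionsOnCurve.

End FlexedPoints.

Lemma edge_of_sym u v : adjacent u v -> edge_of u v = edge_of v u.
Proof.
by elim/vertex_cases: u => i; elim/vertex_cases: v => j //= _;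
  rewrite /edge_of /=; congr (_, _, _); apply: val_inj.
Qed.

(** * From edge lengths to inner products *)

Section EdgeLengths.
Variables (R : realType) (l : edge -> R) (p1 p2 q1 q2 : R).
Hypotheses (h11 : l (edge_of a1 a2) = pi / 2) (h12 : l (edge_of a1 b2) = pi / 2)
  (h21 : l (edge_of b1 a2) = pi / 2) (h22 : l (edge_of b1 b2) = pi / 2)
  (ha1 : l (edge_of a1 a3) = l (edge_of a1 b3))
  (hb1 : l (edge_of b1 a3) = l (edge_of b1 b3))
  (ha2 : l (edge_of a2 a3) + l (edge_of a2 b3) = pi)
  (hb2 : l (edge_of b2 a3) + l (edge_of b2 b3) = pi)
  (hp1 : p1 = cos (l (edge_of a1 a3))) (hp2 : p2 = cos (l (edge_of b1 a3)))
  (hq1 : q1 = cos (l (edge_of a2 a3))) (hq2 : q2 = cos (l (edge_of b2 a3))).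

Lemma cos_length_gram u v : adjacent u v ->
  cos (l (edge_of u v)) = gram (fun i => if i then p2 else p1) (fun i => if i then q2 else q1) u v.
Proof.
have e12 i j : cos (l (edge_of (@Ordinal 3 0 isT, i) (@Ordinal 3 1 isT, j))) = 0.
  by rewrite -[RHS](@cos_pihalf R); congr cos; case: i j => [] [].
have e13 i k : cos (l (edge_of (@Ordinal 3 0 isT, i) (@Ordinal 3 2 isT, k))) = if i then p2 else p1.
  by case: i k => [] [] /=; rewrite ?hp1 ?hp2; congr cos => //; exact: esym.
have cN (x y : R) : x + y = pi -> cos y = - cos x.
  by move=> xy; rewrite (_ : y = pi - x) ?cosBpi; last lra; rewrite cosB cospi sinpi; lra.
have e23 j k : cos (l (edge_of (@Ordinal 3 1 isT, j) (@Ordinal 3 2 isT, k))) =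
    sg R k * if j then q2 else q1.
  case: j k => [] [] /=; rewrite ?hq1 ?hq2 /sg ?expr0 ?expr1 ?mul1r ?mulN1r //; exact: cN.
elim/vertex_cases: u => i; elim/vertex_cases: v => j //= _; rewrite /gram /=.
all: by rewrite edge_of_sym.
Qed.
End EdgeLengths.

Theorem proposition5p1 (R : realType) (l : edge -> R)
  (p1 p2 q1 q2 thmin thmax : R)
  (hl : nondegenerate_lengths l)
  (hl0 : forall e, 0 < l e < pi)
  (h11 : l (edge_of a1 a2) = pi / 2) (h12 : l (edge_of a1 b2) = pi / 2)
  (h21 : l (edge_of b1 a2) = pi / 2) (h22 : l (edge_of b1 b2) = pi / 2)
  (ha1 : l (edge_of a1 a3) = l (edge_of a1 b3))
  (hb1 : l (edge_of b1 a3) = l (edge_of b1 b3))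
  (ha2 : l (edge_of a2 a3) + l (edge_of a2 b3) = pi)
  (hb2 : l (edge_of b2 a3) + l (edge_of b2 b3) = pi)
  (hp1 : p1 = cos (l (edge_of a1 a3))) (hp2 : p2 = cos (l (edge_of b1 a3)))
  (hq1 : q1 = cos (l (edge_of a2 a3))) (hq2 : q2 = cos (l (edge_of b2 a3)))
  (hp : `|p1| < `|p2|) (hq : `|q1| < `|q2|) (hpq : p2 ^+ 2 + q2 ^+ 2 < 1)
  (hmin : thmin = asin `|q2|) (hmax : thmax = acos `|p2|) :
  exists G : set (RP1_12 R),
    (* G is the unique essential one-dimensional irreducible component *)
    [/\ essential_component (config_space l) G,
        forall G', essential_component (config_space l) G' -> G' = G,
        (* all points of G are smooth *)
        forall t, G t -> smooth_point_of_curve G t &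
    (* G has exactly two connected components, indexed by the sign
       s = delta_1 epsilon_1 *)
    exists Gpm : R -> set (RP1_12 R),
    [/\ Gpm 1 <> Gpm (-1),
        [set connected_component G t | t in G] = [set Gpm 1; Gpm (-1)],
        (* the flexion in Gpm s is given, up to rotation, by the formulae *)
        forall s, is_sign s ->
          (forall th d1 d2 e1 e2, thmin <= th <= thmax ->
             is_sign d1 -> is_sign d2 -> is_sign e1 -> is_sign e2 ->
             d1 * e1 = s ->
             let Q := flexed_octahedron p1 p2 q1 q2 th d1 d2 e1 e2 in
             [/\ is_octahedron Q, has_edge_lengths Q l &
                 exists2 t, Gpm s t & has_half_tans Q t]) /\
          (forall t Q, Gpm s t -> is_octahedron Q -> has_edge_lengths Q l ->
             has_half_tans Q t ->
             exists th d1 d2 e1 e2 g,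
               [/\ thmin <= th <= thmax,
                   [/\ is_sign d1, is_sign d2, is_sign e1 & is_sign e2],
                   d1 * e1 = s, is_rotation g &
                   forall u,
                     Q u =
                     flexed_octahedron p1 p2 q1 q2 th d1 d2 e1 e2 u *m g]),
        (* Gpm s is a closed curve traversed once by the flexion in which
           delta_1 and epsilon_1 are constant, delta_2 changes when
           theta = thmax and epsilon_2 changes when theta = thmin *)
        forall s d1, is_sign s -> is_sign d1 ->
          exists c : R -> RP1_12 R,
          [/\ {within `[0, 4], continuous c}, c 0 = c 4,
              {in `[0, 4[ &, injective c}, c @` `[0, 4] = Gpm s &
              forall tau, 0 <= tau <= 4 ->
                has_half_tans
                  (flexed_octahedron p1 p2 q1 q2 (loop_theta thmin thmax tau)
                     d1 (loop_d2 tau) (s * d1) (loop_e2 tau))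
                  (c tau)] &
        (* for a fixed delta_1, theta and the coordinates of the vertices are
           functions on G: theta maps Gpm s onto [thmin, thmax], 4-fold over
           the interior, and the coordinates are real analytic *)
        forall d1, is_sign d1 ->
          exists th d2 e1 e2 : RP1_12 R -> R,
          let Q t :=
            flexed_octahedron p1 p2 q1 q2 (th t) d1 (d2 t) (e1 t) (e2 t) in
          [/\ forall t, G t -> [/\ thmin <= th t <= thmax,
                is_sign (d2 t), is_sign (e1 t) & is_sign (e2 t)],
              forall t, G t -> has_half_tans (Q t) t,
              forall s t, is_sign s -> Gpm s t -> d1 * e1 t = s,
              forall s, is_sign s -> th @` Gpm s = `[thmin, thmax]%classic /\
                forall x, thmin < x < thmax ->
                  (Gpm s `&` th @^-1` [set x] #= `I_4)%card &
              forall u i, analytic_on G (fun t => Q t u 0 i)]]].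
Proof.
pose p b := if b then p2 else p1; pose q b := if b then q2 else q1.
have hl' u v : adjacent u v -> cos (l (edge_of u v)) = gram p q u v by exact: cos_length_gram.
have Hp : `|p false| < `|p true| by []; have Hq : `|q false| < `|q true| by [].
have Hpq : p true ^+ 2 + q true ^+ 2 < 1 by [].
have tminE : thmin = theta_min q by []; have tmaxE : thmax = theta_max p by [].
rewrite (config_space_affine Hp Hq Hpq hl' hl0) -/(curve_set p q).
have s1 : is_sign (1 : R) by left.
have sN1 : is_sign (-1 : R) by right.
have cG := curve_set_half Hp Hq Hpq s1.
exists (curve_set p q); split.
- exact: (essential_component_curve_set Hp Hq Hpq).
- exact: (essential_component_unique Hp Hq Hpq).
- exact: (curve_set_smooth Hp Hq Hpq).
exists (half_curve p q); split.
- have [t t1] := half_curve_nonempty Hp Hq Hpq s1.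
  by move=> E; apply: (half_curve_disjoint Hp Hq Hpq t1); rewrite -E.
- apply/seteqP; split=> [_ [t Gt <-]|_ []->].
  + rewrite cG in Gt; case: Gt => ht; [left|right].
      exact: (connected_component_half Hp Hq Hpq s1 ht).
    exact: (connected_component_half Hp Hq Hpq sN1 ht).
  + have [t t1] := half_curve_nonempty Hp Hq Hpq s1; exists t; first by rewrite cG; left.
    exact: (connected_component_half Hp Hq Hpq s1 t1).
  + have [t t1] := half_curve_nonempty Hp Hq Hpq sN1; exists t; first by rewrite cG; right.
    exact: (connected_component_half Hp Hq Hpq sN1 t1).
- move=> s ss; rewrite tminE tmaxE; split.
    move=> th d1 d2 e1 e2 ht sd1 sd2 se1 se2 <- Q.
    have [oQ lQ] := flexed_is_octahedron Hp Hq Hpq hl' hl0 ht sd1 sd2 se1 se2.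
    split=> //; exists (flexed_point p q th d1 d2 e1 e2).
      exact: (flexed_point_half Hp Hq Hpq ht sd1 sd2 se1 se2).
    exact: (half_tans_flexed Hp Hq Hpq ht sd1 sd2 se1 se2).
  move=> t Q st oQ lQ tQ.
  exact: (octahedron_flexed Hp Hq Hpq hl' hl0 ss st oQ lQ tQ).
- move=> s d1 ss sd1; rewrite tminE tmaxE; exists (loop_point p q s d1).
  have ssd : is_sign (s * d1).
    by case: ss sd1 => -> [] ->; rewrite ?mul1r ?mulN1r ?opprK; [left|right|right|left].
  split.
  + exact: (loop_point_continuous Hp Hq Hpq sd1 ss).
  + exact: loop_point_closed.
  + exact: (loop_point_inj Hp Hq Hpq ss sd1).
  + apply/seteqP; split=> [_ [tau ht <-]|t st].
      by apply: (loop_point_half Hp Hq Hpq ss sd1); move: ht; rewrite /= in_itv.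
    have [tau ht <-] := loop_point_surj Hp Hq Hpq sd1 ss st.
    by exists tau; rewrite //= in_itv.
  + move=> tau ht; have r := loop_theta_range Hp Hq Hpq ht.
    have H := half_tans_flexed Hp Hq Hpq r sd1 (loop_d2_sign tau) ssd (loop_e2_sign tau).
    exact: H.
move=> d1 sd1; rewrite tminE tmaxE.
exists (theta_at p q d1), (fun t => sgp (al_at p q d1 t true)), (fun t => sgp (be_at p q d1 t false)),
  (fun t => sgp (be_at p q d1 t true)) => Q; split.
- move=> t Gt; split; try exact: sgp_sign.
  exact: (theta_at_range Hp Hq Hpq sd1 Gt).
- move=> t Gt; have r := theta_at_range Hp Hq Hpq sd1 Gt.
  rewrite -[t in has_half_tans _ t](flexed_point_at Hp Hq Hpq sd1 Gt).
  exact: (half_tans_flexed Hp Hq Hpq r sd1 (sgp_sign _) (sgp_sign _) (sgp_sign _)).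
- move=> s t ss st; rewrite (sgp_be_at Hp Hq Hpq sd1 ss st) mulrCA -expr2.
  by rewrite sign_sqr// mulr1.
- move=> s ss; split; first exact: (theta_at_image Hp Hq Hpq sd1 ss).
  move=> x; exact: (theta_at_fiber Hp Hq Hpq sd1 ss).
- move=> u i; exact: (analytic_vertex Hp Hq Hpq sd1 u i).
Qed.
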